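(* Let $n,d\ge 1$ be integers, let $k$ be a field with $\operatorname{char}(k)\neq 2,3$, and let $k(\xi)/k$ be a quadratic extension with $\xi^2=-3$. Let $X^{2n}\subset\mathbb P^{2n+1}$, the toric variety $\mathcal T$, the divisor $\widetilde X^{2n}\subset\mathcal T$ cut out by $\widehat F=0$, and the rational map $\overline\varphi_{2n}\colon\mathbb P^{2n}\dashrightarrow X^{2n}$ be as defined in the context. Then the following hold. (i) The strict transform $\widetilde X^{2n}\subset\mathcal T$ cut out by $\widehat F=0$ has class $(2d+1,-d,-d)$ and is birational to $\mathbb P^{2n}$. That is, the rational map $\overline\varphi_{2n}\colon\mathbb P^{2n}\dashrightarrow X^{2n}$ factors through $\mathcal T$ and induces a birational correspondence $\widetilde X^{2n}\dashrightarrow X^{2n}$. For $d=1$, $X^{2n}$ is the Fermat cubic $\{x_0^3+\cdots+x_{2n+1}^3=0\}\subset\mathbb P^{2n+1}$. (ii) If $k=\mathbb F_q$ with $q\equiv 5\pmod 6$ and $\gcd(2d+1,q-1)=1$, then $$\big|\widetilde X^{2n}(\mathbb F_q)\big|=\big|\mathbb P^{2n}(\mathbb F_q)\big|=\frac{q^{2n+1}-1}{q-1}.$$ Moreover, for $n=1$ the following explicit formula holds for every prime power $q=p^m$, where $X^2\subset\mathbb P^3$ is the surface over $\mathbb F_q$ defined by $(x_0+x_1)(x_0^2-x_0x_1+x_1^2)^d+(x_2+x_3)(x_2^2-x_2x_3+x_3^2)^d=0$ and $s=\gcd(q-1,2d+1)$: - if $p\ne 2,3$, then $|X^2(\mathbb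 F_q)|=q^2+sq+1$ when $q\equiv 5\pmod 6$, and $|X^2(\mathbb F_q)|=q^2+(s+4)q+1$ when $q\equiv 1\pmod 6$; - if $p=3$, write $2d+1=3^ig$ with $3\nmid g$ and set $s'=\gcd(g,q-1)$; then $|X^2(\mathbb F_q)|=s'q^2+q+1$; - if $p=2$, then $|X^2(\mathbb F_q)|=q^2+sq+1$ when $m$ is odd, and $|X^2(\mathbb F_q)|=q^2+(s+4)q+1$ when $m$ is even. (iii) For any number field $K$ and the height $H$ induced by $\mathcal O_{X^{2n}}(1)$, one has $$\#\{x\in\widetilde X^{2n}(K):H(x)\le B\}\gg B^{\frac{2n+1}{2d+2}}\qquad(B\to\infty),$$ with the improved lower bound $B^{\frac{3}{2d+1}}$ when $n=1$.
   Context: **The hypersurface.** $X^{2n}=\left\{\sum_{i=0}^n(x_{2i}+x_{2i+1})(x_{2i}^2-x_{2i}x_{2i+1}+x_{2i+1}^2)^d=0\right\}\subset\mathbb P^{2n+1}$, of degree $2d+1$. Put $a_\pm=(1\pm\xi)/2$. Then $X^{2n}$ has multiplicity $d$ along the two skew conjugate $n$-planes $H_\pm=\{x_{2i}-a_\pm x_{2i+1}=0,\ i=0,\dots,n\}$ defined over $k(\xi)$. **The toric variety.** Over $k(\xi)$ use homogeneous coordinates $y_{2j}=x_{2j}-a_+x_{2j+1}$, $y_{2j+1}=x_{2j}-a_-x_{2j+1}$ ($j=0,\dots,n$) on $\mathbb P^{2n+1}$, so that $H_+=\{y_0=y_2=\cdots=y_{2n}=0\}$ and $H_-=\{y_1=y_3=\cdots=y_{2n+1}=0\}$.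 $\mathcal T$ is the blow-up of $\mathbb P^{2n+1}$ along $H_+\cup H_-$. It is defined over $k$, since $H_+\cup H_-$ is stable under $\operatorname{Gal}(k(\xi)/k)$, and over $k(\xi)$ it is a smooth split toric variety. Its Cox ring over $k(\xi)$ is $R=k(\xi)[z_0,\dots,z_{2n+1},w_+,w_-]$, where $z_i$ corresponds to the strict transform of $\{y_i=0\}$ and $w_\pm$ to the exceptional divisor $E_\pm$ over $H_\pm$ (so $y_{2i}=z_{2i}w_+$ and $y_{2i+1}=z_{2i+1}w_-$). The $\mathbb Z^3$-grading is $\deg z_{2i}=(1,-1,0)$, $\deg z_{2i+1}=(1,0,-1)$, $\deg w_+=(0,1,0)$, $\deg w_-=(0,0,1)$, where $(a,b,c)$ stands for the class $aH+bE_++cE_-$ in $\operatorname{Pic}(\mathcal T_{k(\xi)})=\mathbb ZH\oplus\mathbb ZE_+\oplus\mathbb ZE_-$ and $H$ is the pullback of the hyperplane class. $\mathcal T_{k(\xi)}=(\operatorname{Spec}R\setminus V(\mathfrak B))/\mathbb G_m^3$ with irrelevant ideal $\mathfrak B=(z_0,z_2,\dots,z_{2n})\cap(z_1,z_3,\dots,z_{2n+1})\cap(w_+,w_-)$. **The divisor.** Set $$\widehat S=\sum_{i=0}^nz_{2i}^dz_{2i+1}^d(w_+z_{2i}+w_-z_{2i+1}),\qquad \widehat D=\sum_{i=0}^nz_{2i}^dz_{2i+1}^d(w_+z_{2i}-w_-z_{2i+1}),$$ both of multidegree $(2d+1,-d,-d)$, and $\widehat F=3\widehat D-\xi\widehat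 S$. Then $\widetilde X^{2n}=V(\widehat F)\subset\mathcal T_{k(\xi)}$ is the strict transform of $X^{2n}$. The non-trivial element of $\operatorname{Gal}(k(\xi)/k)$ exchanges $z_{2i}\leftrightarrow z_{2i+1}$ and $w_+\leftrightarrow w_-$ and sends $\xi\mapsto-\xi$; $V(\widehat F)$ is stable under it, and $\widetilde X^{2n}$ also denotes the resulting $k$-model (the strict transform of $X^{2n}$ in $\mathcal T$ over $k$), which is used when speaking of rational points. When the base field already contains $\xi$, $\mathcal T$ and $\widetilde X^{2n}$ are given directly by these formulas. **The map $\overline\varphi_{2n}$.** On $\mathbb P^{2n}$ with coordinates $u_0,\dots,u_{2n}$ let $$\overline A=u_0^{2d+1}+\sum_{i=0}^{n-1}(u_{2i+1}+3u_{2i+2})(u_{2i+1}^2+3u_{2i+2}^2)^d,\qquad \overline B=u_0^{2d+1}+\sum_{i=0}^{n-1}(u_{2i+1}-u_{2i+2})(u_{2i+1}^2+3u_{2i+2}^2)^d.$$ Then $\overline\varphi_{2n}=[\overline\varphi_0:\cdots:\overline\varphi_{2n+1}]$ with $\overline\varphi_{2i}=\tfrac12\big((u_{2i+1}-3u_{2i+2})\overline A-3(u_{2i+1}+u_{2i+2})\overline B\big)$ and $\overline\varphi_{2i+1}=u_{2i+1}\overline A-3u_{2i+2}\overline B$ for $i=0,\dots,n-1$, $\overline\varphi_{2n}=\tfrac12u_0(\overline A-3\overline B)$, $\overline\varphi_{2n+1}=u_0\overline A$ (the last coordinates are forms; the same symbol $\overline\varphi_{2n}$ also denotes the map). **Height.**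 For $x\in\widetilde X^{2n}(K)$, $H(x)$ is the usual multiplicative height on $\mathbb P^{2n+1}(K)$ of the image of $x$ in $X^{2n}\subset\mathbb P^{2n+1}$ (over $\mathbb Q$: the maximum of the absolute values of the coordinates of a primitive integral representative). In (iii) the varieties are taken over $K$, and the implied constant is positive and independent of $B$. *)

(* Defs.v *)
From HB Require Import structures.
From mathcomp Require Import all_boot all_order all_algebra all_field.
From mathcomp Require Import boolp classical_sets functions cardinality fsbigop.
From mathcomp Require Import reals constructive_ereal counting_measure exp.
From mathcomp Require Import complex.
(* The notations of mpoly clash with those of MathComp-Analysis. *)
From mathcomp Require Import -(notations) mpoly.
From mathcomp Require Import ring.

Set Implicit Arguments.
Unset Strict Implicit.
Unset Printing Implicit Defensive.

Import Order.TTheory GRing.Theory Num.Theory.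

Local Open Scope classical_set_scope.
Local Open Scope ring_scope.

(* The variety (Spec F[x_j] \ V(irrelevant ideal)) / G_m^rk, where x_j has
   degree [wt j] in Z^rk and the irrelevant ideal is the intersection, over the
   sets S in [irr], of the ideals (x_j, j in S). *)
Record coxSpace := CoxSpace {
  nvar : nat;
  rk : nat;
  wt : 'I_nvar -> 'I_rk -> int;
  irr : seq {set 'I_nvar} }.

Section Points.
Variables (C : coxSpace) (F : fieldType).
Implicit Types p q : 'I_(nvar C) -> F.

Definition semistable p : Prop :=
  forall S, S \in irr C -> exists2 j, j \in S & p j != 0.

Definition same_orbit p q : Prop :=
  exists2 t : 'I_(rk C) -> F, forall b, t b != 0 &
    forall j, q j = (\prod_b t b ^ wt j b) * p j.

Definition orbit p : set ('I_(nvar C) -> F) := [set q | same_orbit p q].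

(* F-points of the hypersurface f = 0 (of the whole space when f = 0). *)
Definition cox_points (f : mpoly (nvar C) F) : set (set ('I_(nvar C) -> F)) :=
  [set orbit p | p in [set p | semistable p /\ meval p f = 0]].

(* f is homogeneous of degree delta in Z^rk; for the smooth varieties used here
   this means that the divisor f = 0 has class delta in Pic = Z^rk. *)
Definition multihomog (delta : 'I_(rk C) -> int) (f : mpoly (nvar C) F) : Prop :=
  forall m, m \in msupp f -> forall b, \sum_j (m j)%:Z * wt j b = delta b.

End Points.

Arguments orbit C {F} p.
Arguments semistable C {F} p.
Arguments same_orbit C {F} p q.
Arguments multihomog C {F} delta f.
Arguments cox_points C {F} f.

Section RationalMaps.
Variable F : fieldType.

Definition mpdvd N (f g : mpoly N F) : Prop := exists h, g = h * f.

(* As f = 0 is allowed, "f generates a prime ideal" rather than "f is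
   irreducible". *)
Definition prime_ideal N (f : mpoly N F) : Prop :=
  ~ mpdvd f 1 /\ forall g h, mpdvd f (g * h) -> mpdvd f g \/ mpdvd f h.

(* Some coordinate in each S of [irr C2] is not identically zero on f1 = 0. *)
Definition gen_semistable N (f1 : mpoly N F) (C2 : coxSpace)
    (G : 'I_(nvar C2) -> mpoly N F) : Prop :=
  forall S, S \in irr C2 -> exists2 j, j \in S & ~ mpdvd f1 (G j).

Definition coords N : 'I_N -> mpoly N F := fun j => mpolyX F (mnm1 j).

Definition mpcomp N1 N2 (f : mpoly N2 F) (G : 'I_N2 -> mpoly N1 F) : mpoly N1 F :=
  comp_mpoly [tuple G j | j < N2] f.

Definition mapcomp N1 N2 N3 (G2 : 'I_N3 -> mpoly N2 F) (G1 : 'I_N2 -> mpoly N1 F)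
    : 'I_N3 -> mpoly N1 F :=
  fun j => mpcomp (G2 j) G1.

(* f = 0 defines a nonempty integral closed subvariety of C. *)
Definition subvariety (C : coxSpace) (f : mpoly (nvar C) F) : Prop :=
  [/\ exists delta, multihomog C delta f,
      prime_ideal f &
      gen_semistable f (C2 := C) (@coords (nvar C))].

(* G represents a rational map from {f1 = 0} to {f2 = 0}.  The first clause makes
   G compatible with the two torus actions; for projective spaces it says that
   all the G j are forms of one and the same degree. *)
Definition ratmap (C1 : coxSpace) (f1 : mpoly (nvar C1) F)
    (C2 : coxSpace) (f2 : mpoly (nvar C2) F)
    (G : 'I_(nvar C2) -> mpoly (nvar C1) F) : Prop :=
  [/\ exists D : 'I_(rk C2) -> 'I_(rk C1) -> int,
        forall j, multihomog C1 (fun b => \sum_a wt j a * D a b) (G j),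
      mpdvd f1 (mpcomp f2 G) &
      gen_semistable f1 G].

(* Equality of the rational maps represented by G and G' on the integral variety
   {f1 = 0}: the values agree at every point, with coordinates in any extension
   field, at which both representatives are defined. *)
Definition ratmap_eq (C1 : coxSpace) (f1 : mpoly (nvar C1) F) (C2 : coxSpace)
    (G G' : 'I_(nvar C2) -> mpoly (nvar C1) F) : Prop :=
  forall (E : fieldType) (iota : {rmorphism F -> E}) (p : 'I_(nvar C1) -> E),
    semistable C1 p -> mmap iota p f1 = 0 ->
    semistable C2 (fun j => mmap iota p (G j)) ->
    semistable C2 (fun j => mmap iota p (G' j)) ->
    same_orbit C2 (fun j => mmap iota p (G j)) (fun j => mmap iota p (G' j)).

Definition birational (C1 : coxSpace) (f1 : mpoly (nvar C1) F)
    (C2 : coxSpace) (f2 : mpoly (nvar C2) F)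
    (G : 'I_(nvar C2) -> mpoly (nvar C1) F) : Prop :=
  [/\ subvariety f1, subvariety f2, ratmap f1 f2 G &
   exists G' : 'I_(nvar C1) -> mpoly (nvar C2) F,
     [/\ ratmap f2 f1 G',
         ratmap f1 f1 (mapcomp G' G),
         ratmap_eq f1 (mapcomp G' G) (@coords (nvar C1)),
         ratmap f2 f2 (mapcomp G G') &
         ratmap_eq f2 (mapcomp G G') (@coords (nvar C2))]].

End RationalMaps.

Arguments coords {F N}.
Arguments subvariety {F} C f.
Arguments ratmap {F} C1 f1 C2 f2 G.
Arguments ratmap_eq {F} C1 f1 C2 G G'.
Arguments birational {F} C1 f1 C2 f2 G.

Definition Proj (m : nat) : coxSpace :=
  @CoxSpace m.+1 1 (fun _ _ => 1) [:: [set: 'I_m.+1]%SET].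

(* The variables z_0, ..., z_{2n+1}, w_+, w_- are numbered in this order, so that
   w_+ has the even index 2n+2 and w_- the odd index 2n+3. *)
Definition toric_wt (n : nat) (j : 'I_n.*2.+4) : seq int :=
  if (j < n.*2.+2)%N then if odd j then [:: 1; 0; -1] else [:: 1; -1; 0]
  else if odd j then [:: 0; 0; 1] else [:: 0; 1; 0].

Definition toric (n : nat) : coxSpace :=
  @CoxSpace n.*2.+4 3 (fun j b => nth 0 (toric_wt j) b)
    [:: [set j : 'I_n.*2.+4 | (j < n.*2.+2)%N && ~~ odd j]%SET;
        [set j : 'I_n.*2.+4 | (j < n.*2.+2)%N && odd j]%SET;
        [set j : 'I_n.*2.+4 | (n.*2.+2 <= j)%N]%SET].

Section Equations.
Variables (F : fieldType) (n d : nat).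

Definition var N (i : nat) : mpoly N.+1 F := mpolyX F (mnm1 (inord i)).

Local Notation x := (@var n.*2.+1).
Local Notation z := (@var n.*2.+3).
Local Notation w_plus := (@var n.*2.+3 n.*2.+2).
Local Notation w_minus := (@var n.*2.+3 n.*2.+3).
Local Notation u := (@var n.*2).

Definition hypX : mpoly n.*2.+2 F :=
  \sum_(i < n.+1) (x i.*2 + x i.*2.+1) *
    (x i.*2 ^+ 2 - x i.*2 * x i.*2.+1 + x i.*2.+1 ^+ 2) ^+ d.

Definition fermat_cubic : mpoly n.*2.+2 F := \sum_(j < n.*2.+2) x j ^+ 3.

Definition Shat : mpoly n.*2.+4 F :=
  \sum_(i < n.+1) z i.*2 ^+ d * z i.*2.+1 ^+ d *
    (w_plus * z i.*2 + w_minus * z i.*2.+1).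

Definition Dhat : mpoly n.*2.+4 F :=
  \sum_(i < n.+1) z i.*2 ^+ d * z i.*2.+1 ^+ d *
    (w_plus * z i.*2 - w_minus * z i.*2.+1).

Definition Fhat (xi : F) : mpoly n.*2.+4 F := 3%:R *: Dhat - xi *: Shat.

Definition Fhat_class : 'I_3 -> int :=
  fun b => nth 0 [:: (d.*2.+1)%:Z; - d%:Z; - d%:Z] b.

Definition Abar : mpoly n.*2.+1 F :=
  u 0 ^+ d.*2.+1 + \sum_(i < n) (u i.*2.+1 + 3%:R *: u i.*2.+2) *
    (u i.*2.+1 ^+ 2 + 3%:R *: u i.*2.+2 ^+ 2) ^+ d.

Definition Bbar : mpoly n.*2.+1 F :=
  u 0 ^+ d.*2.+1 + \sum_(i < n) (u i.*2.+1 - u i.*2.+2) *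
    (u i.*2.+1 ^+ 2 + 3%:R *: u i.*2.+2 ^+ 2) ^+ d.

Definition phi_even (i : nat) : mpoly n.*2.+1 F :=
  if (i < n)%N then
    2%:R^-1 *: ((u i.*2.+1 - 3%:R *: u i.*2.+2) * Abar
                - 3%:R *: (u i.*2.+1 + u i.*2.+2) * Bbar)
  else 2%:R^-1 *: (u 0 * (Abar - 3%:R *: Bbar)).

Definition phi_odd (i : nat) : mpoly n.*2.+1 F :=
  if (i < n)%N then u i.*2.+1 * Abar - 3%:R *: u i.*2.+2 * Bbar
  else u 0 * Abar.

Definition phi (j : 'I_n.*2.+2) : mpoly n.*2.+1 F :=
  if odd j then phi_odd j./2 else phi_even j./2.

Section Blowdown.
Variable xi : F.

Definition a_plus : F := (1 + xi) / 2%:R.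
Definition a_minus : F := (1 - xi) / 2%:R.

Definition y_even (i : nat) : mpoly n.*2.+4 F := z i.*2 * w_plus.
Definition y_odd (i : nat) : mpoly n.*2.+4 F := z i.*2.+1 * w_minus.

(* The blow-down T -> P^{2n+1} in the coordinates x_j, obtained by solving
   y_{2i} = x_{2i} - a_+ x_{2i+1}, y_{2i+1} = x_{2i} - a_- x_{2i+1}; see
   [blowdown_y]. *)
Definition blowdown (j : 'I_n.*2.+2) : mpoly n.*2.+4 F :=
  let i := (j : nat)./2 in
  if odd j then xi^-1 *: (y_odd i - y_even i)
  else xi^-1 *: (a_plus *: y_odd i - a_minus *: y_even i).

Lemma blowdown_y (i : nat) : (i <= n)%N -> 2%:R != 0 :> F -> xi != 0 ->
  blowdown (inord i.*2) - a_plus *: blowdown (inord i.*2.+1) = y_even i /\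
  blowdown (inord i.*2) - a_minus *: blowdown (inord i.*2.+1) = y_odd i.
Proof.
move=> le_in nz2 nzxi.
have le2 : (i.*2 <= n.*2)%N by rewrite leq_double.
have solve a o e : xi^-1 *: (a_plus *: o - a_minus *: e) - a *: (xi^-1 *: (o - e))
    = ((a_plus - a) / xi) *: o + ((a - a_minus) / xi) *: e :> mpoly n.*2.+4 F.
  rewrite !scalerBr !scalerA !mulrBl !scalerBl opprB ![xi^-1 * _]mulrC.
  by rewrite addrACA [- _ + _]addrC [_ *: e - _]addrC addrACA [_ *: e - _]addrC.
have Ea : (a_plus - a_minus) / xi = 1.
  by rewrite /a_plus /a_minus; field; rewrite nz2 nzxi.
rewrite /blowdown !inordK ?ltnS ?(leq_trans le2) //= odd_double /=.
rewrite uphalf_double doubleK !solve Ea !subrr !mul0r !scale0r !scale1r.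
by rewrite addr0 add0r.
Qed.

(* The divisor g = 0 of T is the strict transform of the hypersurface f = 0: the
   pull-back of the latter is the sum of the former and of multiples of E_+ and
   E_-, and the former contains neither E_+ nor E_-. *)
Definition strict_transform (f : mpoly n.*2.+2 F) (g : mpoly n.*2.+4 F) : Prop :=
  [/\ exists c : F, exists a b : nat,
        c != 0 /\ mpcomp f blowdown = c *: (w_plus ^+ a * w_minus ^+ b * g),
      ~ mpdvd w_plus g &
      ~ mpdvd w_minus g].

End Blowdown.
End Equations.

Arguments hypX F n d : clear implicits.
Arguments fermat_cubic F n : clear implicits.
Arguments phi F n d j : clear implicits.
Arguments Fhat {F} n d xi.
Arguments blowdown {F} n xi j.
Arguments strict_transform {F} n xi f g.

Section Descent.
Variables (k : fieldType) (L : fieldExtType k) (xi : L) (n d : nat).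

(* 'AEnd(L) is the group of k-automorphisms of L. *)
Definition swap_index (sigma : 'AEnd(L)) (j : 'I_n.*2.+4) : 'I_n.*2.+4 :=
  if sigma xi == xi then j else inord (if odd j then j.-1 else j.+1).

Definition gal_point (sigma : 'AEnd(L)) (p : 'I_(nvar (toric n)) -> L)
    : 'I_(nvar (toric n)) -> L :=
  fun j => sigma (p (swap_index sigma j)).

(* k-points of the strict transform.  If xi lies in k and L = k(xi) = k, the
   condition on sigma is void. *)
Definition Xtilde_points : set (set ('I_(nvar (toric n)) -> L)) :=
  [set O | cox_points (toric n) (Fhat n d xi) O /\
           forall sigma : 'AEnd(L), gal_point sigma @` O = O].

(* The rational maps represented by psi : P^m -> T, resp. by G : Xtilde -> P^m,
   are defined over k, T being equipped with its twisted k-structure. *)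
Definition descends_to m (psi : 'I_(nvar (toric n)) -> mpoly m.+1 L) : Prop :=
  forall sigma : 'AEnd(L),
    ratmap_eq (Proj m) 0 (toric n)
      (fun j => map_mpoly sigma (psi (swap_index sigma j))) psi.

Definition descends_from m (G : 'I_m.+1 -> mpoly (nvar (toric n)) L) : Prop :=
  forall sigma : 'AEnd(L),
    ratmap_eq (toric n) (Fhat n d xi) (Proj m)
      (mapcomp (fun j => map_mpoly sigma (G j))
         (fun l => coords (swap_index sigma l))) G.

End Descent.

Section Height.
Variables (R : realType) (K : fieldExtType rat).

(* Normalised non-archimedean absolute values: those of a discrete valuation,
   with |pi| = 1/q for a uniformiser pi, q the cardinality of the residue
   field. *)
Definition residue_classes (v : K -> R) : set (set K) :=
  [set [set b | v b <= 1 /\ v (b - a) < 1] | a in [set a | v a <= 1]].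

Definition finite_places : set (K -> R) :=
  [set v | [/\ v 0 = 0 /\ (forall a, a != 0 -> 0 < v a),
               forall a b, v (a * b) = v a * v b,
               forall a b, v (a + b) <= Num.max (v a) (v b) &
               exists q : nat, [/\ (residue_classes v #= `I_q)%card,
                 exists pi, v pi = q%:R^-1 &
                 forall a, a != 0 -> exists m : int, v a = q%:R ^ m]]].

(* A complex place is counted through its two conjugate embeddings, whence its
   absolute value is squared as it should. *)
Definition embeddings : set (K -> R[i]) :=
  range (fun f : {rmorphism K -> R[i]} => f : K -> R[i]).

(* The height relative to K, i.e. without the exponent 1/[K : Q]. *)
Definition height N (c : 'I_N -> K) : R :=
  (\big[*%R/1]_(v \in finite_places) \big[Num.max/0]_(i < N) v (c i)) *
  (\big[*%R/1]_(f \in embeddings)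
     \big[Num.max/0]_(i < N) ComplexField.Normc.normc (f (c i))).

Variables (L : fieldExtType K) (xi : L) (n d : nat).

(* The point of T with Cox coordinates in O is mapped to the point of
   P^{2n+1}(K) with coordinates c. *)
Definition image_point (O : set ('I_(nvar (toric n)) -> L))
    (c : 'I_n.*2.+2 -> K) : Prop :=
  exists2 p, O p &
    same_orbit (Proj n.*2.+1) (fun j => (c j)%:A)
      (fun j => meval p (blowdown n xi j)).

Definition Xtilde_points_le (B : R) : set (set ('I_(nvar (toric n)) -> L)) :=
  [set O | Xtilde_points xi d O /\ exists2 c, image_point O c & height c <= B].

End Height.

Arguments Xtilde_points {k L} xi n d.
Arguments Xtilde_points_le {R K L} xi n d B.
Arguments descends_to {k L} xi {n m} psi.
Arguments descends_from {k L} xi n d {m} G.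

Definition quadratic_setting (k : fieldType) (L : fieldExtType k) (xi : L) : Prop :=
  [/\ 2%N \notin [pchar k], 3%N \notin [pchar k], \dim {:L} = 2%N,
      <<1; xi>>%VS = {:L}%VS & xi ^+ 2 = - 3%:R].

(* Main.v *)
Require Import Defs.
From HB Require Import structures.
From mathcomp Require Import all_boot all_order all_algebra all_field.
From mathcomp Require Import boolp classical_sets functions cardinality fsbigop.
From mathcomp Require Import reals constructive_ereal counting_measure exp.
From mathcomp Require Import complex.
From mathcomp Require Import -(notations) mpoly.
From mathcomp Require Import ring zify.

Set Implicit Arguments.
Unset Strict Implicit.
Unset Printing Implicit Defensive.

Import Order.TTheory GRing.Theory Num.Theory.

Local Open Scope classical_set_scope.
Local Open Scope ring_scope.


(** * Polynomial substitution *)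

Section Substitution.
Variables (F : comNzRingType) (N : nat).
Implicit Types (f g : mpoly N F).

Lemma mmap_ext (S : nzRingType) (i1 i2 : F -> S) (v1 v2 : 'I_N -> S) f :
  i1 =1 i2 -> v1 =1 v2 -> mmap i1 v1 f = mmap i2 v2 f.
Proof.
move=> Ei Ev; apply: eq_bigr => m _; rewrite Ei; congr (_ * _).
exact: mmap1_eq.
Qed.

Lemma rmorph_mmap (S : comNzRingType) (h : {rmorphism mpoly N F -> S}) f :
  h f = mmap (h \o @mpolyC N F) (fun i => h (mpolyX F (mnm1 i))) f.
Proof.
rewrite {1}[f]mpolyE rmorph_sum; apply: eq_bigr => m _ /=.
rewrite -mul_mpolyC rmorphM; congr (_ * _).
by rewrite mpolyXE_id rmorph_prod; apply: eq_bigr => i _; rewrite rmorphXn.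
Qed.

Lemma mmapXU (S : comNzRingType) (i : {rmorphism F -> S}) (v : 'I_N -> S) j :
  mmap i v (mpolyX F (mnm1 j)) = v j.
Proof. by rewrite mmapX mmap1U. Qed.

Lemma mmap_id f : mmap (@mpolyC N F) (fun i => mpolyX F (mnm1 i)) f = f.
Proof. by rewrite [RHS](@rmorph_mmap _ idfun). Qed.

Lemma mmap_rmorph (S T : comNzRingType) (h : {rmorphism S -> T})
    (i : {rmorphism F -> S}) (v : 'I_N -> S) f :
  h (mmap i v f) = mmap (h \o i) (h \o v) f.
Proof.
rewrite [LHS](@rmorph_mmap _ (h \o mmap i v)); apply: mmap_ext => j /=.
  by rewrite mmapC.
by rewrite mmapXU.
Qed.

End Substitution.

Section Composition.
Variables (F : fieldType) (N1 N2 : nat).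
Implicit Types (f : mpoly N2 F) (G : 'I_N2 -> mpoly N1 F).

Lemma mpcompE f G : mpcomp f G = mmap (@mpolyC N1 F) G f.
Proof. by apply: mmap_ext => j //; rewrite tnth_mktuple. Qed.

Lemma mmap_mpcomp (S : comNzRingType) (i : {rmorphism F -> S})
    (v : 'I_N1 -> S) f G :
  mmap i v (mpcomp f G) = mmap i (fun j => mmap i v (G j)) f.
Proof.
by rewrite mpcompE (mmap_rmorph (mmap i v)); apply: mmap_ext => c //=; rewrite mmapC.
Qed.

Lemma meval_mpcomp (v : 'I_N1 -> F) f G :
  meval v (mpcomp f G) = meval (fun j => meval v (G j)) f.
Proof. exact: (mmap_mpcomp idfun). Qed.

Lemma mpcomp0 G : mpcomp 0 G = 0.
Proof. by rewrite mpcompE mmap0. Qed.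

Lemma mpcompM f g G : mpcomp (f * g) G = mpcomp f G * mpcomp g G.
Proof. by rewrite !mpcompE rmorphM. Qed.

Lemma mpcompX j G : mpcomp (mpolyX F (mnm1 j)) G = G j.
Proof. by rewrite mpcompE mmapXU. Qed.

End Composition.

Lemma mpcompA (F : fieldType) N1 N2 N3 (f : mpoly N3 F)
    (G : 'I_N2 -> mpoly N1 F) (H : 'I_N3 -> mpoly N2 F) :
  mpcomp (mpcomp f H) G = mpcomp f (mapcomp H G).
Proof.
rewrite (mpcompE _ G) mmap_mpcomp mpcompE.
by apply: mmap_ext => // j; rewrite /mapcomp mpcompE.
Qed.

Lemma mpcomp_coords (F : fieldType) N (f : mpoly N F) : mpcomp f coords = f.
Proof. by rewrite mpcompE mmap_id. Qed.

Section Divisibility.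
Variables (F : fieldType) (N : nat).
Implicit Types (f g : mpoly N F).

Lemma mpdvd0 f : mpdvd f 0.
Proof. by exists 0; rewrite mul0r. Qed.

Lemma mpdvd_mull f g h : mpdvd f g -> mpdvd f (h * g).
Proof. by case=> e ->; exists (h * e); rewrite mulrA. Qed.

Lemma mpdvd_comp N' (G : 'I_N -> mpoly N' F) f g :
  mpdvd f g -> mpdvd (mpcomp f G) (mpcomp g G).
Proof. by case=> e ->; exists (mpcomp e G); rewrite mpcompM. Qed.

Lemma mpdvd_meval f g (v : 'I_N -> F) :
  mpdvd f g -> meval v f = 0 -> meval v g = 0.
Proof. by case=> e -> v0; rewrite mevalM v0 mulr0. Qed.

End Divisibility.

(** * Multigraded polynomials *)

Section Weights.
Variable F : fieldType.

Definition homw N (w : 'I_N -> int) (e : int) (f : mpoly N F) : bool :=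
  all (fun m : multinom N => \sum_j (m j)%:Z * w j == e) (msupp f).

Lemma homwP N (w : 'I_N -> int) (e : int) (f : mpoly N F) :
  reflect (forall m, m \in msupp f -> \sum_j (m j)%:Z * w j = e) (homw w e f).
Proof. by apply: (iffP allP) => h m /h /eqP. Qed.

Section Ops.
Variables (N : nat) (w : 'I_N -> int).
Implicit Types (e : int) (f g : mpoly N F).

Lemma homw0 e : homw w e 0.
Proof. by apply/homwP => m; rewrite msupp0. Qed.

Lemma homwD e f g : homw w e f -> homw w e g -> homw w e (f + g).
Proof.
by move=> /homwP hf /homwP hg; apply/homwP => m /msuppD_le; rewrite mem_cat => /orP[/hf|/hg].
Qed.

Lemma homw_sum (I : Type) (r : seq I) (P : pred I) e (f : I -> mpoly N F) :
  (forall i, P i -> homw w e (f i)) -> homw w e (\sum_(i <- r | P i) f i).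
Proof.
by move=> h; elim/big_ind: _ => //; [exact: homw0 | move=> f1 f2; exact: homwD].
Qed.

Lemma homwN e f : homw w e f -> homw w e (- f).
Proof. by move=> /homwP hf; apply/homwP => m; rewrite (perm_mem (msuppN f)) => /hf. Qed.

Lemma homwB e f g : homw w e f -> homw w e g -> homw w e (f - g).
Proof. by move=> hf hg; apply/homwD/homwN. Qed.

Lemma homwZ e c f : homw w e f -> homw w e (c *: f).
Proof. by move=> /homwP hf; apply/homwP => m /msuppZ_le /hf. Qed.

Lemma homwM e1 e2 f g : homw w e1 f -> homw w e2 g -> homw w (e1 + e2) (f * g).
Proof.
move=> /homwP hf /homwP hg; apply/homwP => m /msuppM_le /allpairsP[[m1 m2] /= [/hf <- /hg <- ->]].
by rewrite -big_split; apply: eq_bigr => j _; rewrite mnmDE PoszD mulrDl.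
Qed.

Lemma homwC c : homw w 0 (mpolyC N c).
Proof.
apply/homwP => m; rewrite msuppC; case: ifP => // _; rewrite inE => /eqP ->.
by rewrite big1 // => j _; rewrite mnm0E mul0r.
Qed.

Lemma homwXn e f n : homw w e f -> homw w (e *+ n) (f ^+ n).
Proof.
move=> hf; elim: n => [|n IH]; first by rewrite expr0; exact: homwC.
by rewrite exprS mulrS; apply: homwM.
Qed.

Lemma homw_prod (I : Type) (r : seq I) (e : I -> int) (f : I -> mpoly N F) :
  (forall i, homw w (e i) (f i)) -> homw w (\sum_(i <- r) e i) (\prod_(i <- r) f i).
Proof.
move=> hf; elim: r => [|i r IH]; first by rewrite !big_nil; exact: homwC.
by rewrite !big_cons; apply: homwM.
Qed.

Lemma homwX j : homw w (w j) (mpolyX F (mnm1 j)).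
Proof.
apply/homwP => m; rewrite msuppX inE => /eqP ->.
rewrite (bigD1 j) //= mnm1E eqxx mul1r big1 ?addr0 // => i ij.
by rewrite mnm1E eq_sym (negPf ij) mul0r.
Qed.

End Ops.

Lemma homw_comp N1 N2 (w1 : 'I_N1 -> int) (w2 : 'I_N2 -> int) e
    (f : mpoly N2 F) (G : 'I_N2 -> mpoly N1 F) :
  homw w2 e f -> (forall j, homw w1 (w2 j) (G j)) -> homw w1 e (mpcomp f G).
Proof.
move=> /homwP hf hG; rewrite mpcompE /mmap big_seq; apply: homw_sum => m /hf <-.
rewrite mul_mpolyC; apply/homwZ/homw_prod => j.
by rewrite mulrC -[X in _ * X]natz mulr_natr; apply: homwXn.
Qed.

Lemma multihomogP (C : coxSpace) (delta : 'I_(rk C) -> int) (f : mpoly (nvar C) F) :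
  multihomog C delta f <-> forall b, homw (fun j => wt j b) (delta b) f.
Proof.
split=> [h b|h m mf b]; first by apply/homwP => m mf; apply: h.
by have /homwP := h b; apply.
Qed.

Lemma multihomog_comp (C1 C2 : coxSpace) (delta : 'I_(rk C2) -> int)
    (D : 'I_(rk C2) -> 'I_(rk C1) -> int) (f : mpoly (nvar C2) F)
    (G : 'I_(nvar C2) -> mpoly (nvar C1) F) :
  multihomog C2 delta f ->
  (forall j, multihomog C1 (fun b => \sum_a wt j a * D a b) (G j)) ->
  multihomog C1 (fun b => \sum_a delta a * D a b) (mpcomp f G).
Proof.
move=> hf hG; apply/multihomogP => b.
apply: (homw_comp (w2 := fun j => \sum_a wt j a * D a b)) => [|j]; last first.
  by have /multihomogP := hG j; apply.
apply/homwP => m mf; under eq_bigr do rewrite mulr_sumr.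
rewrite exchange_big; apply: eq_bigr => a _ /=.
by rewrite -(hf m mf a) mulr_suml; apply: eq_bigr => j _; rewrite mulrA.
Qed.

End Weights.

(** * Regular pairs and prime elements *)

Section Regular.
Variable R : idomainType.
Implicit Types a b c p q r : R.

Definition rdvd p q : Prop := exists h, q = h * p.

(** For a unique factorisation domain and p <> 0 this is coprimality. *)
Definition regular p q : Prop := forall r, rdvd p (q * r) -> rdvd p r.

Definition prime_elt p : Prop :=
  ~ rdvd p 1 /\ forall q r, rdvd p (q * r) -> rdvd p q \/ rdvd p r.

Lemma rdvd_mull p q r : rdvd p q -> rdvd p (r * q).
Proof. by case=> h ->; exists (r * h); rewrite mulrA. Qed.

Lemma rdvdD p q r : rdvd p q -> rdvd p r -> rdvd p (q + r).
Proof. by case=> h -> [g ->]; exists (h + g); rewrite mulrDl. Qed.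

Lemma rdvdB p q r : rdvd p q -> rdvd p r -> rdvd p (q - r).
Proof. by case=> h -> [g ->]; exists (h - g); rewrite mulrBl. Qed.

Lemma rdvd_id p : rdvd p p.
Proof. by exists 1; rewrite mul1r. Qed.

Lemma regular_sym p q : p != 0 -> regular p q -> regular q p.
Proof.
move=> p0 pq r [s e]; have [|t es] := pq s; first by exists r; rewrite mulrC -e mulrC.
by exists t; apply: (mulfI p0); rewrite e es; ring.
Qed.

Lemma regularM p a b : regular p a -> regular p b -> regular p (a * b).
Proof. by move=> ha hb r; rewrite -mulrA => /ha/hb. Qed.

Lemma regularX p a (m : nat) : regular p a -> regular p (a ^+ m).
Proof.
move=> ha; elim: m => [|m IH]; first by move=> r; rewrite expr0 mul1r.
by rewrite exprS; apply: regularM.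
Qed.

Lemma regular_comb p q c u v : regular p c -> c = u * p + v * q -> regular p q.
Proof.
move=> hc ec r pqr; apply: hc; rewrite ec mulrDl; apply: rdvdD.
  by rewrite mulrAC; apply/rdvd_mull/rdvd_id.
by rewrite -mulrA; apply: rdvd_mull.
Qed.

Lemma regular_unit p q u v : u \is a GRing.unit -> v \is a GRing.unit ->
  regular p q -> regular (u * p) (v * q).
Proof.
move=> uu vu pq r [h e]; have [|t et] := pq r.
  have -> : q * r = v^-1 * (v * q * r) by rewrite !mulrA mulVr // mul1r.
  by rewrite e; exists (v^-1 * h * u); ring.
by exists (t * u^-1); rewrite et mulrA mulrVK.
Qed.

End Regular.

Section Transfer.
Variables (R S : idomainType) (h : {rmorphism R -> S}).
Hypotheses (h_inj : injective h) (h_surj : forall y, exists x, h x = y).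

Lemma rdvd_iso p q : rdvd (h p) (h q) <-> rdvd p q.
Proof.
split=> [[y]|[x ->]]; last by exists (h x); rewrite rmorphM.
by have [x <-] := h_surj y; rewrite -rmorphM => /h_inj ->; exists x.
Qed.

Lemma regular_iso p q : regular (h p) (h q) -> regular p q.
Proof. by move=> hr r /rdvd_iso; rewrite rmorphM => /hr/rdvd_iso. Qed.

Lemma prime_elt_iso p : prime_elt (h p) -> prime_elt p.
Proof.
case=> h1 hM; split=> [/rdvd_iso|q r /rdvd_iso]; first by rewrite rmorph1.
by rewrite rmorphM => /hM[/rdvd_iso|/rdvd_iso]; [left | right].
Qed.

End Transfer.

Section Univariate.
Variable R : idomainType.
Implicit Types (a c : R) (p q r f g h : {poly R}).

Lemma rdvd_polyC c p : (forall i, rdvd c p`_i) -> rdvd c%:P p.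
Proof.
move=> hc; have [h eh] := choice hc.
exists (\poly_(i < size p) h i); apply/polyP => i.
rewrite coefMC coef_poly; case: ltnP => [_|le]; first exact: eh.
by rewrite nth_default // mul0r.
Qed.

Lemma regular_lead c p : regular c (lead_coef p) -> regular c%:P p.
Proof.
move=> hc r; have [m] := ubnP (size r); elim: m r => // m IH r; rewrite ltnS => sr dvd.
have [->|r0] := eqVneq r 0; first by exists 0; rewrite mul0r.
have [t et] : rdvd c (lead_coef r).
  by apply: hc; case: dvd => h e; exists (lead_coef h); rewrite -lead_coefM e lead_coefM lead_coefC.
have dt : rdvd c%:P (lead_coef r *: 'X^((size r).-1)).
  by exists (t *: 'X^((size r).-1)); rewrite et -!mul_polyC polyCM; ring.
have -> : r = (r - lead_coef r *: 'X^((size r).-1)) + lead_coef r *: 'X^((size r).-1) by ring.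
apply: (rdvdD _ dt); apply: IH; last by rewrite mulrBr; apply: rdvdB => //; apply: rdvd_mull.
apply: leq_trans sr; rewrite -[X in (_ < X)%N]prednK ?size_poly_gt0 // ltnS.
apply/leq_sizeP => j; rewrite leq_eqVlt => /orP[/eqP <-|lj].
  by rewrite coefB coefZ coefXn eqxx mulr1 subrr.
rewrite coefB coefZ coefXn gtn_eqF // mulr0 subr0 nth_default //.
by move: lj; rewrite prednK ?size_poly_gt0.
Qed.

(** Gauss's lemma in degree one: pseudo-division by [a 'X + c] only introduces
    powers of [a], and these cancel because [a] is regular against [c]. *)
Lemma linear_prime a c : a != 0 -> regular a c ->
  prime_elt (a%:P * 'X + c%:P).
Proof.
move=> a0 ac; set f := _ + _.
have [sf lf] : size f = 2%N /\ lead_coef f = a.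
  split; first by rewrite /f size_MXaddC polyC_eq0 (negPf a0) size_polyC a0.
  by rewrite /f lead_coefDl ?lead_coefMX ?lead_coefC // size_mulX ?polyC_eq0 // !size_polyC a0; case: (c != 0).
have f0 : f != 0 by rewrite -size_poly_gt0 sf.
have reg_f : regular a%:P f.
  move=> r [h e]; apply: (regular_lead (p := c%:P)); first by rewrite lead_coefC.
  by exists (h - 'X * r); rewrite mulrBl -e /f; ring.
have descend g : f %| g -> rdvd f g.
  rewrite Pdiv.Idomain.dvdp_eq lf => /eqP; move: (_ %/ _) => h.
  elim: (scalp g f) h => [|m IH] h; first by rewrite expr0 scale1r => ->; exists h.
  rewrite exprS -scalerA => e.
  have [|h' eh] := reg_f h.
    by exists (a ^+ m *: g); rewrite mulrC -e -mul_polyC mulrC.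
  apply: (IH h'); apply: (@mulfI _ a%:P); first by rewrite polyC_eq0.
  by rewrite mul_polyC e eh; ring.
split=> [[h /(congr1 (size \o polyseq))] /=|g h].
  rewrite size_poly1; have [->|h0] := eqVneq h 0; first by rewrite mul0r size_poly0.
  by rewrite size_mul // sf addn2 /= => -[/esym/eqP]; rewrite size_poly_eq0 (negPf h0).
case=> e ge; have fgh : f %| g * h by rewrite ge dvdp_mulIr.
have [fg|nfg] := boolP (f %| g); first by left; apply: descend.
right; apply: descend; rewrite -(Gauss_dvdpr h (q := g)) // coprimep_def.
have : (size (gcdp f g) <= 2)%N by rewrite -sf dvdp_leq ?dvdp_gcdl.
rewrite leq_eqVlt => /orP[/eqP s2|]; last first.
  by rewrite ltnS leq_eqVlt ltnS leqn0 size_poly_eq0 gcdp_eq0 (negPf f0) orbF.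
case/negP: nfg; have := dvdp_gcdl f g.
by move=> /dvdp_size_eqp; rewrite s2 sf eqxx => /esym/eqp_dvdl <-; apply: dvdp_gcdr.
Qed.

End Univariate.

(** In [D[X]] the two polynomials are Euclid-reduced to the constant
    [rho = b^(2d+1) q^d + p^(d+1)] of [D], which is prime to [b] and hence
    regular against anything whose leading coefficient is a power of [b]. *)
Lemma regular_pair (D : idomainType) (b p q : D) (d : nat) : (0 < d)%N ->
    b != 0 -> regular b p -> ~ rdvd b p ->
  regular ((b ^+ d.+1)%:P * 'X^d + p%:P) ((b ^+ d)%:P * 'X^(d.+1) + q%:P).
Proof.
move=> d0 b0 bp nbp; set P := _ + p%:P; set Q := _ + q%:P.
pose rho := b ^+ d.*2.+1 * q ^+ d + p ^+ d.+1.
have reg_b : regular b rho.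
  move=> r [h e]; move: (regularX (m := d.+1) bp) => bpX; apply: bpX; exists (h - b ^+ d.*2 * q ^+ d * r).
  by rewrite mulrBl -e /rho (exprS b); ring.
have rho0 : rho != 0.
  apply/eqP => r0; have [|h /esym/eqP] := reg_b 1; first by exists 0; rewrite r0 !mul0r.
  by move=> /eqP e; apply: nbp; exists (h * p); rewrite mulrAC e mul1r.
have lP : lead_coef P = b ^+ d.+1.
  rewrite /P -['X^d]mulr1 mulrA mulr1.
  have -> : (b ^+ d.+1)%:P * 'X^d = b ^+ d.+1 *: 'X^d by rewrite mul_polyC.
  have bn : b ^+ d.+1 != 0 by rewrite expf_neq0.
  rewrite lead_coefDl ?lead_coefZ ?lead_coefXn ?mulr1 //.
  by rewrite size_scale // size_polyXn (leq_ltn_trans (size_polyC_leq1 _)).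
have P0 : P != 0 by rewrite -lead_coef_eq0 lP expf_neq0.
have reg_rho : regular P rho%:P.
  apply: regular_sym; first by rewrite polyC_eq0.
  by apply: regular_lead; rewrite lP; apply/regularX/regular_sym.
pose u : {poly D} := b%:P * q%:P; pose v : {poly D} := p%:P * 'X.
pose S := \sum_(i < d) v ^+ (d.-1 - i) * u ^+ i.
have eS : v ^+ d - u ^+ d = (v - u) * S by apply: subrXX.
apply: (regular_comb reg_rho (u := p%:P ^+ d - (b ^+ d.+1)%:P * S * 'X)
  (v := (b ^+ d.+1)%:P * S * b%:P)).
have -> : rho%:P = p%:P ^+ d * P - (b ^+ d.+1)%:P * (v ^+ d - u ^+ d).
  rewrite /rho /P /u /v polyCD !polyCM !rmorphXn /= !exprMn !exprS -addnn exprD; ring.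
by rewrite eS /P /Q /v /u !rmorphXn /= !exprS; ring.
Qed.

(** * Polynomials in the last variable *)

Section LastVariable.
Variables (F : fieldType) (N : nat).

Lemma muni_max : muni (mpolyX F (mnm1 (@ord_max N))) = 'X.
Proof.
rewrite /muni /= mmapX mmap1U; case: splitP => //.
by case=> j lt_jn /eqP /=; have := lt_jn; rewrite ltn_neqAle eq_sym=> /andP[/negbTE->].
Qed.

Lemma muni_widen (i : 'I_N) :
  muni (mpolyX F (mnm1 (widen_ord (leqnSn N) i))) = (mpolyX F (mnm1 i))%:P.
Proof.
rewrite /muni /= mmapX mmap1U; case: splitP => [j eq|j].
  by do 3! congr (_ _); apply/val_inj=> /=; rewrite -eq.
by rewrite ord1 /= addn0 => /eqP /=; rewrite ltn_eqF.
Qed.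

Lemma muni_inj : injective (@muni N F).
Proof.
pose Xmax := mpolyX F (mnm1 (@ord_max N)).
pose h : {rmorphism {poly mpoly N F} -> mpoly N.+1 F} :=
  horner_eval Xmax \o map_poly (@mwiden N F).
apply: (can_inj (g := h)) => f; rewrite -[RHS]mmap_id.
rewrite [LHS](rmorph_mmap (h \o @muni N F)); apply: mmap_ext => i /=.
  by rewrite muniC /horner_eval map_polyC hornerC /= mwidenC.
rewrite /horner_eval; have [->|ltiN] := eqVneq i ord_max.
  by rewrite muni_max map_polyX hornerX.
have {ltiN} ltiN : (i < N)%N by rewrite ltn_neqAle -ltnS ltn_ord andbT.
have -> : i = widen_ord (leqnSn N) (Ordinal ltiN) by apply: val_inj.
rewrite muni_widen map_polyC hornerC /= mwidenX mnmwiden1 //.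
Qed.

Lemma muni_surj (p : {poly mpoly N F}) : exists f, muni f = p.
Proof.
exists (mmulti p); rewrite /mmulti rmorph_sum /= -[RHS]coefK poly_def.
apply: eq_bigr => i _; rewrite rmorphM rmorphXn /= muni_max -mul_polyC.
congr (_ * _).
have /= -> := rmorph_mmap (@muni N F \o @mwiden N F) p`_i.
rewrite -[in RHS](mmap_id p`_i) (mmap_rmorph (@polyC (mpoly N F))).
apply: mmap_ext => j /=; first by rewrite mwidenC muniC.
by rewrite mwidenX mnmwiden1 muni_widen.
Qed.

Lemma regular_muni (p q : mpoly N.+1 F) : regular (muni p) (muni q) -> regular p q.
Proof. exact: regular_iso muni_inj muni_surj p q. Qed.

Lemma prime_muni (p : mpoly N.+1 F) : prime_elt (muni p) -> prime_elt p.
Proof. exact: prime_elt_iso muni_inj muni_surj p. Qed.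

End LastVariable.

(** * Values of the equations *)

Section Values.
Variables (S : comNzRingType) (n d : nat).
Implicit Types (v : nat -> S) (x : S).

Definition Pval v := \sum_(i < n.+1) v i.*2 ^+ d.+1 * v i.*2.+1 ^+ d.
Definition Qval v := \sum_(i < n.+1) v i.*2 ^+ d * v i.*2.+1 ^+ d.+1.
Definition Fval x v :=
  (3%:R - x) * v n.*2.+2 * Pval v - (3%:R + x) * v n.*2.+3 * Qval v.

Definition normval (a b : S) := a ^+ 2 - a * b + b ^+ 2.

Definition Xval v :=
  \sum_(i < n.+1) (v i.*2 + v i.*2.+1) * normval (v i.*2) (v i.*2.+1) ^+ d.

Lemma val_index_le i : (i <= n)%N -> (i.*2 <= n.*2.+1)%N && (i.*2.+1 <= n.*2.+1)%N.
Proof. by move=> le; rewrite ltnS leq_double le andbT leqW // leq_double. Qed.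

Lemma Pval_ext v w : (forall t, (t <= n.*2.+1)%N -> v t = w t) -> Pval v = Pval w.
Proof.
by move=> vw; apply: eq_bigr => -[i /= /val_index_le/andP[? ?]] _; rewrite !vw.
Qed.

Lemma Qval_ext v w : (forall t, (t <= n.*2.+1)%N -> v t = w t) -> Qval v = Qval w.
Proof.
by move=> vw; apply: eq_bigr => -[i /= /val_index_le/andP[? ?]] _; rewrite !vw.
Qed.

Lemma Xval_ext v w : (forall t, (t <= n.*2.+1)%N -> v t = w t) -> Xval v = Xval w.
Proof.
by move=> vw; apply: eq_bigr => -[i /= /val_index_le/andP[? ?]] _; rewrite !vw.
Qed.

End Values.

Section RmorphValues.
Variables (F : fieldType) (n d : nat) (S : comNzRingType).

Lemma rmorph_Fhat xi (h : {rmorphism mpoly n.*2.+4 F -> S}) :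
  h (Fhat n d xi) = Fval n d (h (mpolyC _ xi)) (fun t => h (var F _ t)).
Proof.
have h3 : h (mpolyC _ 3%:R) = 3%:R by rewrite !rmorph_nat.
rewrite /Fhat /Dhat /Shat -!mul_mpolyC rmorphB !rmorphM h3 !rmorph_sum /Fval.
rewrite !mulr_sumr -!sumrB; apply: eq_bigr => i _.
rewrite !(rmorphM, rmorphB, rmorphD, rmorphXn) /= !exprS; ring.
Qed.

Lemma rmorph_hypX (h : {rmorphism mpoly n.*2.+2 F -> S}) :
  h (hypX F n d) = Xval n d (fun t => h (var F _ t)).
Proof.
rewrite /hypX rmorph_sum /Xval; apply: eq_bigr => i _.
by rewrite !(rmorphM, rmorphB, rmorphD, rmorphXn) /=.
Qed.

Variable i : {rmorphism F -> S}.

Lemma mmap_var N (v : 'I_N.+1 -> S) t : mmap i v (var F N t) = v (inord t).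
Proof. exact: mmapXU. Qed.

Lemma mmap_Fhat xi (v : 'I_n.*2.+4 -> S) :
  mmap i v (Fhat n d xi) = Fval n d (i xi) (fun t => v (inord t)).
Proof.
rewrite (rmorph_Fhat _ (mmap i v)) /= mmapC.
by congr Fval; apply: funext => t /=; rewrite mmap_var.
Qed.

Lemma mmap_hypX (v : 'I_n.*2.+2 -> S) :
  mmap i v (hypX F n d) = Xval n d (fun t => v (inord t)).
Proof.
rewrite (rmorph_hypX (mmap i v)).
by congr Xval; apply: funext => t /=; rewrite mmap_var.
Qed.

End RmorphValues.

Lemma meval_var (F : fieldType) N (v : 'I_N.+1 -> F) t :
  meval v (var F N t) = v (inord t).
Proof. exact: (mmap_var idfun). Qed.

Lemma meval_Fhat (F : fieldType) n d xi (v : 'I_n.*2.+4 -> F) :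
  meval v (Fhat n d xi) = Fval n d xi (fun t => v (inord t)).
Proof. exact: (@mmap_Fhat F n d F idfun xi v). Qed.

Lemma meval_hypX (F : fieldType) n d (v : 'I_n.*2.+2 -> F) :
  meval v (hypX F n d) = Xval n d (fun t => v (inord t)).
Proof. exact: (@mmap_hypX F n d F idfun v). Qed.

(** * The strict transform is integral *)

Section PrimeFhat.
Variables (F : fieldType).

Lemma muni_var_max N : muni (var F N N) = 'X.
Proof.
by rewrite -(@muni_max F N) /var; do 3!congr (_ _); apply: val_inj; rewrite /= inordK.
Qed.

Lemma muni_var N i : (i <= N)%N -> muni (var F N.+1 i) = (var F N i)%:P.
Proof.
move=> iN; rewrite -muni_widen /var; do 3!congr (_ _).
by apply: val_inj; rewrite /= !inordK // ltnS ltnW.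
Qed.

Lemma prime_var_max N : prime_elt (var F N N).
Proof.
apply: prime_muni; rewrite muni_var_max.
have -> : 'X = 1%:P * 'X + 0%:P :> {poly mpoly N F} by rewrite mul1r addr0.
by apply: linear_prime; [exact: oner_neq0 | move=> r [h]; rewrite mul0r; exists r; rewrite mulr1].
Qed.

Lemma rdvd_meval N (f g : mpoly N F) (v : 'I_N -> F) :
  meval v f = 0 -> rdvd f g -> meval v g = 0.
Proof. by move=> f0 /mpdvd_meval; apply. Qed.

Variables (n d : nat).
Hypotheses (n0 : (0 < n)%N) (d0 : (0 < d)%N).

Lemma regular_PQ : regular (Qval n d (var F n.*2.+1)) (Pval n d (var F n.*2.+1)).
Proof.
pose b := var F n.*2 n.*2; pose v := var F n.*2.
pose p := \sum_(i < n) v i.*2 ^+ d.+1 * v i.*2.+1 ^+ d.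
pose q := \sum_(i < n) v i.*2 ^+ d * v i.*2.+1 ^+ d.+1.
have lt1 (i : 'I_n) : (i.*2.+1 <= n.*2)%N by rewrite ltn_double.
have lt0 (i : 'I_n) : (i.*2 <= n.*2)%N by rewrite ltnW ?lt1.
have mb : muni (var F n.*2.+1 n.*2) = b%:P by rewrite muni_var.
have mP : muni (Pval n d (var F n.*2.+1)) = (b ^+ d.+1)%:P * 'X^d + p%:P.
  rewrite /Pval big_ord_recr rmorphD rmorphM !rmorphXn /= mb muni_var_max addrC.
  congr (_ + _); rewrite !rmorph_sum; apply: eq_bigr => i _.
  by rewrite !rmorphM !rmorphXn /= !muni_var.
have mQ : muni (Qval n d (var F n.*2.+1)) = (b ^+ d)%:P * 'X^(d.+1) + q%:P.
  rewrite /Qval big_ord_recr rmorphD rmorphM !rmorphXn /= mb muni_var_max addrC.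
  congr (_ + _); rewrite !rmorph_sum; apply: eq_bigr => i _.
  by rewrite !rmorphM !rmorphXn /= !muni_var.
apply: regular_muni; rewrite mP mQ.
have nbp : ~ rdvd b p.
  pose e (j : 'I_n.*2.+1) : F := ((j : nat) <= 1)%N%:R.
  have ev t : (t <= n.*2)%N -> meval e (var F n.*2 t) = (t <= 1)%N%:R.
    by move=> tn; rewrite meval_var /e inordK.
  have gt1 t : (0 < t)%N -> (t.*2 <= 1)%N = false by case: t.
  have e0 : meval e b = 0 by rewrite ev // gt1.
  move=> /(rdvd_meval e0); rewrite rmorph_sum (bigD1 (Ordinal n0)) //= big1 => [|i i0].
    by rewrite addr0 rmorphM !rmorphXn /= !ev // ?double_gt0 // !expr1n mulr1 => /eqP; rewrite oner_eq0.
  by rewrite rmorphM !rmorphXn /= !ev // gt1 ?lt0n // exprS !mul0r.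
have bp : regular b p.
  by move=> r; have [_ pr] := prime_var_max n.*2 => /pr[].
have bn0 : b != 0.
  by apply/eqP => b0; apply: nbp; exists 0; have := muni_var_max n.*2; rewrite -/b b0 rmorph0 => /esym/eqP; rewrite polyX_eq0.
apply: regular_sym; last exact: regular_pair d0 bn0 bp nbp.
rewrite -lead_coef_eq0 lead_coefDl; last first.
  by rewrite mul_polyC size_scale ?expf_neq0 // size_polyXn (leq_ltn_trans (size_polyC_leq1 _)).
by rewrite mul_polyC lead_coefZ lead_coefXn mulr1 expf_neq0.
Qed.

Lemma prime_Fhat (xi : F) : 3%:R - xi != 0 -> 3%:R + xi != 0 ->
  prime_elt (Fhat n d xi).
Proof.
move=> nzm nzp.
have mvP N : (n.*2.+1 <= N)%N ->
    Pval n d (fun t => muni (var F N.+1 t)) = (Pval n d (var F N))%:P.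
  move=> leN; rewrite /Pval rmorph_sum; apply: eq_bigr => -[i /= /val_index_le/andP[l0 l1]] _.
  by rewrite rmorphM !rmorphXn /= !muni_var // (leq_trans _ leN).
have muP N : (n.*2.+1 <= N)%N -> muni (Pval n d (var F N.+1)) = (Pval n d (var F N))%:P.
  move=> leN; rewrite -mvP // /Pval rmorph_sum.
  by apply: eq_bigr => i _; rewrite rmorphM !rmorphXn.
have mvQ N : (n.*2.+1 <= N)%N ->
    Qval n d (fun t => muni (var F N.+1 t)) = (Qval n d (var F N))%:P.
  move=> leN; rewrite /Qval rmorph_sum; apply: eq_bigr => -[i /= /val_index_le/andP[l0 l1]] _.
  by rewrite rmorphM !rmorphXn /= !muni_var // (leq_trans _ leN).
have muQ N : (n.*2.+1 <= N)%N -> muni (Qval n d (var F N.+1)) = (Qval n d (var F N))%:P.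
  move=> leN; rewrite -mvQ // /Qval rmorph_sum.
  by apply: eq_bigr => i _; rewrite rmorphM !rmorphXn.
pose P N := Pval n d (var F N); pose Q N := Qval n d (var F N).
have unitC N (c : F) : c != 0 -> mpolyC N c \is a GRing.unit.
  by move=> c0; apply/unitrP; exists (mpolyC N c^-1); rewrite -!mpolyCM mulVf // mulfV.
have Qn0 N : (n.*2.+1 <= N)%N -> Q N != 0.
  move=> leN; apply/eqP => Q0; pose e (j : 'I_N.+1) : F := ((j : nat) <= 1)%N%:R.
  have : meval e (Q N) = 0 by rewrite Q0 rmorph0.
  have ev t : (t <= n.*2.+1)%N -> meval e (var F N t) = (t <= 1)%N%:R.
    by move=> tn; rewrite meval_var /e inordK // ltnS (leq_trans tn).
  have gt1 t : (0 < t)%N -> (t.*2 <= 1)%N = false by case: t.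
  rewrite rmorph_sum (bigD1 ord0) //= big1 => [|i i0].
    by rewrite addr0 rmorphM !rmorphXn /= !ev // !expr1n mulr1 => /eqP; rewrite oner_eq0.
  have /val_index_le/andP[le0 le1] : (i <= n)%N by rewrite -ltnS.
  have i1 : (i.*2.+1 <= 1)%N = false by rewrite ltnS leqn0 double_eq0; apply: negPf.
  by rewrite rmorphM !rmorphXn /= !ev // i1 exprS mul0r mulr0.
apply: prime_muni.
have -> : muni (Fhat n d xi) =
    (mpolyC _ (- (3%:R + xi)) * Q n.*2.+2)%:P * 'X
    + (mpolyC _ (3%:R - xi) * (var F n.*2.+2 n.*2.+2 * P n.*2.+2))%:P.
  rewrite (@rmorph_Fhat F n d _ xi (@muni n.*2.+3 F)) /Fval /= muniC muni_var // muni_var_max.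
  rewrite mvP // mvQ //.
  rewrite /P /Q !polyCM mpolyCN mpolyCB mpolyCD !rmorph_nat; ring.
apply: linear_prime.
  by rewrite mulf_neq0 ?Qn0 // mpolyC_eq0 oppr_eq0.
apply: regular_unit; rewrite ?unitC ?oppr_eq0 //.
apply: regular_muni.
rewrite rmorphM /= muni_var_max /P /Q muP // muQ //.
apply: regular_lead; rewrite lead_coefM lead_coefX mul1r lead_coefC.
exact: regular_PQ.
Qed.

Lemma prime_ideal_Fhat (xi : F) : 3%:R - xi != 0 -> 3%:R + xi != 0 ->
  prime_ideal (Fhat n d xi).
Proof. exact: prime_Fhat. Qed.

End PrimeFhat.

(** * Coordinates, orbits and semistable points *)

Section Indices.
Variable n : nat.

Lemma pair_ind (P : 'I_n.*2.+2 -> Prop) :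
  (forall i, (i <= n)%N -> P (inord i.*2) /\ P (inord i.*2.+1)) -> forall j, P j.
Proof.
move=> h j; have jn : (j./2 <= n)%N by rewrite -ltnS ltn_half_double doubleS.
have [h0 h1] := h _ jn; rewrite -[j]inord_val.
by rewrite -[X in inord X]odd_double_half; case: (odd j); rewrite ?add0n ?add1n.
Qed.

Lemma toric_ind (P : 'I_n.*2.+4 -> Prop) :
  (forall i, (i <= n)%N -> P (inord i.*2) /\ P (inord i.*2.+1)) ->
  P (inord n.*2.+2) -> P (inord n.*2.+3) -> forall j, P j.
Proof.
move=> h hp hm j; have : (j./2 <= n.+1)%N by rewrite -ltnS ltn_half_double !doubleS.
rewrite leq_eqVlt -[X in P X]inord_val => /orP[/eqP e|/h[h0 h1]].
  by rewrite -[X in inord X]odd_double_half e doubleS; case: (odd j); rewrite ?add0n ?add1n.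
by rewrite -[X in inord X]odd_double_half; case: (odd j); rewrite ?add0n ?add1n.
Qed.

Lemma proj_ind (P : 'I_n.*2.+1 -> Prop) :
  P ord0 -> (forall i, (i < n)%N -> P (inord i.*2.+1) /\ P (inord i.*2.+2)) ->
  forall j, P j.
Proof.
move=> h0 h j; case: (posnP j) => [j0|jp]; first by rewrite (_ : j = ord0) //; apply: val_inj.
have jn : (j.-1./2 < n)%N by rewrite ltn_half_double -ltnS prednK.
have [h1 h2] := h _ jn; rewrite -[j]inord_val -[X in inord X](prednK jp).
by rewrite -[X in inord X.+1]odd_double_half; case: (odd j.-1); rewrite ?add0n ?add1n.
Qed.

Lemma inord_even_lt i : (i <= n)%N -> (i.*2 < n.*2.+4)%N.
Proof. by move=> h; rewrite -!doubleS ltn_double ltnS leqW. Qed.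

Lemma inord_odd_lt i : (i <= n)%N -> (i.*2.+1 < n.*2.+4)%N.
Proof. by move=> h; rewrite -!(doubleS n) -(doubleS n.+1) ltn_Sdouble ltnS leqW. Qed.

Lemma wt_even i : (i <= n)%N -> @wt (toric n) (inord i.*2) =1 nth 0 [:: 1; -1; 0].
Proof.
move=> h b; rewrite /= /toric_wt inordK ?inord_even_lt // odd_double.
by rewrite -doubleS ltn_double ltnS h.
Qed.

Lemma wt_odd i : (i <= n)%N -> @wt (toric n) (inord i.*2.+1) =1 nth 0 [:: 1; 0; -1].
Proof.
move=> h b; rewrite /= /toric_wt inordK ?inord_odd_lt // -(doubleS n) ltn_Sdouble ltnS h.
by rewrite /= odd_double.
Qed.

Lemma wt_wp : @wt (toric n) (inord n.*2.+2) =1 nth 0 [:: 0; 1; 0].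
Proof. by move=> b; rewrite /= /toric_wt inordK // ltnn /= odd_double. Qed.

Lemma wt_wm : @wt (toric n) (inord n.*2.+3) =1 nth 0 [:: 0; 0; 1].
Proof. by move=> b; rewrite /= /toric_wt inordK // ltnNge leqnSn /= odd_double. Qed.

Lemma toric_weights (x0 x1 x2 : int) (D : 'I_3 -> int) :
  D ord0 = x0 -> D 1 = x1 -> D 2%:R = x2 ->
  [/\ forall i, (i <= n)%N -> \sum_a @wt (toric n) (inord i.*2) a * D a = x0 - x1,
      forall i, (i <= n)%N -> \sum_a @wt (toric n) (inord i.*2.+1) a * D a = x0 - x2,
      \sum_a @wt (toric n) (inord n.*2.+2) a * D a = x1 &
      \sum_a @wt (toric n) (inord n.*2.+3) a * D a = x2].
Proof.
move=> <- <- <-.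
have e (w : 'I_3 -> int) s : w =1 nth 0 s ->
    \sum_a w a * D a = s`_0 * D ord0 + s`_1 * D 1 + s`_2 * D 2%:R.
  move=> ew; rewrite !big_ord_recl big_ord0 addr0 !ew /= addrA.
  by congr (_ + _ * D _ + _ * D _); apply: val_inj.
split=> [i h|i h||].
- by rewrite (e _ _ (wt_even h)) /= mul1r mulN1r mul0r addr0.
- by rewrite (e _ _ (wt_odd h)) /= mul1r mulN1r mul0r addr0.
- by rewrite (e _ _ wt_wp) /= !mul0r mul1r addr0 add0r.
- by rewrite (e _ _ wt_wm) /= !mul0r mul1r !add0r.
Qed.

End Indices.

Section Orbits.
Variables (n : nat) (F : fieldType).

Lemma proj_orbitP m (p q : 'I_m.+1 -> F) :
  same_orbit (Proj m) p q <-> exists2 t, t != 0 & forall j, q j = t * p j.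
Proof.
split=> [[t t0 e]|[t t0 e]].
  by exists (t ord0) => // j; rewrite e big_ord1 /= expr1z.
by exists (fun _ => t) => // j; rewrite big_ord1 /= expr1z.
Qed.

Lemma proj_semistableP m (p : 'I_m.+1 -> F) :
  semistable (Proj m) p <-> exists j, p j != 0.
Proof.
split=> [h|[j pj] S]; last by rewrite inE => /eqP ->; exists j; rewrite ?inE.
by have [|j _ pj] := h [set: 'I_m.+1]%SET; [rewrite inE | exists j].
Qed.

Implicit Types p q : 'I_n.*2.+4 -> F.

Lemma toric_orbitP p q : same_orbit (toric n) p q <->
  exists t0 t1 t2, [/\ t0 != 0, t1 != 0, t2 != 0,
    forall i, (i <= n)%N -> q (inord i.*2) = t0 / t1 * p (inord i.*2) /\
      q (inord i.*2.+1) = t0 / t2 * p (inord i.*2.+1) &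
    q (inord n.*2.+2) = t1 * p (inord n.*2.+2) /\
    q (inord n.*2.+3) = t2 * p (inord n.*2.+3)].
Proof.
have act (t : 'I_3 -> F) (w : 'I_3 -> int) s : w =1 nth 0 s ->
    \prod_b t b ^ w b = t ord0 ^ s`_0 * t 1 ^ s`_1 * t 2%:R ^ s`_2.
  move=> ew; rewrite !big_ord_recl big_ord0 mulr1 !ew /= mulrA.
  by congr (_ * t _ ^ _ * t _ ^ _); apply: val_inj.
split=> [[t nz e]|[t0 [t1 [t2 [n0 n1 n2 e [ep em]]]]]].
  exists (t ord0), (t 1), (t 2%:R); split=> // [i h|].
    rewrite !e (act _ _ _ (wt_even h)) (act _ _ _ (wt_odd h)) /=.
    by rewrite !exprN1 !expr0z !expr1z !mulr1.
  by rewrite !e (act _ _ _ (@wt_wp n)) (act _ _ _ (@wt_wm n)) /= !expr0z !expr1z !mulr1 !mul1r.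
pose t (b : 'I_3) := nth 0 [:: t0; t1; t2] b.
exists t; first by case=> [[|[|[|]]]].
apply: toric_ind => [i h||].
- rewrite (act _ _ _ (wt_even h)) (act _ _ _ (wt_odd h)) /= !expr0z !expr1z !mulr1 !exprN1.
  exact: e.
- by rewrite (act _ _ _ (@wt_wp n)) /= !expr0z !expr1z mulr1 mul1r.
- by rewrite (act _ _ _ (@wt_wm n)) /= !expr0z !expr1z !mul1r.
Qed.

Lemma toric_semistableP p : semistable (toric n) p <->
  [/\ exists2 i, (i <= n)%N & p (inord i.*2) != 0,
      exists2 i, (i <= n)%N & p (inord i.*2.+1) != 0 &
      p (inord n.*2.+2) != 0 \/ p (inord n.*2.+3) != 0].
Proof.
have lt_half (j : nat) : (j < n.*2.+2)%N -> (j./2 <= n)%N.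
  by move=> h; rewrite -ltnS ltn_half_double doubleS.
split=> [h|[[i hi pi] [i' hi' pi'] pw] S]; last first.
  rewrite !inE => /or3P[]/eqP ->.
  - by exists (inord i.*2) => //; rewrite inE inordK ?inord_even_lt // odd_double -doubleS ltn_double ltnS hi.
  - by exists (inord i'.*2.+1) => //; rewrite inE inordK ?inord_odd_lt // -(doubleS n) ltn_Sdouble ltnS hi' /= odd_double.
  - by case: pw => pw; [exists (inord n.*2.+2)|exists (inord n.*2.+3)] => //; rewrite inE inordK.
split.
- have [|j] := h [set j : 'I_n.*2.+4 | (j < n.*2.+2)%N && ~~ odd j]%SET; first by rewrite !inE eqxx.
  rewrite inE => /andP[/lt_half lj oj] pj; exists j./2 => //.
  by rewrite (_ : j./2.*2 = j) ?inord_val // -[RHS]odd_double_half (negPf oj).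
- have [|j] := h [set j : 'I_n.*2.+4 | (j < n.*2.+2)%N && odd j]%SET; first by rewrite !inE eqxx orbT.
  rewrite inE => /andP[/lt_half lj oj] pj; exists j./2 => //.
  by rewrite (_ : j./2.*2.+1 = j) ?inord_val // -[RHS]odd_double_half oj.
- have [|j] := h [set j : 'I_n.*2.+4 | (n.*2.+2 <= j)%N]%SET; first by rewrite !inE eqxx !orbT.
  rewrite inE leq_eqVlt => /orP[/eqP ej|lj] pj.
    by left; rewrite (_ : inord _ = j) //; apply: val_inj; rewrite /= inordK.
  right; rewrite (_ : inord _ = j) //; apply: val_inj; rewrite /= inordK //.
  by apply/eqP; rewrite eqn_leq lj -ltnS ltn_ord.
Qed.

End Orbits.

(** * Criteria for rational maps *)

Section Criteria.
Variable F : fieldType.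

Lemma meval_mapcomp N1 N2 N3 (G2 : 'I_N3 -> mpoly N2 F) (G1 : 'I_N2 -> mpoly N1 F)
    (v : 'I_N1 -> F) j :
  meval v (mapcomp G2 G1 j) = meval (fun l => meval v (G1 l)) (G2 j).
Proof. exact: meval_mpcomp. Qed.

Lemma mmap_mapcomp N1 N2 N3 (G2 : 'I_N3 -> mpoly N2 F) (G1 : 'I_N2 -> mpoly N1 F)
    (E : comNzRingType) (i : {rmorphism F -> E}) (v : 'I_N1 -> E) j :
  mmap i v (mapcomp G2 G1 j) = mmap i (fun l => mmap i v (G1 l)) (G2 j).
Proof. exact: mmap_mpcomp. Qed.

Lemma gen_semistable_at N (f : mpoly N F) (C : coxSpace)
    (G : 'I_(nvar C) -> mpoly N F) (v : 'I_N -> F) :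
  meval v f = 0 -> semistable C (fun j => meval v (G j)) -> gen_semistable f G.
Proof.
move=> f0 ss S /ss[j jS nz]; exists j => // /mpdvd_meval/(_ f0) e.
by rewrite e eqxx in nz.
Qed.

Lemma semistable_eq (C : coxSpace) (E : fieldType) (p q : 'I_(nvar C) -> E) :
  p =1 q -> semistable C p -> semistable C q.
Proof. by move=> e h S /h[j jS]; rewrite e; exists j. Qed.

Lemma prime_ideal0 N : prime_ideal (0 : mpoly N F).
Proof.
split=> [[h /eqP]|g h [e /eqP]]; first by rewrite mulr0 oner_eq0.
rewrite mulr0 mulf_eq0 => /orP[]/eqP ->; [left|right]; exact: mpdvd0.
Qed.

Lemma subvarietyI (C : coxSpace) delta (f : mpoly (nvar C) F) v :
  multihomog C delta f -> prime_ideal f -> meval v f = 0 -> semistable C v ->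
  subvariety C f.
Proof.
move=> hf pf v0 ss; split=> //; first by exists delta.
apply: (gen_semistable_at v0); apply: semistable_eq ss => j.
by rewrite /coords mevalXU.
Qed.

Lemma ratmap_comp (C1 C2 C3 : coxSpace) f1 f2 f3
    (G1 : 'I_(nvar C2) -> mpoly (nvar C1) F) (G2 : 'I_(nvar C3) -> mpoly (nvar C2) F) :
  ratmap C1 f1 C2 f2 G1 -> ratmap C2 f2 C3 f3 G2 ->
  gen_semistable f1 (mapcomp G2 G1) -> ratmap C1 f1 C3 f3 (mapcomp G2 G1).
Proof.
case=> [[D1 h1] d1 _] [[D2 h2] d2 _] gs; split=> //.
  exists (fun a b => \sum_c D2 a c * D1 c b) => j.
  have := multihomog_comp (h2 j) h1; congr (multihomog _ _ _).
  apply: funext => b; under eq_bigr do rewrite mulr_suml.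
  rewrite exchange_big; apply: eq_bigr => a _ /=.
  by rewrite mulr_sumr; apply: eq_bigr => c _; rewrite mulrA.
rewrite -mpcompA; case: d2 => h ->; rewrite mpcompM.
exact: mpdvd_mull.
Qed.

Lemma birationalI (C1 C2 : coxSpace) f1 f2 (G : 'I_(nvar C2) -> mpoly (nvar C1) F)
    (G' : 'I_(nvar C1) -> mpoly (nvar C2) F) v1 v2 :
  subvariety C1 f1 -> subvariety C2 f2 -> ratmap C1 f1 C2 f2 G -> ratmap C2 f2 C1 f1 G' ->
  meval v1 f1 = 0 -> semistable C1 (fun j => meval v1 (mapcomp G' G j)) ->
  meval v2 f2 = 0 -> semistable C2 (fun j => meval v2 (mapcomp G G' j)) ->
  ratmap_eq C1 f1 C1 (mapcomp G' G) coords ->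
  ratmap_eq C2 f2 C2 (mapcomp G G') coords ->
  birational C1 f1 C2 f2 G.
Proof.
move=> s1 s2 r1 r2 v10 ss1 v20 ss2 e1 e2; split=> //; exists G'; split=> //.
  by apply: (ratmap_comp r1 r2); apply: gen_semistable_at ss1.
by apply: (ratmap_comp r2 r1); apply: gen_semistable_at ss2.
Qed.

End Criteria.

(** * The parametrisation and its inverses *)

Section Maps.
Variables (S : comNzRingType) (n d : nat).
Implicit Types (u p x : nat -> S) (U V : nat -> S) (xi ixi hf : S).

(** The coordinate [u 0] plays the part of a last pair (u_0, 0): with this
    convention the n pairs of coordinates and u_0 obey the same formulas. *)
Definition ufst u i := if (i < n)%N then u i.*2.+1 else u 0%N.
Definition usnd u i := if (i < n)%N then u i.*2.+2 else 0.

Definition upair U V t :=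
  if t is t'.+1 then if odd t then U t./2 else V t'./2 else U n.

Definition Asum U V := \sum_(i < n.+1) (U i + 3%:R * V i) * (U i ^+ 2 + 3%:R * V i ^+ 2) ^+ d.
Definition Bsum U V := \sum_(i < n.+1) (U i - V i) * (U i ^+ 2 + 3%:R * V i ^+ 2) ^+ d.
Definition Aval u := Asum (ufst u) (usnd u).
Definition Bval u := Bsum (ufst u) (usnd u).

Definition by_parity (e o : nat -> S) t := if odd t then o t./2 else e t./2.

Definition phi_val hf u := by_parity
  (fun i => hf * ((ufst u i - 3%:R * usnd u i) * Aval u
                  - 3%:R * (ufst u i + usnd u i) * Bval u))
  (fun i => ufst u i * Aval u - 3%:R * usnd u i * Bval u).

Definition psi_val xi hf u t :=
  if (t < n.*2.+2)%N then
    by_parity (fun i => ufst u i - xi * usnd u i) (fun i => ufst u i + xi * usnd u i) t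
  else by_parity (fun=> - hf * (3%:R * Bval u + xi * Aval u))
         (fun=> - hf * (3%:R * Bval u - xi * Aval u)) t.

Definition blow_val xi ixi hf p := by_parity
  (fun i => ixi * ((1 + xi) * hf * (p i.*2.+1 * p n.*2.+3)
                   - (1 - xi) * hf * (p i.*2 * p n.*2.+2)))
  (fun i => ixi * (p i.*2.+1 * p n.*2.+3 - p i.*2 * p n.*2.+2)).

(** Scaling the even and the odd coordinates z so that the last two become
    equal, z_{2i} = u - xi v and z_{2i+1} = u + xi v can be solved for u, v. *)
Definition retract_fst hf p i := hf * (p i.*2 * p n.*2.+1 + p i.*2.+1 * p n.*2).
Definition retract_snd ixi hf p i :=
  ixi * hf * (p i.*2.+1 * p n.*2 - p i.*2 * p n.*2.+1).
Definition retract_val ixi hf p := upair (retract_fst hf p) (retract_snd ixi hf p).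

(** [retract_val] rewritten in the coordinates x, where xi disappears. *)
Definition unphi_fst hf x i := x i.*2 * x n.*2 + x i.*2.+1 * x n.*2.+1
  - hf * (x i.*2 * x n.*2.+1 + x i.*2.+1 * x n.*2).
Definition unphi_snd hf x i := hf * (x i.*2.+1 * x n.*2 - x i.*2 * x n.*2.+1).
Definition unphi_val hf x := upair (unphi_fst hf x) (unphi_snd hf x).

Definition lift_val xi hf x t :=
  if (t < n.*2.+2)%N then
    by_parity (fun i => x i.*2 - (1 + xi) * hf * x i.*2.+1)
              (fun i => x i.*2 - (1 - xi) * hf * x i.*2.+1) t
  else 1.

Lemma by_parity_even e o i : by_parity e o i.*2 = e i.
Proof. by rewrite /by_parity odd_double doubleK. Qed.

Lemma by_parity_odd e o i : by_parity e o i.*2.+1 = o i.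
Proof. by rewrite /by_parity /= odd_double uphalf_double. Qed.

Lemma upair_odd U V i : upair U V i.*2.+1 = U i.
Proof. by rewrite /upair /= odd_double uphalf_double. Qed.

Lemma upair_even U V i : upair U V i.*2.+2 = V i.
Proof. by rewrite /upair /= odd_double /= uphalf_double. Qed.

Lemma ufst_upair U V i : (i <= n)%N -> ufst (upair U V) i = U i.
Proof.
by rewrite leq_eqVlt /ufst => /orP[/eqP -> |->]; rewrite ?ltnn ?upair_odd.
Qed.

Lemma usnd_upair U V i : V n = 0 -> (i <= n)%N -> usnd (upair U V) i = V i.
Proof.
by move=> Vn; rewrite leq_eqVlt /usnd => /orP[/eqP -> |->]; rewrite ?ltnn ?upair_even.
Qed.

Lemma ufst_n u : ufst u n = u 0%N.
Proof. by rewrite /ufst ltnn. Qed.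

Lemma usnd_n u : usnd u n = 0.
Proof. by rewrite /usnd ltnn. Qed.

Lemma psi_even xi hf u i : (i <= n)%N ->
  psi_val xi hf u i.*2 = ufst u i - xi * usnd u i.
Proof. by move=> h; rewrite /psi_val -doubleS ltn_double ltnS h by_parity_even. Qed.

Lemma psi_odd xi hf u i : (i <= n)%N ->
  psi_val xi hf u i.*2.+1 = ufst u i + xi * usnd u i.
Proof.
by move=> h; rewrite /psi_val -(doubleS n) ltn_Sdouble ltnS h by_parity_odd.
Qed.

Lemma psi_wp xi hf u :
  psi_val xi hf u n.*2.+2 = - hf * (3%:R * Bval u + xi * Aval u).
Proof. by rewrite /psi_val ltnn -doubleS by_parity_even. Qed.

Lemma psi_wm xi hf u :
  psi_val xi hf u n.*2.+3 = - hf * (3%:R * Bval u - xi * Aval u).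
Proof. by rewrite /psi_val ltnNge leqnSn /= -(doubleS n) by_parity_odd. Qed.

Lemma lift_even xi hf x i : (i <= n)%N ->
  lift_val xi hf x i.*2 = x i.*2 - (1 + xi) * hf * x i.*2.+1.
Proof. by move=> h; rewrite /lift_val -doubleS ltn_double ltnS h by_parity_even. Qed.

Lemma lift_odd xi hf x i : (i <= n)%N ->
  lift_val xi hf x i.*2.+1 = x i.*2 - (1 - xi) * hf * x i.*2.+1.
Proof.
by move=> h; rewrite /lift_val -(doubleS n) ltn_Sdouble ltnS h by_parity_odd.
Qed.

Lemma lift_wp xi hf x : lift_val xi hf x n.*2.+2 = 1.
Proof. by rewrite /lift_val ltnn. Qed.

Lemma lift_wm xi hf x : lift_val xi hf x n.*2.+3 = 1.
Proof. by rewrite /lift_val ltnNge leqnSn. Qed.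

Lemma unphi_snd_n hf x : unphi_snd hf x n = 0.
Proof. by rewrite /unphi_snd mulrC [X in _ - X]mulrC subrr mul0r. Qed.

Lemma retract_snd_n ixi hf p : retract_snd ixi hf p n = 0.
Proof. by rewrite /retract_snd [X in _ - X]mulrC subrr mulr0. Qed.

Section Identities.
Variables (hf xi ixi : S).
Hypotheses (hf2 : hf * 2%:R = 1) (xi2 : xi ^+ 2 = - 3%:R) (xiV : ixi * xi = 1).

Lemma dbl_half a : a = hf * 2%:R * a.
Proof. by rewrite hf2 mul1r. Qed.

Lemma normval_phi u i : normval (phi_val hf u i.*2) (phi_val hf u i.*2.+1) =
  3%:R * hf ^+ 2 * (3%:R * Bval u ^+ 2 + Aval u ^+ 2) *
  (ufst u i ^+ 2 + 3%:R * usnd u i ^+ 2).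
Proof.
rewrite /normval /phi_val by_parity_even by_parity_odd.
move: (ufst u i) (usnd u i) (Aval u) (Bval u) => U V A B.
by rewrite [U * A - _]dbl_half; ring.
Qed.

(** In the sum of the n+1 equations the forms A and B multiply each other
    crosswise, and the two products cancel. *)
Lemma Xval_phi u : Xval n d (phi_val hf u) = 0.
Proof.
pose K := 3%:R * hf ^+ 2 * (3%:R * Bval u ^+ 2 + Aval u ^+ 2).
transitivity (3%:R * hf * K ^+ d * (Aval u * Bval u - Bval u * Aval u)); last by ring.
rewrite {1}/Bval {2}/Aval /Asum /Bsum !mulr_sumr -sumrB mulr_sumr.
apply: eq_bigr => i _; rewrite normval_phi -/K exprMn /phi_val by_parity_even by_parity_odd.
move: (ufst u i) (usnd u i) (Aval u) (Bval u) (K ^+ d) => U V A B Kd.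
by rewrite [U * A - _]dbl_half; ring.
Qed.

Lemma blow_psi u t : (t <= n.*2.+1)%N ->
  blow_val xi ixi hf (psi_val xi hf u) t = phi_val hf u t.
Proof.
move=> tn.
have tl : (t./2 <= n)%N by rewrite -ltnS ltn_half_double doubleS ltnS.
rewrite /blow_val /phi_val /by_parity psi_even // psi_odd // psi_wp psi_wm.
move: (ufst u _) (usnd u _) (Aval u) (Bval u) => U V A B.
case: (odd t).
  transitivity (ixi * xi * (hf * 2%:R) * (U * A - 3%:R * V * B)); last by rewrite xiV hf2 !mul1r.
  by ring: xi2.
transitivity (ixi * xi * (hf * 2%:R) * (hf * ((U - 3%:R * V) * A - 3%:R * (U + V) * B))); last by rewrite xiV hf2 !mul1r.
by ring: xi2.
Qed.

Lemma Xval_blow p : Xval n d (blow_val xi ixi hf p) =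
  - (ixi * hf) * ((p n.*2.+2 * p n.*2.+3) ^+ d * Fval n d xi p).
Proof.
rewrite /Fval /Pval /Qval !mulr_sumr -sumrB !mulr_sumr; apply: eq_bigr => i _.
rewrite /blow_val by_parity_even by_parity_odd.
move: (p i.*2) (p i.*2.+1) (p n.*2.+2) (p n.*2.+3) => z z' w w'.
have -> : normval (ixi * ((1 + xi) * hf * (z' * w') - (1 - xi) * hf * (z * w)))
    (ixi * (z' * w' - z * w)) = z * z' * (w * w').
  transitivity ((ixi * xi) ^+ 2 * (hf * 2%:R) ^+ 2 * (z * z' * (w * w'))).
    rewrite /normval [z' * w' - _]dbl_half; ring: xi2.
  by rewrite xiV hf2 expr1n !mul1r.
rewrite !exprMn !exprS [z' * w' - _]dbl_half; ring.
Qed.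

Lemma psi_Pval u :
  (3%:R - xi) * Pval n d (psi_val xi hf u) = 3%:R * Bval u - xi * Aval u.
Proof.
rewrite /Pval /Aval /Bval /Asum /Bsum !mulr_sumr -sumrB.
apply: eq_bigr => -[i /= ltin] _; rewrite psi_even ?psi_odd //.
move: (ufst u i) (usnd u i) => U V.
have -> : U ^+ 2 + 3%:R * V ^+ 2 = (U - xi * V) * (U + xi * V) by ring: xi2.
rewrite exprMn exprS; ring: xi2.
Qed.

Lemma psi_Qval u :
  (3%:R + xi) * Qval n d (psi_val xi hf u) = 3%:R * Bval u + xi * Aval u.
Proof.
rewrite /Qval /Aval /Bval /Asum /Bsum !mulr_sumr -big_split /=.
apply: eq_bigr => -[i /= ltin] _; rewrite psi_even ?psi_odd //.
move: (ufst u i) (usnd u i) => U V.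
have -> : U ^+ 2 + 3%:R * V ^+ 2 = (U - xi * V) * (U + xi * V) by ring: xi2.
rewrite exprMn exprS; ring: xi2.
Qed.

Lemma Fval_psi u : Fval n d xi (psi_val xi hf u) = 0.
Proof.
set q := psi_val xi hf u.
transitivity (q n.*2.+2 * ((3%:R - xi) * Pval n d q) - q n.*2.+3 * ((3%:R + xi) * Qval n d q)).
  by rewrite /Fval; ring.
by rewrite psi_Pval psi_Qval /q psi_wp psi_wm; ring.
Qed.

Lemma retract_psi u : let r := retract_val ixi hf (psi_val xi hf u) in
  (r 0%N = u 0%N * u 0%N) /\
  (forall i, (i < n)%N -> r i.*2.+1 = u 0%N * u i.*2.+1 /\ r i.*2.+2 = u 0%N * u i.*2.+2).
Proof.
have rf i : (i <= n)%N -> retract_fst hf (psi_val xi hf u) i = u 0%N * ufst u i.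
  move=> h; rewrite /retract_fst !psi_even ?psi_odd // ufst_n usnd_n.
  by rewrite [RHS]dbl_half; ring.
split=> [|i lt]; first by rewrite /retract_val /= rf // ufst_n.
rewrite /retract_val upair_odd upair_even rf ?(ltnW lt) // {1}/ufst lt; split=> //.
rewrite /retract_snd !psi_even ?psi_odd // ?(ltnW lt) // ufst_n usnd_n.
rewrite /usnd lt; transitivity (ixi * xi * (hf * 2%:R) * (u 0%N * u i.*2.+2)); first by ring.
by rewrite xiV hf2 !mul1r.
Qed.

(** Up to the torus action the composite fixes z, and it replaces w_+ and w_-
    by the two coefficients of the linear equation that they satisfy. *)
Lemma psi_retract p : let q := psi_val xi hf (retract_val ixi hf p) in
  let c := p n.*2 * p n.*2.+1 in
  [/\ forall i, (i <= n)%N -> q i.*2 = p n.*2.+1 * p i.*2 /\ q i.*2.+1 = p n.*2 * p i.*2.+1,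
      q n.*2.+2 = - hf * ((3%:R + xi) * (c ^+ d * p n.*2 * Qval n d p)) &
      q n.*2.+3 = - hf * ((3%:R - xi) * (c ^+ d * p n.*2.+1 * Pval n d p))].
Proof.
move=> q c.
have ev i : (i <= n)%N -> q i.*2 = p n.*2.+1 * p i.*2 /\ q i.*2.+1 = p n.*2 * p i.*2.+1.
  move=> h; rewrite /q psi_even // psi_odd // ufst_upair // usnd_upair ?retract_snd_n //.
  rewrite /retract_fst /retract_snd; move: (p i.*2) (p n.*2.+1) (p i.*2.+1) (p n.*2) => z z' w w'.
  split.
    transitivity (hf * (z * z' + w * w') - (ixi * xi) * (hf * (w * w' - z * z'))); first by ring.
    by rewrite xiV mul1r [RHS]dbl_half; ring.
  transitivity (hf * (z * z' + w * w') + (ixi * xi) * (hf * (w * w' - z * z'))); first by ring.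
  by rewrite xiV mul1r [RHS]dbl_half; ring.
split=> //.
  rewrite /q psi_wp -psi_Qval -/q; do 2!congr (_ * _).
  rewrite /Qval mulr_sumr; apply: eq_bigr => -[i /= lt] _; have [-> ->] := ev i lt.
  by rewrite /c !exprMn !exprS; ring.
rewrite /q psi_wm -psi_Pval -/q; do 2!congr (_ * _).
rewrite /Pval mulr_sumr; apply: eq_bigr => -[i /= lt] _; have [-> ->] := ev i lt.
by rewrite /c !exprMn !exprS; ring.
Qed.

Lemma unphi_phi u : let r := unphi_val hf (phi_val hf u) in
  let K := 3%:R * hf ^+ 2 * (3%:R * Bval u ^+ 2 + Aval u ^+ 2) * u 0%N in
  (r 0%N = K * u 0%N) /\
  (forall i, (i < n)%N -> r i.*2.+1 = K * u i.*2.+1 /\ r i.*2.+2 = K * u i.*2.+2).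
Proof.
move=> r K.
have core (U V A B v : S) :
    let a := hf * ((U - 3%:R * V) * A - 3%:R * (U + V) * B) in
    let b := U * A - 3%:R * V * B in
    let a' := hf * ((v - 3%:R * 0) * A - 3%:R * (v + 0) * B) in
    let b' := v * A - 3%:R * 0 * B in
    a * a' + b * b' - hf * (a * b' + b * a')
      = 3%:R * hf ^+ 2 * (3%:R * B ^+ 2 + A ^+ 2) * v * U /\
    hf * (b * a' - a * b') = 3%:R * hf ^+ 2 * (3%:R * B ^+ 2 + A ^+ 2) * v * V.
  move=> a b a' b'; rewrite [b]dbl_half [b']dbl_half.
  set e := (U - 3%:R * V) * A - 3%:R * (U + V) * B.
  set e' := v * A - 3%:R * v * B.
  split.
    transitivity (hf ^+ 2 * (e * e' + 4%:R * b * b' - (hf * 2%:R) * (e * b' + b * e'))).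
      by rewrite /a /a' -/e /e'; ring.
    by rewrite hf2 mul1r /b /b' /e /e'; ring.
  transitivity (hf ^+ 2 * ((hf * 2%:R) * (b * e' - e * b'))).
    by rewrite /a /a' -/e /e'; ring.
  by rewrite hf2 mul1r /b /b' /e /e'; ring.
have rf i : unphi_fst hf (phi_val hf u) i = K * ufst u i.
  rewrite /unphi_fst /phi_val !by_parity_even !by_parity_odd ufst_n usnd_n.
  exact: (core _ _ _ _ _).1.
split=> [|i lt]; first by rewrite /r /unphi_val /= rf ufst_n.
rewrite /r /unphi_val upair_odd upair_even rf {1}/ufst lt; split=> //.
rewrite /unphi_snd /phi_val !by_parity_even !by_parity_odd ufst_n usnd_n.
by rewrite (core _ _ _ _ _).2 {1}/usnd lt.
Qed.

Lemma phi_unphi x t : (t <= n.*2.+1)%N -> Xval n d x = 0 ->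
  let c := normval (x n.*2) (x n.*2.+1) in
  let M := \sum_(i < n.+1) x i.*2 * normval (x i.*2) (x i.*2.+1) ^+ d in
  phi_val hf (unphi_val hf x) t = - (3%:R * c ^+ d.+1 * M) * x t.
Proof.
move=> tn x0 c M; set u := unphi_val hf x.
pose M' := \sum_(i < n.+1) x i.*2.+1 * normval (x i.*2) (x i.*2.+1) ^+ d.
have M'E : M' = - M.
  apply/eqP; rewrite -addr_eq0 addrC -big_split -[X in _ == X]x0; apply/eqP.
  by apply: eq_bigr => i _; rewrite mulrDl.
have uf i : (i <= n)%N -> ufst u i = unphi_fst hf x i by exact: ufst_upair.
have us i : (i <= n)%N -> usnd u i = unphi_snd hf x i.
  by apply: usnd_upair; apply: unphi_snd_n.
have nrm i : unphi_fst hf x i ^+ 2 + 3%:R * unphi_snd hf x i ^+ 2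
    = c * normval (x i.*2) (x i.*2.+1).
  rewrite /unphi_fst /unphi_snd /c /normval.
  move: (x i.*2) (x i.*2.+1) (x n.*2) (x n.*2.+1) => a b a' b'.
  transitivity ((hf * 2%:R) ^+ 2 * ((a' ^+ 2 - a' * b' + b' ^+ 2) * (a ^+ 2 - a * b + b ^+ 2))).
    by rewrite [a * a' + _]dbl_half; ring.
  by rewrite hf2 expr1n mul1r.
have twice i : 2%:R * unphi_snd hf x i = x i.*2.+1 * x n.*2 - x i.*2 * x n.*2.+1.
  by rewrite /unphi_snd [RHS]dbl_half; ring.
have diff i : unphi_fst hf x i - unphi_snd hf x i =
    x n.*2 * (x i.*2 - x i.*2.+1) + x n.*2.+1 * x i.*2.+1.
  rewrite /unphi_fst /unphi_snd.
  transitivity (x i.*2 * x n.*2 + x i.*2.+1 * x n.*2.+1 - hf * 2%:R * (x i.*2.+1 * x n.*2)); first by ring.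
  by rewrite hf2; ring.
have eA : Aval u = - (3%:R * c ^+ d * x n.*2.+1 * M).
  transitivity (c ^+ d * (x n.*2 * Xval n d x + x n.*2.+1 * (M' - 2%:R * M))); last first.
    by rewrite x0 M'E; ring.
  rewrite /Aval /Asum /Xval /M' /M !(mulr_sumr, mulrBr, mulrDr) -sumrB -big_split.
  apply: eq_bigr => -[i /= lt] _; rewrite uf // us // nrm exprMn.
  have -> : unphi_fst hf x i + 3%:R * unphi_snd hf x i =
     (unphi_fst hf x i - unphi_snd hf x i) + 2%:R * (2%:R * unphi_snd hf x i) by ring.
  by rewrite diff twice; ring.
have eB : Bval u = c ^+ d * M * (2%:R * x n.*2 - x n.*2.+1).
  transitivity (c ^+ d * (x n.*2 * (M - M') + x n.*2.+1 * M')); last first.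
    by rewrite M'E; ring.
  rewrite /Bval /Bsum /M' /M !(mulr_sumr, mulrBr, mulrDr) -sumrB -big_split.
  apply: eq_bigr => -[i /= lt] _; rewrite uf // us // nrm exprMn diff; ring.
have tl : (t./2 <= n)%N by rewrite -ltnS ltn_half_double doubleS ltnS.
rewrite -[in RHS](odd_double_half t) /phi_val /by_parity eA eB uf // us //.
set i := t./2; case: (odd t); rewrite ?add0n ?add1n.
  transitivity (- (3%:R * c ^+ d * M) * ((unphi_fst hf x i - unphi_snd hf x i) * x n.*2.+1
      + 2%:R * unphi_snd hf x i * x n.*2)); first by ring.
  by rewrite diff twice exprS /c /normval; ring.
transitivity (- (3%:R * c ^+ d * M) * (hf * 2%:R) * ((unphi_fst hf x i - unphi_snd hf x i) * x n.*2
      + 2%:R * unphi_snd hf x i * (x n.*2 - x n.*2.+1))); first by ring.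
by rewrite diff twice hf2 exprS /c /normval; ring.
Qed.

Lemma blow_lift x t : (t <= n.*2.+1)%N ->
  blow_val xi ixi hf (lift_val xi hf x) t = x t.
Proof.
move=> tn; have tl : (t./2 <= n)%N by rewrite -ltnS ltn_half_double doubleS ltnS.
rewrite -[in RHS](odd_double_half t) /blow_val /by_parity lift_wp lift_wm lift_even // lift_odd //.
set i := t./2.
case: (odd t); rewrite ?add0n ?add1n; move: (x i.*2) (x i.*2.+1) => a b.
  by transitivity ((ixi * xi) * (hf * 2%:R) * b); [ring | rewrite xiV hf2 !mul1r].
by transitivity ((ixi * xi) * (hf * 2%:R) * a); [ring | rewrite xiV hf2 !mul1r].
Qed.

Lemma lift_blow p : let q := lift_val xi hf (blow_val xi ixi hf p) in
  forall i, (i <= n)%N ->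
  q i.*2 = p n.*2.+2 * p i.*2 /\ q i.*2.+1 = p n.*2.+3 * p i.*2.+1.
Proof.
move=> q i h; rewrite /q lift_even // lift_odd // /blow_val by_parity_even by_parity_odd.
move: (p n.*2.+2) (p i.*2) (p n.*2.+3) (p i.*2.+1) => w z w' z'.
split.
  by transitivity ((ixi * xi) * (hf * 2%:R) * (w * z)); [ring | rewrite xiV hf2 !mul1r].
by transitivity ((ixi * xi) * (hf * 2%:R) * (w' * z')); [ring | rewrite xiV hf2 !mul1r].
Qed.

End Identities.
End Maps.

(** * The maps as polynomials *)

Section Naturality.
Variables (S T : comNzRingType) (g : {rmorphism S -> T}) (n d : nat).
Implicit Types (u p x : nat -> S) (xi ixi hf : S).

Lemma rmorph_ufst u i : g (ufst n u i) = ufst n (g \o u) i.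
Proof. by rewrite /ufst; case: ifP. Qed.

Lemma rmorph_usnd u i : g (usnd n u i) = usnd n (g \o u) i.
Proof. by rewrite /usnd; case: ifP => // _; rewrite rmorph0. Qed.

Definition rmE :=
  (rmorphM, rmorphB, rmorphD, rmorphN, rmorphXn, rmorph_nat, rmorph1, rmorph_ufst, rmorph_usnd).

Lemma rmorph_Aval u : g (Aval n d u) = Aval n d (g \o u).
Proof. by rewrite /Aval /Asum rmorph_sum; apply: eq_bigr => i _; rewrite !rmE. Qed.

Lemma rmorph_Bval u : g (Bval n d u) = Bval n d (g \o u).
Proof. by rewrite /Bval /Bsum rmorph_sum; apply: eq_bigr => i _; rewrite !rmE. Qed.

Lemma rmorph_phi_val hf u t : g (phi_val n d hf u t) = phi_val n d (g hf) (g \o u) t.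
Proof.
by rewrite /phi_val /by_parity; case: ifP => _; rewrite !rmE rmorph_Aval rmorph_Bval.
Qed.

Lemma rmorph_psi_val xi hf u t :
  g (psi_val n d xi hf u t) = psi_val n d (g xi) (g hf) (g \o u) t.
Proof.
rewrite /psi_val /by_parity; case: ifP => _; case: ifP => _;
by rewrite !rmE ?rmorph_Aval ?rmorph_Bval.
Qed.

Lemma rmorph_blow_val xi ixi hf p t :
  g (blow_val n xi ixi hf p t) = blow_val n (g xi) (g ixi) (g hf) (g \o p) t.
Proof. by rewrite /blow_val /by_parity; case: ifP => _; rewrite !rmE. Qed.

Lemma rmorph_retract_val ixi hf p t :
  g (retract_val n ixi hf p t) = retract_val n (g ixi) (g hf) (g \o p) t.
Proof.
rewrite /retract_val; case: t => [|t]; first by rewrite /= /retract_fst !rmE.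
by rewrite /upair; case: ifP => _; rewrite /retract_fst /retract_snd !rmE.
Qed.

Lemma rmorph_unphi_val hf x t :
  g (unphi_val n hf x t) = unphi_val n (g hf) (g \o x) t.
Proof.
rewrite /unphi_val; case: t => [|t]; first by rewrite /= /unphi_fst !rmE.
by rewrite /upair; case: ifP => _; rewrite /unphi_fst /unphi_snd !rmE.
Qed.

Lemma rmorph_lift_val xi hf x t :
  g (lift_val n xi hf x t) = lift_val n (g xi) (g hf) (g \o x) t.
Proof.
by rewrite /lift_val /by_parity; case: ifP => _; [case: ifP => _|]; rewrite !rmE.
Qed.

End Naturality.

Section Extensionality.
Variables (S : comNzRingType) (n d : nat).
Implicit Types (u p q x y : nat -> S) (xi ixi hf : S).

Lemma half_le t : (t <= n.*2.+1)%N -> (t./2 <= n)%N.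
Proof. by move=> h; rewrite -ltnS ltn_half_double doubleS ltnS. Qed.

Lemma Fval_ext xi p q : (forall t, (t <= n.*2.+3)%N -> p t = q t) ->
  Fval n d xi p = Fval n d xi q.
Proof.
move=> e; have e' t : (t <= n.*2.+1)%N -> p t = q t by move=> h; rewrite e // leqW // leqW.
by rewrite /Fval (Pval_ext _ e') (Qval_ext _ e') !e.
Qed.

Lemma blow_ext xi ixi hf p q t : (forall s, (s <= n.*2.+3)%N -> p s = q s) ->
  (t <= n.*2.+1)%N -> blow_val n xi ixi hf p t = blow_val n xi ixi hf q t.
Proof.
move=> e /half_le/val_index_le/andP[l0 l1].
by rewrite /blow_val /by_parity !e // leqW // leqW.
Qed.

Lemma retract_ext ixi hf p q t : (forall s, (s <= n.*2.+1)%N -> p s = q s) ->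
  (t <= n.*2)%N -> retract_val n ixi hf p t = retract_val n ixi hf q t.
Proof.
move=> e; rewrite /retract_val; have nn := leqnSn n.*2; case: t => [|t] tn.
  by rewrite /= /retract_fst !e.
have /val_index_le/andP[l0 l1] : (t.+1./2 <= n)%N by apply: half_le; rewrite leqW.
have /val_index_le/andP[k0 k1] : (t./2 <= n)%N by apply: half_le; apply: leqW; apply: ltnW.
by rewrite /upair; case: ifP => _; rewrite /retract_fst /retract_snd !e.
Qed.

Lemma unphi_ext hf p q t : (forall s, (s <= n.*2.+1)%N -> p s = q s) ->
  (t <= n.*2)%N -> unphi_val n hf p t = unphi_val n hf q t.
Proof.
move=> e; rewrite /unphi_val; have nn := leqnSn n.*2; case: t => [|t] tn.
  by rewrite /= /unphi_fst !e.
have /val_index_le/andP[l0 l1] : (t.+1./2 <= n)%N by apply: half_le; rewrite leqW.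
have /val_index_le/andP[k0 k1] : (t./2 <= n)%N by apply: half_le; apply: leqW; apply: ltnW.
by rewrite /upair; case: ifP => _; rewrite /unphi_fst /unphi_snd !e.
Qed.

Lemma lift_ext xi hf p q t : (forall s, (s <= n.*2.+1)%N -> p s = q s) ->
  lift_val n xi hf p t = lift_val n xi hf q t.
Proof.
move=> e; rewrite /lift_val; case: ifP => // tn.
have /val_index_le/andP[l0 l1] : (t./2 <= n)%N by apply: half_le.
by rewrite /by_parity; case: ifP => _; rewrite !e.
Qed.

Lemma ufst_ext u v i : (forall s, (s <= n.*2)%N -> u s = v s) -> ufst n u i = ufst n v i.
Proof.
by move=> e; rewrite /ufst; case: ifP => lt; rewrite e // ltn_double.
Qed.

Lemma usnd_ext u v i : (forall s, (s <= n.*2)%N -> u s = v s) -> usnd n u i = usnd n v i.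
Proof.
by move=> e; rewrite /usnd; case: ifP => // lt; rewrite e // -doubleS leq_double.
Qed.

Lemma Aval_ext u v : (forall s, (s <= n.*2)%N -> u s = v s) -> Aval n d u = Aval n d v.
Proof.
by move=> e; apply: eq_bigr => i _; rewrite (ufst_ext _ e) (usnd_ext _ e).
Qed.

Lemma Bval_ext u v : (forall s, (s <= n.*2)%N -> u s = v s) -> Bval n d u = Bval n d v.
Proof.
by move=> e; apply: eq_bigr => i _; rewrite (ufst_ext _ e) (usnd_ext _ e).
Qed.

Lemma phi_ext hf u v t : (forall s, (s <= n.*2)%N -> u s = v s) ->
  phi_val n d hf u t = phi_val n d hf v t.
Proof.
move=> e; rewrite /phi_val (Aval_ext e) (Bval_ext e) /by_parity.
by rewrite (ufst_ext _ e) (usnd_ext _ e).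
Qed.

Lemma psi_ext xi hf u v t : (forall s, (s <= n.*2)%N -> u s = v s) ->
  psi_val n d xi hf u t = psi_val n d xi hf v t.
Proof.
move=> e; rewrite /psi_val (Aval_ext e) (Bval_ext e) /by_parity.
by rewrite (ufst_ext _ e) (usnd_ext _ e).
Qed.

End Extensionality.

Section PolynomialMaps.
Variables (F : fieldType) (n d : nat) (xi : F).
Local Notation C := (mpolyC _).

Definition psi_map (j : 'I_(nvar (toric n))) : mpoly n.*2.+1 F :=
  psi_val n d (C xi) (C 2%:R^-1) (var F n.*2) j.

Definition retract_map (j : 'I_n.*2.+1) : mpoly (nvar (toric n)) F :=
  retract_val n (C xi^-1) (C 2%:R^-1) (var F n.*2.+3) j.

Definition unphi_map (j : 'I_n.*2.+1) : mpoly n.*2.+2 F :=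
  unphi_val n (C 2%:R^-1) (var F n.*2.+1) j.

Definition lift_map (j : 'I_(nvar (toric n))) : mpoly n.*2.+2 F :=
  lift_val n (C xi) (C 2%:R^-1) (var F n.*2.+1) j.

Lemma AbarE : Abar F n d = Aval n d (var F n.*2).
Proof.
rewrite /Aval /Asum big_ord_recr /= ufst_n usnd_n mulr0 addr0 expr0n mulr0 addr0.
rewrite -exprM mul2n -exprS addrC /Abar; congr (_ + _).
by apply: eq_bigr => i _; rewrite /ufst /usnd ltn_ord !scaler_nat !mulr_natl.
Qed.

Lemma BbarE : Bbar F n d = Bval n d (var F n.*2).
Proof.
rewrite /Bval /Bsum big_ord_recr /= ufst_n usnd_n subr0 expr0n mulr0 addr0.
rewrite -exprM mul2n -exprS addrC /Bbar; congr (_ + _).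
by apply: eq_bigr => i _; rewrite /ufst /usnd ltn_ord !scaler_nat !mulr_natl.
Qed.

Lemma phiE j : phi F n d j = phi_val n d (C 2%:R^-1) (var F n.*2) j.
Proof.
have C3 : C 3%:R = 3%:R :> mpoly n.*2.+1 F by rewrite rmorph_nat.
rewrite /phi /phi_val /by_parity -AbarE -BbarE /phi_even /phi_odd /ufst /usnd.
by case: ifP => _; case: ifP => _; rewrite -?mul_mpolyC ?C3; ring.
Qed.

Lemma blowdownE j : blowdown n xi j =
  blow_val n (C xi) (C xi^-1) (C 2%:R^-1) (var F n.*2.+3) j.
Proof.
rewrite /blowdown /blow_val /by_parity -!mul_mpolyC /a_plus /a_minus.
by rewrite !mpolyCM mpolyCD mpolyCB mpolyC1.
Qed.

Section Values.
Variables (S : comNzRingType) (i : {rmorphism F -> S}).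

Lemma mmap_phi (v : 'I_n.*2.+1 -> S) j :
  mmap i v (phi F n d j) = phi_val n d (i 2%:R^-1) (fun t => v (inord t)) j.
Proof.
rewrite phiE (rmorph_phi_val (mmap i v)) /= mmapC.
by congr phi_val; apply: funext => t /=; rewrite mmap_var.
Qed.

Lemma mmap_psi (v : 'I_n.*2.+1 -> S) j :
  mmap i v (psi_map j) = psi_val n d (i xi) (i 2%:R^-1) (fun t => v (inord t)) j.
Proof.
rewrite /psi_map (rmorph_psi_val (mmap i v)) /= !mmapC.
by congr psi_val; apply: funext => t /=; rewrite mmap_var.
Qed.

Lemma mmap_blowdown (v : 'I_n.*2.+4 -> S) j : mmap i v (blowdown n xi j) =
  blow_val n (i xi) (i xi^-1) (i 2%:R^-1) (fun t => v (inord t)) j.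
Proof.
rewrite blowdownE (rmorph_blow_val (mmap i v)) /= !mmapC.
by congr blow_val; apply: funext => t /=; rewrite mmap_var.
Qed.

Lemma mmap_retract (v : 'I_n.*2.+4 -> S) j : mmap i v (retract_map j) =
  retract_val n (i xi^-1) (i 2%:R^-1) (fun t => v (inord t)) j.
Proof.
rewrite /retract_map (rmorph_retract_val (mmap i v)) /= !mmapC.
by congr retract_val; apply: funext => t /=; rewrite mmap_var.
Qed.

Lemma mmap_unphi (v : 'I_n.*2.+2 -> S) j :
  mmap i v (unphi_map j) = unphi_val n (i 2%:R^-1) (fun t => v (inord t)) j.
Proof.
rewrite /unphi_map (rmorph_unphi_val (mmap i v)) /= !mmapC.
by congr unphi_val; apply: funext => t /=; rewrite mmap_var.
Qed.

Lemma mmap_lift (v : 'I_n.*2.+2 -> S) j :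
  mmap i v (lift_map j) = lift_val n (i xi) (i 2%:R^-1) (fun t => v (inord t)) j.
Proof.
rewrite /lift_map (rmorph_lift_val (mmap i v)) /= !mmapC.
by congr lift_val; apply: funext => t /=; rewrite mmap_var.
Qed.

End Values.

End PolynomialMaps.

Arguments psi_map {F n} d xi j.
Arguments retract_map {F n} xi j.
Arguments unphi_map F {n} j.
Arguments lift_map {F n} xi j.

(** * Degrees *)

Section Degrees.
Variables (F : fieldType).

Lemma homw_eq N (w : 'I_N -> int) e e' (f : mpoly N F) :
  homw w e f -> e = e' -> homw w e' f.
Proof. by move=> h <-. Qed.

Lemma homwCM N (w : 'I_N -> int) e c (f : mpoly N F) :
  homw w e f -> homw w e (mpolyC N c * f).
Proof. by rewrite mul_mpolyC; apply: homwZ. Qed.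

Lemma homw_natM N (w : 'I_N -> int) e m (f : mpoly N F) :
  homw w e f -> homw w e (m%:R * f).
Proof. by rewrite mulr_natl -scaler_nat; apply: homwZ. Qed.

Lemma homw_var N (w : 'I_N.+1 -> int) t : homw w (w (inord t)) (var F N t).
Proof. exact: homwX. Qed.

Variables (n d : nat).

Section ProjectiveSource.
Local Notation hom e := (homw (fun=> 1 : int) (e : int)).

Lemma hom_var N t : hom 1 (var F N t).
Proof. exact: homw_var. Qed.

Lemma hom_ufst i : hom 1 (ufst n (var F n.*2) i).
Proof. by rewrite /ufst; case: ifP => _; apply: hom_var. Qed.

Lemma hom_usnd i : hom 1 (usnd n (var F n.*2) i).
Proof. by rewrite /usnd; case: ifP => _; [apply: hom_var | apply: homw0]. Qed.

Lemma hom_norm i :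
  hom d.*2 ((ufst n (var F n.*2) i ^+ 2 + 3%:R * usnd n (var F n.*2) i ^+ 2) ^+ d).
Proof.
apply: (homw_eq (e := 2%:Z *+ d)); last by rewrite -mul2n; lia.
apply: homwXn; apply: homwD; first exact: (homwXn 2 (hom_ufst i)).
by apply/homw_natM; exact: (homwXn 2 (hom_usnd i)).
Qed.

Lemma hom_Aval : hom d.*2.+1 (Aval n d (var F n.*2)).
Proof.
apply: homw_sum => i _; apply: (homw_eq (homwM _ (hom_norm i)) (e := 1 + d.*2%:Z)); last by lia.
by apply: homwD; [apply: hom_ufst | apply/homw_natM/hom_usnd].
Qed.

Lemma hom_Bval : hom d.*2.+1 (Bval n d (var F n.*2)).
Proof.
apply: homw_sum => i _; apply: (homw_eq (homwM _ (hom_norm i)) (e := 1 + d.*2%:Z)); last by lia.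
by apply: homwB; [apply: hom_ufst | apply: hom_usnd].
Qed.

Lemma hom_phi j : hom d.*2.+2 (phi F n d j).
Proof.
have e (f : mpoly n.*2.+1 F) : hom d.*2.+1 f -> forall g, hom 1 g -> hom d.*2.+2 (g * f).
  by move=> hf g hg; apply: (homw_eq (homwM hg hf)); lia.
have hA := e _ hom_Aval; have hB := e _ hom_Bval.
rewrite phiE /phi_val /by_parity; case: ifP => _.
  apply: homwB; [apply/hA/hom_ufst | apply/hB/homw_natM/hom_usnd].
apply/homwCM/homwB; first by apply: hA; apply: homwB; [apply: hom_ufst | apply/homw_natM/hom_usnd].
by apply: hB; apply/homw_natM/homwD; [apply: hom_ufst | apply: hom_usnd].
Qed.

Lemma hom_psi (xi : F) : exists D, forall j, multihomog (Proj n.*2)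
  (fun b => \sum_a @wt (toric n) j a * D a b) (psi_map d xi j).
Proof.
pose D (a : 'I_3) (b : 'I_1) : int := nth 0 [:: d.*2.+2%:Z; d.*2.+1%:Z; d.*2.+1%:Z] a.
exists D => j; apply/multihomogP => b.
have [//|//|//|we wo wp wm] := @toric_weights n d.*2.+2 d.*2.+1 d.*2.+1 (D ^~ b).
move: j; apply: toric_ind => [i h||].
- rewrite /psi_map !inordK ?inord_even_lt ?inord_odd_lt // we // wo // psi_even // psi_odd //.
  split; apply: (homw_eq (e := 1)); try lia; [apply: homwB | apply: homwD];
  by [apply: hom_ufst | apply/homwCM/hom_usnd].
- rewrite /psi_map inordK // wp psi_wp -mpolyCN; apply/homwCM/homwD.
    exact/homw_natM/hom_Bval.
  exact/homwCM/hom_Aval.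
- rewrite /psi_map inordK // wm psi_wm -mpolyCN; apply/homwCM/homwB.
    exact/homw_natM/hom_Bval.
  exact/homwCM/hom_Aval.
Qed.

Lemma hom_hypX : multihomog (Proj n.*2.+1) (fun=> d.*2.+1%:Z) (hypX F n d).
Proof.
apply/multihomogP => b; apply: homw_sum => i _.
apply: (homw_eq (e := 1 + 2%:Z *+ d)); last by rewrite -mul2n; lia.
apply: homwM; first by apply: homwD; apply: hom_var.
apply/homwXn/homwD; last exact: (homwXn 2 (hom_var _ _)).
apply: homwB; first exact: (homwXn 2 (hom_var _ _)).
exact: (homwM (hom_var _ _) (hom_var _ _)).
Qed.

Lemma hom_unphi t : hom 2 (unphi_val n (mpolyC _ 2%:R^-1) (var F n.*2.+1) t).
Proof.
have h s s' : hom 2 (var F n.*2.+1 s * var F n.*2.+1 s').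
  exact: (homwM (hom_var _ _) (hom_var _ _)).
have hf i : hom 2 (unphi_fst n (mpolyC _ 2%:R^-1) (var F n.*2.+1) i).
  by apply: homwB; [apply: homwD | apply/homwCM/homwD].
rewrite /unphi_val; case: t => [|t]; first exact: hf.
rewrite /upair; case: ifP => _; first exact: hf.
by apply/homwCM/homwB.
Qed.

Lemma hom_lift (xi : F) : exists D, forall j, multihomog (Proj n.*2.+1)
  (fun b => \sum_a @wt (toric n) j a * D a b) (lift_map xi j).
Proof.
pose D (a : 'I_3) (b : 'I_1) : int := nth 0 [:: 1; 0; 0] a.
exists D => j; apply/multihomogP => b.
have [//|//|//|we wo wp wm] := @toric_weights n 1 0 0 (D ^~ b).
move: j; apply: toric_ind => [i h||].
- rewrite /lift_map !inordK ?inord_even_lt ?inord_odd_lt // we // wo // lift_even // lift_odd //.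
  rewrite -mpolyC1 -mpolyCD -mpolyCB -!mpolyCM.
  by split; apply: homwB; [apply: hom_var | apply/homwCM/hom_var | apply: hom_var | apply/homwCM/hom_var].
- by rewrite /lift_map inordK // wp lift_wp; apply: homwC.
- by rewrite /lift_map inordK // wm lift_wm; apply: homwC.
Qed.

End ProjectiveSource.

Section ToricSource.
Implicit Type b : 'I_3.

Definition coord_degree (t : nat) b : int := nth 0 (@toric_wt n (inord t)) b.

Lemma homw_tvar b t : homw (fun j => @wt (toric n) j b) (coord_degree t b) (var F n.*2.+3 t).
Proof. exact: homw_var. Qed.

Lemma coord_degree_even i b : (i <= n)%N -> coord_degree i.*2 b = nth 0 [:: 1; -1; 0] b.
Proof. by move=> h; rewrite -(wt_even h). Qed.

Lemma coord_degree_odd i b : (i <= n)%N -> coord_degree i.*2.+1 b = nth 0 [:: 1; 0; -1] b.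
Proof. by move=> h; rewrite -(wt_odd h). Qed.

Lemma coord_degree_wp b : coord_degree n.*2.+2 b = nth 0 [:: 0; 1; 0] b.
Proof. by rewrite -(@wt_wp n). Qed.

Lemma coord_degree_wm b : coord_degree n.*2.+3 b = nth 0 [:: 0; 0; 1] b.
Proof. by rewrite -(@wt_wm n). Qed.

Lemma hom_Fhat (xi : F) : multihomog (toric n) (Fhat_class d) (Fhat n d xi).
Proof.
apply/multihomogP => b.
rewrite [Fhat n d xi](@rmorph_Fhat F n d _ xi idfun : _ = Fval n d _ (var F _)) /Fval.
have -> : 3%:R = mpolyC n.*2.+4 3%:R :> mpoly _ F by rewrite rmorph_nat.
rewrite -mpolyCB -mpolyCD -!mulrA /Pval /Qval !mulr_sumr.
apply: homwB; apply: homw_sum => -[i /= lt] _; apply: homwCM.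
  apply: (homw_eq (homwM (homw_tvar b _) (homwM (homwXn _ (homw_tvar b _)) (homwXn _ (homw_tvar b _))))).
  rewrite coord_degree_wp coord_degree_even // coord_degree_odd // /Fhat_class.
  by case: b => -[|[|[|]]] //= _; lia.
apply: (homw_eq (homwM (homw_tvar b _) (homwM (homwXn _ (homw_tvar b _)) (homwXn _ (homw_tvar b _))))).
rewrite coord_degree_wm coord_degree_even // coord_degree_odd // /Fhat_class.
by case: b => -[|[|[|]]] //= _; lia.
Qed.

Lemma hom_retract (xi : F) : exists D, forall j, multihomog (toric n)
  (fun b => \sum_a @wt (Proj n.*2) j a * D a b) (retract_map xi j).
Proof.
exists (fun _ b => nth 0 [:: 2%:Z; -1; -1] b) => j; apply/multihomogP => b.
rewrite big_ord1 mul1r.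
have h i i' : (i <= n)%N -> (i' <= n)%N -> homw (fun j => @wt (toric n) j b)
    (nth 0 [:: 2%:Z; -1; -1] b) (var F n.*2.+3 i.*2 * var F n.*2.+3 i'.*2.+1).
  move=> hi hi'; apply: (homw_eq (homwM (homw_tvar b _) (homw_tvar b _))).
  rewrite coord_degree_even // coord_degree_odd //.
  by case: b => -[|[|[|]]].
have hf i : (i <= n)%N -> homw (fun j => @wt (toric n) j b) (nth 0 [:: 2%:Z; -1; -1] b)
    (retract_fst n (mpolyC _ 2%:R^-1) (var F n.*2.+3) i).
  by move=> hi; apply/homwCM/homwD; [|rewrite mulrC]; apply: h.
rewrite /retract_map /retract_val; case: j => -[|t] /= tn; first exact: hf.
have l0 : (t.+1./2 <= n)%N by apply: half_le; rewrite leqW // -ltnS.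
have l1 : (t./2 <= n)%N by apply: half_le; rewrite leqW // ltnW.
case: ifP => _; first exact: hf.
by rewrite /retract_snd -mpolyCM; apply/homwCM/homwB; [rewrite mulrC|]; apply: h.
Qed.

Lemma hom_blowdown (xi : F) : exists D, forall j, multihomog (toric n)
  (fun b => \sum_a @wt (Proj n.*2.+1) j a * D a b) (blowdown n xi j).
Proof.
exists (fun _ b => nth 0 [:: 1; 0; 0] b) => j; apply/multihomogP => b.
rewrite big_ord1 mul1r blowdownE.
have jn : (j./2 <= n)%N by apply: half_le; rewrite -ltnS.
have he : homw (fun j => @wt (toric n) j b) (nth 0 [:: 1; 0; 0] b)
    (var F n.*2.+3 j./2.*2 * var F n.*2.+3 n.*2.+2).
  apply: (homw_eq (homwM (homw_tvar b _) (homw_tvar b _))).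
  by rewrite coord_degree_even // coord_degree_wp; case: b => -[|[|[|]]].
have ho : homw (fun j => @wt (toric n) j b) (nth 0 [:: 1; 0; 0] b)
    (var F n.*2.+3 j./2.*2.+1 * var F n.*2.+3 n.*2.+3).
  apply: (homw_eq (homwM (homw_tvar b _) (homw_tvar b _))).
  by rewrite coord_degree_odd // coord_degree_wm; clear he; case: b => -[|[|[|]]].
rewrite /blow_val /by_parity; case: ifP => _; apply: homwCM; first exact: homwB.
by rewrite -mpolyC1 -mpolyCD -mpolyCB -!mpolyCM; apply: homwB; apply: homwCM.
Qed.

End ToricSource.
End Degrees.

(** * Birationality *)

Section TestPoints.
Variables (S : comNzRingType) (n d : nat).

(** Only the last pair of coordinates and w_+, w_- are nonzero. *)
Definition cone_pt (a b w w' : S) (t : nat) : S :=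
  if (t < n.*2)%N then 0 else nth 0 [:: a; b; w; w'] (t - n.*2).

Variables (a b w w' : S).
Local Notation p := (cone_pt a b w w').

Lemma cone_pt_a : p n.*2 = a.
Proof. by rewrite /cone_pt ltnn subnn. Qed.

Lemma cone_pt_b : p n.*2.+1 = b.
Proof. by rewrite /cone_pt ltnNge leqnSn /= subSnn. Qed.

Lemma cone_pt_w : p n.*2.+2 = w.
Proof. by rewrite /cone_pt ltnNge !leqW //= subSn ?leqW // subSnn. Qed.

Lemma cone_pt_w' : p n.*2.+3 = w'.
Proof. by rewrite /cone_pt ltnNge !leqW //= !subSn ?leqW // subnn. Qed.

Lemma cone_pt0 i : (i < n)%N -> p i.*2 = 0 /\ p i.*2.+1 = 0.
Proof.
move=> lt; rewrite /cone_pt ltn_double lt.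
by rewrite -[X in (_ < X)%N]/(n.*2) ltn_Sdouble lt.
Qed.

Hypothesis d0 : (0 < d)%N.

Lemma cone_pt_P : Pval n d p = a ^+ d.+1 * b ^+ d.
Proof.
rewrite /Pval big_ord_recr big1 /= => [|i _]; first by rewrite cone_pt_a cone_pt_b add0r.
by have [-> _] := cone_pt0 (ltn_ord i); rewrite exprS !mul0r.
Qed.

Lemma cone_pt_Q : Qval n d p = a ^+ d * b ^+ d.+1.
Proof.
rewrite /Qval big_ord_recr big1 /= => [|i _]; first by rewrite cone_pt_a cone_pt_b add0r.
by have [_ ->] := cone_pt0 (ltn_ord i); rewrite exprS mul0r mulr0.
Qed.

Lemma cone_pt_F xi :
  Fval n d xi p = (3%:R - xi) * w * (a ^+ d.+1 * b ^+ d) - (3%:R + xi) * w' * (a ^+ d * b ^+ d.+1).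
Proof. by rewrite /Fval cone_pt_P cone_pt_Q cone_pt_w cone_pt_w'. Qed.

Lemma cone_pt_X : Xval n d p = (a + b) * normval a b ^+ d.
Proof.
rewrite /Xval big_ord_recr big1 /= => [|i _]; first by rewrite cone_pt_a cone_pt_b add0r.
by have [-> ->] := cone_pt0 (ltn_ord i); rewrite addr0 mul0r.
Qed.

End TestPoints.

Section Descent.
Variables (k : fieldType) (L : fieldExtType k).

(** A k-linear retraction of L onto k turns a quotient over L of two
    polynomials over k into a quotient over k. *)
Lemma mpdvd_descend N (f g : mpoly N k) :
  mpdvd (map_mpoly (in_alg L) f) (map_mpoly (in_alg L) g) -> mpdvd f g.
Proof.
case=> h e.
have [l l1] : exists l : L -> k, [/\ (forall x y, l (x + y) = l x + l y), l 0 = 0 &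
    forall c x, l (x * c%:A) = l x * c] /\ l 1 = 1.
  have fr : free [tuple (1 : L)] by rewrite seq1_free oner_neq0.
  exists (coord [tuple (1 : L)] ord0); split; last first.
    exact: (coord_free ord0 ord0 fr).
  split=> [x y||c x]; first by rewrite linearD.
    by rewrite linear0.
  by rewrite mulr_algr linearZ /= mulrC.
case: l1 => [[lD l0 lZ] l1].
exists (\sum_(m <- msupp h) l (mcoeff m h) *: mpolyX k m).
have ch m : mcoeff m (\sum_(m <- msupp h) l (mcoeff m h) *: mpolyX k m) = l (mcoeff m h).
  rewrite raddf_sum /=; case: (boolP (m \in msupp h)) => mh.
    rewrite (bigD1_seq m) ?msupp_uniq //= mcoeffZ mcoeffX eqxx mulr1 big1 ?addr0 // => m' /negPf m'm.
    by rewrite mcoeffZ mcoeffX m'm mulr0.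
  rewrite big1_seq => [|m' /andP[_ m'h]]; first by rewrite (memN_msupp_eq0 mh).
  by rewrite mcoeffZ mcoeffX; case: eqP => [mm|_]; [by rewrite -mm m'h in mh | rewrite mulr0].
apply/mpolyP => m.
have lsum (I : Type) (r : seq I) (P : pred I) (F : I -> L) :
    l (\sum_(i <- r | P i) F i) = \sum_(i <- r | P i) l (F i).
  exact: (big_morph l lD l0).
transitivity (l (mcoeff m (map_mpoly (in_alg L) g))).
  by rewrite mcoeff_map_mpoly /= -[_%:A]mul1r lZ l1 mul1r.
rewrite e !mcoeffM lsum; apply: eq_bigr => -[m1 m2] _ /=.
by rewrite ch mcoeff_map_mpoly lZ.
Qed.

Lemma prime_ideal_descend N (f : mpoly N k) :
  prime_ideal (map_mpoly (in_alg L) f) -> prime_ideal f.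
Proof.
case=> f1 fM; split=> [[h e]|g h [e ge]].
  by apply: f1; exists (map_mpoly (in_alg L) h); rewrite -rmorphM -e rmorph1.
have [|d|d] := fM (map_mpoly (in_alg L) g) (map_mpoly (in_alg L) h).
- by exists (map_mpoly (in_alg L) e); rewrite -!rmorphM ge.
- by left; apply: mpdvd_descend.
- by right; apply: mpdvd_descend.
Qed.

End Descent.

Lemma map_hypX (k L : fieldType) (i : {rmorphism k -> L}) n d :
  map_mpoly i (hypX k n d) = hypX L n d.
Proof.
rewrite (@rmorph_hypX k n d _ (map_mpoly i)) [RHS](@rmorph_hypX L n d _ idfun) /=.
by congr Xval; apply: funext => t; rewrite map_mpolyX.
Qed.

Section OverBase.
Variables (F : fieldType) (n d : nat).
Hypothesis F2 : 2%:R != 0 :> F.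
Variables (S : comNzRingType) (i : {rmorphism F -> S}).

Lemma image_half : i 2%:R^-1 * 2%:R = 1.
Proof. by rewrite -(rmorph_nat i 2) -rmorphM mulVf // rmorph1. Qed.

Lemma mmap_hypX_phi (v : 'I_n.*2.+1 -> S) :
  mmap i (fun j => mmap i v (phi F n d j)) (hypX F n d) = 0.
Proof.
have h2 := image_half.
rewrite mmap_hypX -(Xval_phi n d h2 (fun t => v (inord t))); apply: Xval_ext => t lt.
by rewrite mmap_phi inordK.
Qed.

Lemma mmap_unphi_phi (v : 'I_n.*2.+1 -> S) j :
  let u t := v (inord t) in
  mmap i (fun l => mmap i v (phi F n d l)) (unphi_map F j) =
  3%:R * i 2%:R^-1 ^+ 2 * (3%:R * Bval n d u ^+ 2 + Aval n d u ^+ 2) * v ord0 * v j.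
Proof.
have h2 := image_half; move=> u.
have [r0 r] := unphi_phi n d h2 u.
have e0 : inord 0 = ord0 :> 'I_n.*2.+1 by apply: val_inj; rewrite /= inordK.
have qE : mmap i (fun l => mmap i v (phi F n d l)) (unphi_map F j) =
    unphi_val n (i 2%:R^-1) (phi_val n d (i 2%:R^-1) u) j.
  rewrite mmap_unphi; apply: unphi_ext; last by rewrite -ltnS.
  by move=> s ls; rewrite mmap_phi inordK.
rewrite qE; move: j {qE}; apply: proj_ind => [|t lt]; first by rewrite r0 /u e0.
have [r1 r2] := r t lt.
by rewrite !inordK ?r1 ?r2 /u ?e0 // !ltnS -?doubleS ?leq_double // ltn_double.
Qed.

Lemma mmap_phi_unphi (v : 'I_n.*2.+2 -> S) j : mmap i v (hypX F n d) = 0 ->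
  let x t := v (inord t) in
  let c := normval (x n.*2) (x n.*2.+1) in
  let M := \sum_(t < n.+1) x t.*2 * normval (x t.*2) (x t.*2.+1) ^+ d in
  mmap i (fun l => mmap i v (unphi_map F l)) (phi F n d j) = - (3%:R * c ^+ d.+1 * M) * v j.
Proof.
have h2 := image_half; rewrite mmap_hypX => x0 x c M.
have jn : (j <= n.*2.+1)%N by rewrite -ltnS.
have := phi_unphi h2 jn x0; rewrite inord_val => <-; rewrite mmap_phi.
by apply: phi_ext => s ls; rewrite mmap_unphi inordK.
Qed.

End OverBase.

Section OverXi.
Variables (F : fieldType) (n d : nat) (xi : F).
Hypotheses (n0 : (0 < n)%N) (d0 : (0 < d)%N).
Hypotheses (F2 : 2%:R != 0 :> F) (F3 : 3%:R != 0 :> F) (xi2 : xi ^+ 2 = - 3%:R).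

Lemma xi_neq0 : xi != 0.
Proof. by apply: contra_neq F3 => x0; apply: oppr_inj; rewrite -xi2 x0 expr0n oppr0. Qed.

Lemma three_xi : (3%:R - xi) * (3%:R + xi) = 2%:R * 2%:R * 3%:R.
Proof. by ring: xi2. Qed.

Lemma three_xi_neq0 : 3%:R - xi != 0 /\ 3%:R + xi != 0.
Proof.
by apply/andP; rewrite -negb_or -mulf_eq0 three_xi !mulf_neq0.
Qed.

Lemma image_facts (S : comNzRingType) (i : {rmorphism F -> S}) :
  [/\ i 2%:R^-1 * 2%:R = 1, i xi ^+ 2 = - 3%:R & i xi^-1 * i xi = 1].
Proof.
split.
- exact: image_half.
- by rewrite -rmorphXn xi2 rmorphN rmorph_nat.
- by rewrite -rmorphM mulVf ?xi_neq0 // rmorph1.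
Qed.

Section PointIdentities.
Variables (S : comNzRingType) (i : {rmorphism F -> S}).

Lemma mmap_hypX_blowdown (v : 'I_n.*2.+4 -> S) :
  mmap i (fun j => mmap i v (blowdown n xi j)) (hypX F n d) =
  - (i xi^-1 * i 2%:R^-1) *
    ((v (inord n.*2.+2) * v (inord n.*2.+3)) ^+ d * mmap i v (Fhat n d xi)).
Proof.
have [h2 x2 xV] := image_facts i.
rewrite mmap_hypX mmap_Fhat -(Xval_blow n d h2 x2 xV); apply: Xval_ext => t lt.
by rewrite mmap_blowdown inordK.
Qed.

Lemma mmap_Fhat_psi (v : 'I_n.*2.+1 -> S) :
  mmap i (fun j => mmap i v (psi_map d xi j)) (Fhat n d xi) = 0.
Proof.
have [h2 x2 xV] := image_facts i.
rewrite mmap_Fhat -(Fval_psi n d (i 2%:R^-1) x2 (fun t => v (inord t))).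
by apply: Fval_ext => t lt; rewrite mmap_psi inordK.
Qed.

Lemma mmap_Fhat_lift (v : 'I_n.*2.+2 -> S) :
  mmap i (fun j => mmap i v (lift_map xi j)) (Fhat n d xi) =
  - (2%:R * i xi) * mmap i v (hypX F n d).
Proof.
have [h2 x2 xV] := image_facts i.
rewrite mmap_Fhat mmap_hypX; set q := fun t => v (inord t).
have -> : Fval n d (i xi) (fun t => mmap i v (lift_map xi (inord t)))
    = Fval n d (i xi) (lift_val n (i xi) (i 2%:R^-1) q).
  by apply: Fval_ext => t lt; rewrite mmap_lift inordK.
have := Xval_blow n d h2 x2 xV (lift_val n (i xi) (i 2%:R^-1) q).
rewrite lift_wp lift_wm mulr1 expr1n mul1r => e.
rewrite (_ : Xval n d q = Xval n d (blow_val n (i xi) (i xi^-1) (i 2%:R^-1)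
    (lift_val n (i xi) (i 2%:R^-1) q))); last first.
  by apply: Xval_ext => t lt; rewrite blow_lift.
rewrite e; set f := Fval _ _ _ _.
transitivity ((i xi^-1 * i xi) * (i 2%:R^-1 * 2%:R) * f); last by ring.
by rewrite xV h2 !mul1r.
Qed.

Lemma mmap_blowdown_psi (v : 'I_n.*2.+1 -> S) j :
  mmap i (fun l => mmap i v (psi_map d xi l)) (blowdown n xi j) = mmap i v (phi F n d j).
Proof.
have [h2 x2 xV] := image_facts i.
rewrite mmap_blowdown mmap_phi -(blow_psi _ h2 x2 xV) -1?ltnS //.
by apply: blow_ext => [s ls|]; rewrite ?mmap_psi ?inordK // -ltnS.
Qed.

Lemma mmap_blowdown_lift (v : 'I_n.*2.+2 -> S) j :
  mmap i (fun l => mmap i v (lift_map xi l)) (blowdown n xi j) = v j.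
Proof.
have [h2 x2 xV] := image_facts i.
have jn : (j <= n.*2.+1)%N by rewrite -ltnS.
have := blow_lift h2 xV (fun t => v (inord t)) jn; rewrite inord_val => <-.
by rewrite mmap_blowdown; apply: blow_ext => // s ls; rewrite mmap_lift inordK.
Qed.

Lemma mmap_lift_blowdown (v : 'I_n.*2.+4 -> S) :
  let q j := mmap i (fun l => mmap i v (blowdown n xi l)) (lift_map xi j) in
  (forall t, (t <= n)%N ->
    q (inord t.*2) = v (inord n.*2.+2) * v (inord t.*2) /\
    q (inord t.*2.+1) = v (inord n.*2.+3) * v (inord t.*2.+1)) /\
  (q (inord n.*2.+2) = 1 /\ q (inord n.*2.+3) = 1).
Proof.
have [h2 x2 xV] := image_facts i; move=> q.
have qE j : q j = lift_val n (i xi) (i 2%:R^-1)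
    (blow_val n (i xi) (i xi^-1) (i 2%:R^-1) (fun t => v (inord t))) j.
  by rewrite /q mmap_lift; apply: lift_ext => s ls; rewrite mmap_blowdown inordK.
split=> [t lt|]; rewrite !qE !inordK ?inord_even_lt ?inord_odd_lt //.
  by have := lift_blow h2 xV (fun t => v (inord t)) lt.
by rewrite lift_wp lift_wm.
Qed.

Lemma mmap_retract_psi (v : 'I_n.*2.+1 -> S) j :
  mmap i (fun l => mmap i v (psi_map d xi l)) (retract_map xi j) = v ord0 * v j.
Proof.
have [h2 x2 xV] := image_facts i.
have [r0 r] := retract_psi n d h2 xV (fun t => v (inord t)).
have e0 : inord 0 = ord0 :> 'I_n.*2.+1 by apply: val_inj; rewrite /= inordK.
have qE : mmap i (fun l => mmap i v (psi_map d xi l)) (retract_map xi j) =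
    retract_val n (i xi^-1) (i 2%:R^-1) (psi_val n d (i xi) (i 2%:R^-1) (fun t => v (inord t))) j.
  rewrite mmap_retract; apply: retract_ext; last by rewrite -ltnS.
  by move=> s ls; rewrite mmap_psi inordK // ltnS leqW // leqW.
rewrite qE; move: j {qE}; apply: proj_ind => [|t lt]; first by rewrite r0 e0.
have [r1 r2] := r t lt.
by rewrite !inordK ?r1 ?r2 ?e0 // !ltnS -?doubleS ?leq_double // ltn_double.
Qed.

Lemma mmap_psi_retract (v : 'I_n.*2.+4 -> S) :
  let p t := v (inord t) in
  let q j := mmap i (fun l => mmap i v (retract_map xi l)) (psi_map d xi j) in
  let c := p n.*2 * p n.*2.+1 in
  [/\ forall t, (t <= n)%N -> q (inord t.*2) = p n.*2.+1 * p t.*2 /\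
        q (inord t.*2.+1) = p n.*2 * p t.*2.+1,
      q (inord n.*2.+2) = - i 2%:R^-1 * ((3%:R + i xi) * (c ^+ d * p n.*2 * Qval n d p)) &
      q (inord n.*2.+3) = - i 2%:R^-1 * ((3%:R - i xi) * (c ^+ d * p n.*2.+1 * Pval n d p))].
Proof.
have [h2 x2 xV] := image_facts i; move=> p q c.
have qE j : q j = psi_val n d (i xi) (i 2%:R^-1) (retract_val n (i xi^-1) (i 2%:R^-1) p) j.
  by rewrite /q mmap_psi; apply: psi_ext => s ls; rewrite mmap_retract inordK.
have [e0 e1 e2] := psi_retract n d h2 x2 xV p.
split=> [t lt||]; rewrite !qE !inordK ?inord_even_lt ?inord_odd_lt //.
exact: e0.
Qed.

End PointIdentities.
End OverXi.

Section TestPointsOnVarieties.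
Variables (F : fieldType) (n d : nat).
Hypotheses (n0 : (0 < n)%N) (d0 : (0 < d)%N).

Definition X0 (j : 'I_n.*2.+2) : F := cone_pt n 1 (-1) 0 0 j.
Definition U0 (j : 'I_n.*2.+1) : F := (j == ord0)%:R.

Lemma X0E t : (t <= n.*2.+1)%N -> X0 (inord t) = cone_pt n 1 (-1) 0 0 t.
Proof. by move=> h; rewrite /X0 inordK. Qed.

Lemma X0_on : meval X0 (hypX F n d) = 0.
Proof.
by rewrite meval_hypX (Xval_ext _ X0E) cone_pt_X // subrr mul0r.
Qed.

Lemma X0_semistable : semistable (Proj n.*2.+1) X0.
Proof.
apply/proj_semistableP; exists (inord n.*2).
by rewrite X0E // cone_pt_a oner_neq0.
Qed.

Lemma X0_last : X0 (inord n.*2) = 1 /\ X0 (inord n.*2.+1) = -1.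
Proof. by rewrite !X0E // cone_pt_a cone_pt_b. Qed.

Lemma U0_semistable : semistable (Proj n.*2) U0.
Proof. by apply/proj_semistableP; exists ord0; rewrite /U0 eqxx oner_neq0. Qed.

Lemma U0E t : (t <= n.*2)%N -> U0 (inord t) = (t == 0)%N%:R.
Proof. by move=> h; rewrite /U0 -val_eqE /= inordK. Qed.

Lemma U0_AB : Aval n d (fun t => U0 (inord t)) = 1 /\ Bval n d (fun t => U0 (inord t)) = 1.
Proof.
pose u t : F := (t == 0)%N%:R.
have uf i : ufst n u i = (i >= n)%N%:R by rewrite /ufst ltnNge; case: leqP.
have us i : usnd n u i = 0 by rewrite /usnd /u; case: ifP.
rewrite (Aval_ext _ U0E) (Bval_ext _ U0E) /Aval /Bval /Asum /Bsum -/u.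
by split; rewrite big_ord_recr big1 /= => [|i _]; rewrite !uf !us ?leqnn ?mulr0 ?addr0 ?subr0 ?add0r ?expr0n ?mulr0 ?addr0 ?expr1n ?mul1r //
  leqNgt ltn_ord mul0r.
Qed.

Lemma subvariety_Proj m : subvariety (Proj m) (0 : mpoly m.+1 F).
Proof.
apply: (@subvarietyI _ (Proj m) (fun=> 0) _ (fun=> 1)).
- by move=> j; rewrite msupp0.
- exact: prime_ideal0.
- exact: meval0.
- by apply/proj_semistableP; exists ord0; rewrite oner_neq0.
Qed.

Hypotheses (F2 : 2%:R != 0 :> F) (F3 : 3%:R != 0 :> F).

(** * The parametrisation of the hypersurface *)

Lemma gen_semistable_phi : gen_semistable (0 : mpoly n.*2.+1 F) (C2 := Proj n.*2.+1) (phi F n d).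
Proof.
apply: (gen_semistable_at (v := U0)); first exact: meval0.
apply/proj_semistableP; exists (inord n.*2.+1).
have [A1 B1] := U0_AB.
rewrite /meval (mmap_phi d idfun) inordK // /phi_val by_parity_odd A1 B1 ufst_n usnd_n.
by rewrite mulr0 mul0r subr0 mulr1 U0E // eqxx oner_neq0.
Qed.

Lemma ratmap_phi : ratmap (Proj n.*2) 0 (Proj n.*2.+1) (hypX F n d) (phi F n d).
Proof.
split; last exact: gen_semistable_phi.
  exists (fun _ _ => d.*2.+2%:Z) => j; apply/multihomogP => b.
  by rewrite big_ord1 mul1r; apply: hom_phi.
rewrite -[mpcomp _ _]mmap_id mmap_mpcomp mmap_hypX_phi //; exact: mpdvd0.
Qed.

Lemma X0_unphi : meval X0 (unphi_map F (ord0 : 'I_n.*2.+1)) = 3%:R.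
Proof.
rewrite /meval (mmap_unphi idfun) /unphi_val /= /unphi_fst.
have [-> ->] := X0_last; rewrite !mul1r mulr1 mulrNN mulr1 -opprD mulrN opprK.
by rewrite -[1 + 1]/(2%:R) mulVf // -[3%N]/(2 + 1)%N natrD.
Qed.

Lemma ratmap_unphi : ratmap (Proj n.*2.+1) (hypX F n d) (Proj n.*2) 0 (unphi_map F).
Proof.
split.
- exists (fun _ _ => 2%:Z) => j; apply/multihomogP => b.
  by rewrite big_ord1 mul1r; apply: hom_unphi.
- by rewrite mpcomp0; apply: mpdvd0.
- apply: (gen_semistable_at (v := X0)); first exact: X0_on.
  by apply/proj_semistableP; exists ord0; rewrite X0_unphi.
Qed.

Lemma subvariety_hypX : prime_ideal (hypX F n d) -> subvariety (Proj n.*2.+1) (hypX F n d).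
Proof.
move=> pr; by apply: subvarietyI (@hom_hypX F n d) pr X0_on X0_semistable.
Qed.

Lemma birational_phi : prime_ideal (hypX F n d) ->
  birational (Proj n.*2) 0 (Proj n.*2.+1) (hypX F n d) (phi F n d).
Proof.
move=> pr; apply: (@birationalI F (Proj n.*2) (Proj n.*2.+1) _ _ _ (unphi_map F) U0 X0).
- exact: subvariety_Proj.
- exact: subvariety_hypX.
- exact: ratmap_phi.
- exact: ratmap_unphi.
- exact: meval0.
- apply/proj_semistableP; exists ord0; rewrite meval_mapcomp /meval (mmap_unphi_phi d F2 idfun).
  have [-> ->] := U0_AB; rewrite /U0 eqxx !expr1n !mulr1 -[_ + 1](natrD _ 3 1) -[(3 + 1)%N]/(2 * 2)%N natrM.
  by rewrite -mulrA -expr2 -exprMn mulVf // expr1n mulr1.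
- exact: X0_on.
- apply/proj_semistableP; exists (inord n.*2); rewrite meval_mapcomp /meval (mmap_phi_unphi F2 (i := idfun)); last exact: X0_on.
  have [x0 x1] := X0_last; rewrite x0 x1 mulr1 oppr_eq0.
  have -> : normval 1 (-1) = 3%:R :> F by rewrite /normval; ring.
  rewrite big_ord_recr big1 /= => [|t _].
    rewrite x0 x1 add0r mul1r !mulf_neq0 ?expf_neq0 //.
    have -> : normval 1 (-1) = 3%:R :> F by rewrite /normval; ring.
    by [].
  have ltn := ltn_ord t.
  have /val_index_le/andP[l0 _] : (t <= n)%N by apply: ltnW.
  by rewrite X0E // (cone_pt0 _ _ _ _ ltn).1 mul0r.
- move=> E i p _ _ /proj_semistableP[j nz] /proj_semistableP[l pl].
  apply/proj_orbitP; move: nz; rewrite mmap_mapcomp (mmap_unphi_phi d F2 i).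
  set K := _ * p ord0 => nz; have K0 : K != 0 by apply: contraNneq nz => ->; rewrite mul0r.
  exists K^-1; rewrite ?invr_eq0 // => t.
  by rewrite mmap_mapcomp (mmap_unphi_phi d F2 i) -/K mulKf // mmapXU.
- move=> E i p _ on /proj_semistableP[j nz] /proj_semistableP[l pl].
  apply/proj_orbitP; move: nz; rewrite mmap_mapcomp (mmap_phi_unphi F2 _ on).
  set K := - _ => nz; have K0 : K != 0 by apply: contraNneq nz => ->; rewrite mul0r.
  exists K^-1; rewrite ?invr_eq0 // => t.
  by rewrite mmap_mapcomp (mmap_phi_unphi F2 _ on) -/K mulKf // mmapXU.
Qed.

Lemma big_pairs (S : nmodType) (v : nat -> S) m :
  \sum_(j < m.*2) v j = \sum_(j < m) (v j.*2 + v j.*2.+1).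
Proof.
elim: m => [|m IH]; first by rewrite !big_ord0.
by rewrite doubleS !big_ord_recr /= IH addrA.
Qed.

Lemma hypX_fermat : hypX F n 1 = fermat_cubic F n.
Proof.
rewrite /hypX /fermat_cubic.
have -> : \sum_(j < n.*2.+2) var F n.*2.+1 j ^+ 3 = \sum_(j < n.+1)
    (var F n.*2.+1 j.*2 ^+ 3 + var F n.*2.+1 j.*2.+1 ^+ 3).
  exact: (big_pairs (fun t => var F n.*2.+1 t ^+ 3) n.+1).
by apply: eq_bigr => i _; ring.
Qed.

End TestPointsOnVarieties.

(** * The strict transform *)

Section StrictTransform.
Variables (F : fieldType) (n d : nat) (xi : F).
Hypotheses (n0 : (0 < n)%N) (d0 : (0 < d)%N).
Hypotheses (F2 : 2%:R != 0 :> F) (F3 : 3%:R != 0 :> F) (xi2 : xi ^+ 2 = - 3%:R).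

Let nzm : 3%:R - xi != 0 := (three_xi_neq0 F2 F3 xi2).1.
Let nzp : 3%:R + xi != 0 := (three_xi_neq0 F2 F3 xi2).2.
Let nzxi : xi != 0 := xi_neq0 F3 xi2.
Let half : 2%:R^-1 * 2%:R = 1 :> F := mulVf F2.

Definition cone (a b w w' : F) (j : 'I_n.*2.+4) : F := cone_pt n a b w w' j.

Lemma coneE a b w w' t : (t <= n.*2.+3)%N -> cone a b w w' (inord t) = cone_pt n a b w w' t.
Proof. by move=> h; rewrite /cone inordK. Qed.

Lemma cone_Fhat a b w w' : meval (cone a b w w') (Fhat n d xi) =
  (3%:R - xi) * w * (a ^+ d.+1 * b ^+ d) - (3%:R + xi) * w' * (a ^+ d * b ^+ d.+1).
Proof.
by rewrite meval_Fhat (Fval_ext d xi (coneE a b w w')) cone_pt_F.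
Qed.

Definition T0 := cone 1 1 (3%:R + xi) (3%:R - xi).

Lemma T0_on : meval T0 (Fhat n d xi) = 0.
Proof. by rewrite cone_Fhat !expr1n !mulr1 mulrC subrr. Qed.

Lemma T0_last : [/\ T0 (inord n.*2) = 1, T0 (inord n.*2.+1) = 1,
  T0 (inord n.*2.+2) = 3%:R + xi & T0 (inord n.*2.+3) = 3%:R - xi].
Proof.
by rewrite /T0 !coneE ?cone_pt_a ?cone_pt_b ?cone_pt_w ?cone_pt_w' //; lia.
Qed.

Lemma T0_semistable : semistable (toric n) T0.
Proof.
have [a b w _] := T0_last; apply/toric_semistableP; split.
- by exists n => //; rewrite a oner_neq0.
- by exists n => //; rewrite b oner_neq0.
- by left; rewrite w.
Qed.

Lemma subvariety_Fhat : subvariety (toric n) (Fhat n d xi).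
Proof.
apply: subvarietyI (@hom_Fhat F n d xi) _ T0_on T0_semistable.
exact: prime_ideal_Fhat.
Qed.

Lemma mpcomp_hypX_blowdown : mpcomp (hypX F n d) (blowdown n xi) =
  - (xi^-1 * 2%:R^-1) *: (var F n.*2.+3 n.*2.+2 ^+ d * var F n.*2.+3 n.*2.+3 ^+ d * Fhat n d xi).
Proof.
rewrite -[LHS]mmap_id mmap_mpcomp mmap_hypX_blowdown // mmap_id -mpolyCM -mpolyCN.
by rewrite mul_mpolyC exprMn.
Qed.

Lemma strict_transform_Fhat : strict_transform n xi (hypX F n d) (Fhat n d xi).
Proof.
split.
- exists (- (xi^-1 * 2%:R^-1)), d, d; split; last exact: mpcomp_hypX_blowdown.
  by rewrite oppr_eq0 mulf_neq0 ?invr_eq0.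
- move=> /(mpdvd_meval (v := cone 1 1 0 1)).
  rewrite meval_var coneE; last by lia.
  rewrite cone_pt_w => /(_ erefl)/eqP.
  by rewrite cone_Fhat !expr1n !mulr1 mulr0 sub0r oppr_eq0 (negPf nzp).
- move=> /(mpdvd_meval (v := cone 1 1 1 0)).
  rewrite meval_var coneE; last by lia.
  rewrite cone_pt_w' => /(_ erefl)/eqP.
  by rewrite cone_Fhat !expr1n !mulr1 mulr0 subr0 (negPf nzm).
Qed.

Lemma mpcomp_Fhat_lift : mpcomp (Fhat n d xi) (lift_map xi) = - (2%:R * xi) *: hypX F n d.
Proof.
rewrite -[LHS]mmap_id mmap_mpcomp mmap_Fhat_lift // mmap_id -mul_mpolyC.
by rewrite mpolyCN mpolyCM rmorph_nat.
Qed.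

Lemma mapcomp_blowdown_lift : mapcomp (blowdown n xi) (lift_map xi) = coords.
Proof.
apply: funext => j; rewrite -[LHS]mmap_id mmap_mapcomp mmap_blowdown_lift //.
Qed.

Lemma mpdvd_scaler N c (f g : mpoly N F) : c != 0 -> mpdvd (c *: f) g -> mpdvd f g.
Proof. by move=> c0 [h ->]; exists (c *: h); rewrite -scalerAl scalerAr. Qed.

(** Pulled back along the blow-down, a factorisation modulo [hypX] becomes one
    modulo [Fhat], and [lift_map] is a section of the blow-down. *)
Lemma prime_ideal_hypX : prime_ideal (hypX F n d).
Proof.
have [f1 fM] := prime_ideal_Fhat n0 d0 nzm nzp; split.
  by move=> /(mpdvd_meval (v := @X0 F n))/(_ (@X0_on F n d))/eqP; rewrite meval1 oner_eq0.
have down g : mpdvd (Fhat n d xi) (mpcomp g (blowdown n xi)) -> mpdvd (hypX F n d) g.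
  move=> /(mpdvd_comp (lift_map xi)); rewrite mpcompA mapcomp_blowdown_lift mpcomp_coords.
  by rewrite mpcomp_Fhat_lift; apply: mpdvd_scaler; rewrite oppr_eq0 mulf_neq0.
move=> g h /(mpdvd_comp (blowdown n xi)); rewrite mpcomp_hypX_blowdown mpcompM.
move=> dv; have [|/down|/down] := fM (mpcomp g (blowdown n xi)) (mpcomp h (blowdown n xi)).
- case: dv => e ->; exists (- (xi^-1 / 2%:R) *: (e * (var F n.*2.+3 n.*2.+2 ^+ d * var F n.*2.+3 n.*2.+3 ^+ d))).
  by rewrite -!mul_mpolyC; ring.
- by left.
- by right.
Qed.

Lemma U0_psi : let q j := meval (@U0 F n) (psi_map d xi j) in
  [/\ q (inord n.*2) = 1, q (inord n.*2.+1) = 1,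
      q (inord n.*2.+2) = - 2%:R^-1 * (3%:R + xi) & q (inord n.*2.+3) = - 2%:R^-1 * (3%:R - xi)].
Proof.
move=> q; have [A1 B1] := U0_AB F n d.
rewrite /q /meval !(mmap_psi d xi idfun) !inordK ?inord_even_lt ?inord_odd_lt //.
rewrite psi_even // psi_odd // psi_wp psi_wm A1 B1 ufst_n usnd_n U0E // eqxx.
by rewrite !mulr0 subr0 addr0 !mulr1.
Qed.

Lemma U0_psi_semistable : semistable (toric n) (fun j => meval (@U0 F n) (psi_map d xi j)).
Proof.
have [a b w _] := U0_psi; apply/toric_semistableP; split.
- by exists n => //; rewrite a oner_neq0.
- by exists n => //; rewrite b oner_neq0.
- by left; rewrite w mulf_neq0 // oppr_eq0 invr_eq0.
Qed.

Lemma ratmap_psi : ratmap (Proj n.*2) 0 (toric n) (Fhat n d xi) (psi_map d xi).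
Proof.
split; first exact: hom_psi.
  rewrite -[mpcomp _ _]mmap_id mmap_mpcomp mmap_Fhat_psi //; exact: mpdvd0.
by apply: (gen_semistable_at (v := @U0 F n)); [exact: meval0 | exact: U0_psi_semistable].
Qed.

Lemma ratmap_retract : ratmap (toric n) (Fhat n d xi) (Proj n.*2) 0 (retract_map xi).
Proof.
split; first exact: hom_retract.
  by rewrite mpcomp0; apply: mpdvd0.
apply: (gen_semistable_at (v := T0)); first exact: T0_on.
apply/proj_semistableP; exists ord0; rewrite /meval (mmap_retract xi idfun) /retract_val /=.
have [a b _ _] := T0_last; rewrite /retract_fst a b mulr1 -[1 + 1]/(2%:R) mulVf //.
exact: oner_neq0.
Qed.

Lemma birational_psi : birational (Proj n.*2) 0 (toric n) (Fhat n d xi) (psi_map d xi).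
Proof.
apply: (@birationalI F (Proj n.*2) (toric n) _ _ _ (retract_map xi) (@U0 F n) T0).
- exact: subvariety_Proj.
- exact: subvariety_Fhat.
- exact: ratmap_psi.
- exact: ratmap_retract.
- exact: meval0.
- apply/proj_semistableP; exists ord0; rewrite meval_mapcomp /meval (mmap_retract_psi d F2 F3 xi2 idfun).
  by rewrite /U0 eqxx mulr1 oner_neq0.
- exact: T0_on.
- have [ev wp _] := mmap_psi_retract d F2 F3 xi2 idfun T0.
  have [/= a b w w'] := T0_last; apply/toric_semistableP; split.
  + exists n => //; rewrite meval_mapcomp /meval.
    by have [-> _] := ev n (leqnn n); rewrite a b mulr1 oner_neq0.
  + exists n => //; rewrite meval_mapcomp /meval.
    by have [_ ->] := ev n (leqnn n); rewrite a b mulr1 oner_neq0.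
  left; rewrite meval_mapcomp /meval wp a b (Qval_ext d (w := cone_pt n 1 1 (3%:R + xi) (3%:R - xi))).
    by rewrite cone_pt_Q // !expr1n !mulr1 !expr1n mulr1 mulf_neq0 // oppr_eq0 invr_eq0.
  by move=> t lt; rewrite /T0 coneE // leqW // leqW.
- move=> E i p _ _ /proj_semistableP[j nz] /proj_semistableP[l pl].
  apply/proj_orbitP; move: nz; rewrite mmap_mapcomp (mmap_retract_psi d F2 F3 xi2 i) => nz.
  have p0 : p ord0 != 0 by apply: contraNneq nz => ->; rewrite mul0r.
  exists (p ord0)^-1; rewrite ?invr_eq0 // => t.
  by rewrite mmap_mapcomp (mmap_retract_psi d F2 F3 xi2 i) mulKf // mmapXU.
- move=> E i p /toric_semistableP[_ _ pw] on /toric_semistableP[[j jn nz] [j' jn' nz'] nw] _.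
  have [ev wp wm] := mmap_psi_retract d F2 F3 xi2 i p.
  move: nz nz'; rewrite !mmap_mapcomp.
  have [-> _] := ev j jn; have [_ ->] := ev j' jn'.
  rewrite !mulf_eq0 !negb_or => /andP[b0 _] /andP[a0 _].
  move: on nw; rewrite !mmap_mapcomp wp wm mmap_Fhat /Fval; set P := Pval _ _ _; set Q := Qval _ _ _.
  set a := p (inord n.*2) in a0 *; set b := p (inord n.*2.+1) in b0 *.
  set w := p (inord n.*2.+2) in pw *; set w' := p (inord n.*2.+3) in pw *.
  set h := i 2%:R^-1; have h0 : h != 0 by rewrite fmorph_eq0 invr_eq0.
  set c := (a * b) ^+ d; have c0 : c != 0 by rewrite expf_neq0 // mulf_neq0.
  set m := 3%:R - i xi; set m' := 3%:R + i xi.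
  move=> on nw.
  (* The scalar t such that (m' Q, m P) = t (w, w'). *)
  have [t t0 [tw tw']] : exists2 t, t != 0 & m' * Q = t * w /\ m * P = t * w'.
    have on' : (m * P) * w = (m' * Q) * w'.
      by apply/eqP; rewrite -subr_eq0; apply/eqP; rewrite -[RHS]on; ring.
    have nPQ : m' * Q != 0 \/ m * P != 0.
      case: nw => nw; [left|right]; apply: contraNneq nw => e; apply/eqP.
        by transitivity (- h * (c * a * (m' * Q))); [ring | rewrite e !mulr0].
      by transitivity (- h * (c * b * (m * P))); [ring | rewrite e !mulr0].
    case: pw => pw.
      exists (m' * Q / w); last by split; [rewrite divfK | rewrite mulrAC -on' mulfK].
      rewrite mulf_neq0 ?invr_eq0 //; case: nPQ => // nP; apply/eqP => e.
      by move/eqP: on'; rewrite e mul0r mulf_eq0 (negPf nP) (negPf pw).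
    exists (m * P / w'); last by split; [rewrite mulrAC on' mulfK | rewrite divfK].
    rewrite mulf_neq0 ?invr_eq0 //; case: nPQ => // nP; apply/eqP => e.
    by move/eqP: on'; rewrite e mul0r eq_sym mulf_eq0 (negPf nP) (negPf pw).
  apply/toric_orbitP.
  have [s es s0] : exists2 s, s = - (h * c * t) & s != 0.
    by exists (- (h * c * t)); rewrite ?oppr_eq0 ?mulf_neq0.
  exists (a * b * s)^-1, (s * a)^-1, (s * b)^-1; rewrite !invr_eq0 !mulf_neq0 //.
  split=> // [l ln|]; rewrite /coords !mmapXU !mmap_mapcomp ?wp ?wm.
    by have [-> ->] := ev l ln; rewrite -/a -/b; split; field; rewrite ?a0 ?b0 ?s0 ?oner_neq0.
  rewrite -/a -/b -/Q -/P -/h -/c -/m -/m'.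
  split.
    transitivity ((s * a)^-1 * (- h * (c * a * (m' * Q)))); last by congr (_ * _); ring.
    rewrite tw; have -> : - h * (c * a * (t * w)) = s * a * w by rewrite es; ring.
    by rewrite mulKf // mulf_neq0.
  transitivity ((s * b)^-1 * (- h * (c * b * (m * P)))); last by congr (_ * _); ring.
  rewrite tw'; have -> : - h * (c * b * (t * w')) = s * b * w' by rewrite es; ring.
  by rewrite mulKf // mulf_neq0.
Qed.

Lemma ratmap_blowdown :
  ratmap (toric n) (Fhat n d xi) (Proj n.*2.+1) (hypX F n d) (blowdown n xi).
Proof.
split; first exact: hom_blowdown.
  by rewrite mpcomp_hypX_blowdown -mul_mpolyC mulrA; exists (mpolyC _ (- (xi^-1 / 2%:R)) * (var F n.*2.+3 n.*2.+2 ^+ d * var F n.*2.+3 n.*2.+3 ^+ d)).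
apply: (gen_semistable_at (v := T0)); first exact: T0_on.
apply/proj_semistableP; exists (inord n.*2.+1); rewrite /meval (mmap_blowdown xi idfun).
have [a b w w'] := T0_last.
rewrite inordK // /blow_val by_parity_odd a b w w' !mul1r mulf_neq0 ?invr_eq0 //.
have -> : 3%:R - xi - (3%:R + xi) = - (2%:R * xi) by ring.
by rewrite oppr_eq0 mulf_neq0.
Qed.

Lemma ratmap_lift :
  ratmap (Proj n.*2.+1) (hypX F n d) (toric n) (Fhat n d xi) (lift_map xi).
Proof.
split; first exact: hom_lift.
  by rewrite mpcomp_Fhat_lift -mul_mpolyC; exists (mpolyC _ (- (2%:R * xi))).
apply: (gen_semistable_at (v := @X0 F n)); first exact: X0_on.
have [a b] := X0_last F n; apply/toric_semistableP; split.
- exists n => //; rewrite /meval (mmap_lift xi idfun) inordK ?inord_even_lt // lift_even // a b mulrN1 opprK.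
  have -> : 1 + (1 + xi) / 2%:R = 2%:R^-1 * (3%:R + xi) by field.
  by rewrite mulf_neq0 ?invr_eq0.
- exists n => //; rewrite /meval (mmap_lift xi idfun) inordK ?inord_odd_lt // lift_odd // a b mulrN1 opprK.
  have -> : 1 + (1 - xi) / 2%:R = 2%:R^-1 * (3%:R - xi) by field.
  by rewrite mulf_neq0 ?invr_eq0.
- by left; rewrite /meval (mmap_lift xi idfun) inordK // lift_wp oner_neq0.
Qed.

Lemma birational_blowdown :
  birational (toric n) (Fhat n d xi) (Proj n.*2.+1) (hypX F n d) (blowdown n xi).
Proof.
apply: (@birationalI F (toric n) (Proj n.*2.+1) _ _ _ (lift_map xi) T0 (@X0 F n)).
- exact: subvariety_Fhat.
- exact: subvariety_hypX prime_ideal_hypX.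
- exact: ratmap_blowdown.
- exact: ratmap_lift.
- exact: T0_on.
- have [ev [wp _]] := mmap_lift_blowdown F2 F3 xi2 idfun T0.
  have [/= a b w w'] := T0_last; apply/toric_semistableP; split.
  + exists n => //; rewrite meval_mapcomp /meval.
    by have [-> _] := ev n (leqnn n); rewrite a w mulr1.
  + exists n => //; rewrite meval_mapcomp /meval.
    by have [_ ->] := ev n (leqnn n); rewrite b w' mulr1.
  by left; rewrite meval_mapcomp /meval wp oner_neq0.
- exact: X0_on.
- apply: (@semistable_eq (Proj n.*2.+1) F (@X0 F n)); last exact: X0_semistable.
  by move=> j; rewrite mapcomp_blowdown_lift /coords mevalXU.
- move=> E i p _ _ /toric_semistableP[[j jn nz] [j' jn' nz'] _] _.
  have [ev [wp wm]] := mmap_lift_blowdown F2 F3 xi2 i p.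
  move: nz nz'; rewrite !mmap_mapcomp; have [-> _] := ev j jn; have [_ ->] := ev j' jn'.
  rewrite !mulf_eq0 !negb_or => /andP[w0 _] /andP[w0' _].
  apply/toric_orbitP; exists 1, (p (inord n.*2.+2)), (p (inord n.*2.+3)).
  split=> // [|l ln|]; rewrite ?oner_neq0 // /coords !mmapXU !mmap_mapcomp ?wp ?wm ?mulr1 //.
  by have [-> ->] := ev l ln; rewrite !mul1r !mulKf.
- move=> E i p _ _ _ _; rewrite mapcomp_blowdown_lift.
  by apply/proj_orbitP; exists 1; rewrite ?oner_neq0 // => j; rewrite mul1r.
Qed.

Lemma mapcomp_blowdown_psi : mapcomp (blowdown n xi) (psi_map d xi) = phi F n d.
Proof.
by apply: funext => j; rewrite -[LHS]mmap_id mmap_mapcomp mmap_blowdown_psi // mmap_id.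
Qed.

End StrictTransform.

(** * Galois descent *)

Definition flip (t : nat) : nat := if odd t then t.-1 else t.+1.

Lemma flip_even i : flip i.*2 = i.*2.+1.
Proof. by rewrite /flip odd_double. Qed.

Lemma flip_odd i : flip i.*2.+1 = i.*2.
Proof. by rewrite /flip /= odd_double. Qed.

Lemma flipK : involutive flip.
Proof.
move=> t; rewrite -[t]odd_double_half.
by case: (odd t); rewrite ?add0n ?add1n ?flip_even ?flip_odd ?flip_even.
Qed.

Lemma flip_le n t : (t <= n.*2.+3)%N -> (flip t <= n.*2.+3)%N.
Proof.
rewrite -[t]odd_double_half /flip; case: (odd t); rewrite ?add0n ?add1n /= odd_double /=.
  exact: ltnW.
by rewrite !ltnS -!doubleS !leq_double; move: (t./2) => h; rewrite leq_Sdouble.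
Qed.

Section Flip.
Variables (S : comNzRingType) (n d : nat).
Implicit Types (u p : nat -> S) (xi ixi hf : S).

Lemma psi_flip xi hf u t : (t <= n.*2.+3)%N ->
  psi_val n d (- xi) hf u (flip t) = psi_val n d xi hf u t.
Proof.
rewrite -[t]odd_double_half; set i := t./2; case: (odd t); rewrite ?add0n ?add1n => ti.
  have : (i <= n.+1)%N by lia.
  rewrite flip_odd leq_eqVlt => /orP[/eqP ->|]; rewrite ?ltnS.
    by rewrite doubleS psi_wp psi_wm; ring.
  by move=> h; rewrite psi_even // psi_odd //; ring.
have : (i <= n.+1)%N by lia.
rewrite flip_even leq_eqVlt => /orP[/eqP ->|]; rewrite ?ltnS.
  by rewrite doubleS psi_wp psi_wm; ring.
by move=> h; rewrite psi_even // psi_odd //; ring.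
Qed.

Lemma blow_flip xi ixi hf p t :
  blow_val n (- xi) (- ixi) hf (p \o flip) t = blow_val n xi ixi hf p t.
Proof.
rewrite /blow_val /by_parity /= !flip_even !flip_odd -!doubleS flip_even flip_odd.
by case: ifP => _; ring.
Qed.

End Flip.

Lemma same_orbit_refl (C : coxSpace) (E : fieldType) (p : 'I_(nvar C) -> E) :
  same_orbit C p p.
Proof.
exists (fun=> 1) => [b|j]; first exact: oner_neq0.
by rewrite big1 ?mul1r // => b _; rewrite exp1rz.
Qed.

Lemma ratmap_eq_refl (F : fieldType) (C1 C2 : coxSpace) (f1 : mpoly (nvar C1) F)
  (G : 'I_(nvar C2) -> mpoly (nvar C1) F) : ratmap_eq C1 f1 C2 G G.
Proof. by move=> *; apply: same_orbit_refl. Qed.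

Section Quadratic.
Variables (k : fieldType) (L : fieldExtType k) (xi : L).
Hypothesis xi2 : xi ^+ 2 = - 3%:R.

Lemma gal_xi (s : 'AEnd(L)) : s xi = xi \/ s xi = - xi.
Proof.
have : s xi ^+ 2 == xi ^+ 2 by rewrite -rmorphXn xi2 rmorphN rmorph_nat.
by rewrite eqf_sqr => /orP[]/eqP ->; [left|right].
Qed.

Lemma swap_index_fix n (s : 'AEnd(L)) (j : 'I_n.*2.+4) : s xi = xi -> swap_index xi s j = j.
Proof. by move=> e; rewrite /swap_index e eqxx. Qed.

Hypothesis L2 : 2%:R != 0 :> L.
Hypothesis L3 : 3%:R != 0 :> L.

Lemma xi_neqN : - xi != xi.
Proof.
by rewrite eq_sym -subr_eq0 opprK -mulr2n -mulr_natl mulf_neq0 ?(xi_neq0 L3 xi2).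
Qed.

Lemma swap_index_flip n (s : 'AEnd(L)) (j : 'I_n.*2.+4) : s xi = - xi ->
  swap_index xi s j = flip j :> nat.
Proof.
move=> e; rewrite /swap_index e (negPf xi_neqN) inordK // ltnS.
by apply: flip_le; rewrite -ltnS.
Qed.

Variables (n d : nat).

Lemma descends_to_psi : descends_to xi (psi_map (n := n) d xi).
Proof.
move=> s; suff -> : (fun j : 'I_n.*2.+4 => map_mpoly s (psi_map d xi (swap_index xi s j))) = psi_map d xi.
  exact: ratmap_eq_refl.
apply: funext => j; rewrite /psi_map (rmorph_psi_val (map_mpoly s)) /=. rewrite !map_mpolyC /=.
have -> : map_mpoly s \o var L n.*2 = var L n.*2.
  by apply: funext => t; rewrite /= map_mpolyX.
have -> : s 2%:R^-1 = 2%:R^-1 by rewrite fmorphV rmorph_nat.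
case: (gal_xi s) => e; first by rewrite swap_index_fix // e.
by rewrite swap_index_flip // e mpolyCN psi_flip // -ltnS.
Qed.

Lemma descends_from_blowdown : descends_from xi n d (blowdown n xi).
Proof.
move=> s; suff -> : mapcomp (fun j => map_mpoly s (blowdown n xi j))
    (fun l => coords (swap_index xi s l)) = blowdown n xi.
  exact: ratmap_eq_refl.
apply: funext => j; rewrite /mapcomp mpcompE blowdownE.
rewrite (rmorph_blow_val (map_mpoly s)) (rmorph_blow_val (mmap (@mpolyC _ _) _)).
have eV : s xi^-1 = (s xi)^-1 by exact: fmorphV.
have e2 : s 2%:R^-1 = 2%:R^-1 by rewrite fmorphV rmorph_nat.
rewrite /= !map_mpolyC /= !mmapC /= eV e2.
have le : (j <= n.*2.+1)%N by rewrite -ltnS.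
have ev t : (t <= n.*2.+3)%N -> mmap (@mpolyC _ _) (fun l => coords (swap_index xi s l))
    (map_mpoly s (var L n.*2.+3 t)) = var L n.*2.+3 (swap_index (n := n) xi s (inord t)).
  by move=> lt; rewrite map_mpolyX mmap_var /coords /var inord_val.
case: (gal_xi s) => e.
  rewrite e; apply: blow_ext => // t lt /=.
  by rewrite ev // swap_index_fix // inordK.
rewrite e invrN !mpolyCN -[RHS]blow_flip; apply: blow_ext => // t lt /=.
by rewrite ev // swap_index_flip // inordK.
Qed.

End Quadratic.

Lemma part_i n d (k : fieldType) (L : fieldExtType k) (xi : L) :
  (0 < n)%N -> (0 < d)%N -> quadratic_setting xi ->
    [/\ multihomog (toric n) (Fhat_class d) (Fhat n d xi) /\
          strict_transform n xi (hypX L n d) (Fhat n d xi),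
        birational (Proj n.*2) 0 (Proj n.*2.+1) (hypX k n d) (phi k n d),
        exists psi : 'I_(nvar (toric n)) -> mpoly n.*2.+1 L,
          [/\ ratmap (Proj n.*2) 0 (Proj n.*2.+1) (hypX L n d)
                (mapcomp (blowdown n xi) psi),
              ratmap_eq (Proj n.*2) 0 (Proj n.*2.+1)
                (mapcomp (blowdown n xi) psi) (phi L n d),
              birational (Proj n.*2) 0 (toric n) (Fhat n d xi) psi &
              descends_to xi psi],
        birational (toric n) (Fhat n d xi) (Proj n.*2.+1) (hypX L n d)
          (blowdown n xi) /\ descends_from xi n d (blowdown n xi) &
        d = 1%N -> hypX k n d = fermat_cubic k n].
Proof.
move=> n0 d0 [k2 k3 _ _ xi2].
have nz (m : nat) : prime m -> m \notin [pchar k] -> m%:R != 0 :> k.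
  by move=> pm; apply: contraNneq => e; rewrite inE pm e eqxx.
have K2 := nz 2%N isT k2; have K3 := nz 3%N isT k3.
have toL (m : nat) : m%:R != 0 :> k -> m%:R != 0 :> L.
  by rewrite -(rmorph_nat (in_alg L)) fmorph_eq0.
have L2 := toL _ K2; have L3 := toL _ K3.
split.
- split; first exact: hom_Fhat.
  exact: strict_transform_Fhat.
- apply: birational_phi => //; apply: (@prime_ideal_descend k L).
  by rewrite map_hypX; apply: (prime_ideal_hypX n0 d0 L2 L3 xi2).
- exists (psi_map d xi); rewrite mapcomp_blowdown_psi //; split.
  + exact: ratmap_phi.
  + exact: ratmap_eq_refl.
  + exact: birational_psi.
  + exact: descends_to_psi.
- by split; [exact: birational_blowdown | exact: descends_from_blowdown].
- by move=> ->; exact: hypX_fermat.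
Qed.

(** * Rational points of the strict transform *)

Lemma lift_flip (S : comNzRingType) n (xi hf : S) x t : (t <= n.*2.+3)%N ->
  lift_val n (- xi) hf x (flip t) = lift_val n xi hf x t.
Proof.
rewrite -[t]odd_double_half; set i := t./2; case: (odd t); rewrite ?add0n ?add1n => ti.
  have : (i <= n.+1)%N by lia.
  rewrite flip_odd leq_eqVlt => /orP[/eqP ->|]; rewrite ?ltnS.
    by rewrite doubleS lift_wp lift_wm.
  by move=> h; rewrite lift_even // lift_odd //; ring.
have : (i <= n.+1)%N by lia.
rewrite flip_even leq_eqVlt => /orP[/eqP ->|]; rewrite ?ltnS.
  by rewrite doubleS lift_wp lift_wm.
by move=> h; rewrite lift_even // lift_odd // opprK.
Qed.

Section OrbitSets.
Variables (C : coxSpace) (F : fieldType).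
Implicit Types p q r : 'I_(nvar C) -> F.

Lemma exprzMf (x y : F) (m : int) : x != 0 -> y != 0 -> (x * y) ^ m = x ^ m * y ^ m.
Proof. by move=> x0 y0; apply: exprMz_comm; rewrite ?unitfE //; apply: mulrC. Qed.

Lemma same_orbit_sym p q : same_orbit C p q -> same_orbit C q p.
Proof.
case=> t t0 e; exists (fun b => (t b)^-1) => [b|j]; first by rewrite invr_eq0.
rewrite e mulrA -big_split big1 ?mul1r // => b _ /=.
by rewrite -exprzMf ?mulVf ?exp1rz // invr_eq0.
Qed.

Lemma same_orbit_trans p q r : same_orbit C p q -> same_orbit C q r -> same_orbit C p r.
Proof.
case=> t t0 e [s s0 e']; exists (fun b => s b * t b) => [b|j]; first by rewrite mulf_neq0.
rewrite e' e mulrA -big_split; congr (_ * _); apply: eq_bigr => b _ /=.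
by rewrite exprzMf.
Qed.

Lemma orbitP p q : Defs.orbit C p = Defs.orbit C q <-> same_orbit C p q.
Proof.
split=> [e|pq].
  have : Defs.orbit C q q by apply: (@same_orbit_refl C F q).
  by rewrite -e.
apply/seteqP; split=> r; first by apply: same_orbit_trans; apply: same_orbit_sym.
exact: same_orbit_trans.
Qed.

End OrbitSets.

Section TwistedPoints.
Variables (k : fieldType) (L : fieldExtType k) (xi : L) (n d : nat).
Hypothesis xi2 : xi ^+ 2 = - 3%:R.
Hypotheses (L2 : 2%:R != 0 :> L) (L3 : 3%:R != 0 :> L).

(** The point of the blow-up above the k-point c. *)
Definition lift_pt (c : 'I_n.*2.+2 -> k) : 'I_(nvar (toric n)) -> L :=
  fun j => lift_val n xi 2%:R^-1 (fun t => (c (inord t))%:A) j.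

Lemma lift_ptE c j : lift_pt c j = mmap idfun (fun l => (c l)%:A) (lift_map xi j).
Proof. by rewrite (mmap_lift xi idfun). Qed.

Lemma in_algE (c : k) : c%:A = in_alg L c. Proof. by []. Qed.

Lemma lift_pt_Fhat c : meval (lift_pt c) (Fhat n d xi) = - (2%:R * xi) * (meval c (hypX k n d))%:A.
Proof.
have -> : lift_pt c = fun j => mmap idfun (fun l => (c l)%:A) (lift_map xi j).
  by apply: funext => j; apply: lift_ptE.
rewrite /meval (mmap_Fhat_lift d L2 L3 xi2 idfun) /=; congr (_ * _).
rewrite (mmap_hypX d idfun) (mmap_hypX d idfun) in_algE.
rewrite /Xval rmorph_sum; apply: eq_bigr => i _.
rewrite rmorphM rmorphXn /normval !rmE.
by [].
Qed.

Lemma blowdown_lift_pt c j : meval (lift_pt c) (blowdown n xi j) = (c j)%:A.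
Proof.
rewrite -[RHS](mmap_blowdown_lift L2 L3 xi2 idfun (fun l => (c l)%:A)).
by congr (mmap idfun _ _); apply: funext => l; apply: lift_ptE.
Qed.

Lemma gal_lift_pt c (s : 'AEnd(L)) : gal_point xi s (lift_pt c) = lift_pt c.
Proof.
apply: funext => j; rewrite /gal_point /lift_pt (rmorph_lift_val s) /=.
have -> : s 2%:R^-1 = 2%:R^-1 by rewrite fmorphV rmorph_nat.
have -> : s \o (fun t => (c (inord t))%:A) = (fun t => (c (inord t))%:A).
  by apply: funext => t /=; rewrite linearZ /= rmorph1.
case: (gal_xi xi2 s) => e; first by rewrite swap_index_fix // e.
by rewrite swap_index_flip // e lift_flip // -ltnS.
Qed.

Lemma gal_orbit_sub (s : 'AEnd(L)) p : gal_point xi s p = p ->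
  gal_point xi s @` Defs.orbit (toric n) p `<=` Defs.orbit (toric n) p.
Proof.
move=> gp _ [q /toric_orbitP[t0 [t1 [t2 [n0 n1 n2 e [ep em]]]]] <-].
have sM x y : s (x * y) = s x * s y by exact: rmorphM.
have sV x : s x^-1 = (s x)^-1 by exact: fmorphV.
have gpj j : s (p (swap_index xi s j)) = p j by rewrite -[in RHS]gp.
apply/toric_orbitP; case: (gal_xi xi2 s) => es.
  have gj j : s (p j) = p j by have := gpj j; rewrite swap_index_fix.
  exists (s t0), (s t1), (s t2); rewrite !fmorph_eq0; split=> // [i h|].
    rewrite /gal_point !swap_index_fix //; have [-> ->] := e i h.
    by rewrite !sM !sV !gj.
  by rewrite /gal_point !swap_index_fix // ep em !sM !gj.
have sw i j : (i <= n.*2.+3)%N -> flip i = j -> swap_index xi s (inord i : 'I_n.*2.+4) = inord j.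
  move=> h f; apply: val_inj; rewrite /= swap_index_flip // !inordK //; rewrite -?f ?ltnS //.
  exact: flip_le.
have s0 i : (i <= n)%N -> swap_index xi s (inord i.*2) = inord i.*2.+1 :> 'I_n.*2.+4.
  by move=> h; apply: sw; [rewrite -ltnS inord_even_lt | exact: flip_even].
have s1 i : (i <= n)%N -> swap_index xi s (inord i.*2.+1) = inord i.*2 :> 'I_n.*2.+4.
  by move=> h; apply: sw; [rewrite -ltnS inord_odd_lt | exact: flip_odd].
have s2 : swap_index xi s (inord n.*2.+2) = inord n.*2.+3 :> 'I_n.*2.+4.
  by apply: sw => //; rewrite -doubleS flip_even.
have s3 : swap_index xi s (inord n.*2.+3) = inord n.*2.+2 :> 'I_n.*2.+4.
  by apply: sw => //; rewrite -(doubleS n) flip_odd.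
exists (s t0), (s t2), (s t1); rewrite !fmorph_eq0; split=> // [i h|].
  rewrite /gal_point s0 // s1 //; have [-> ->] := e i h.
  have := gpj (inord i.*2); have := gpj (inord i.*2.+1); rewrite s0 // s1 // => g1 g0.
  by rewrite !sM !sV g0 g1.
have := gpj (inord n.*2.+2); have := gpj (inord n.*2.+3); rewrite s2 s3 => g1 g0.
by rewrite /gal_point s2 s3 ep em !sM g0 g1.
Qed.

Lemma gal_orbit p : (forall s : 'AEnd(L), gal_point xi s p = p) ->
  forall s : 'AEnd(L), gal_point xi s @` Defs.orbit (toric n) p = Defs.orbit (toric n) p.
Proof.
move=> gp s; apply/seteqP; split; first exact: gal_orbit_sub.
move=> q pq; exists (gal_point xi (inv_ahom s) q).
  by apply: (gal_orbit_sub (gp (inv_ahom s))); exists q.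
have sK : cancel (inv_ahom s) s by move=> z; rewrite /= lker0_lfunVK // AEnd_lker0.
apply: funext => j; rewrite /gal_point sK; congr q; case: (gal_xi xi2 s) => e.
  rewrite [swap_index xi s j]swap_index_fix // swap_index_fix //.
  by rewrite -[in LHS]e /= lker0_lfunK // AEnd_lker0.
have e' : inv_ahom s xi = - xi.
  by apply: (canLR (lker0_lfunK (AEnd_lker0 s))); rewrite linearN /= e opprK.
apply: val_inj; rewrite /= !swap_index_flip //.
by rewrite flipK.
Qed.

Lemma lift_pt_orbit c c' :
  same_orbit (toric n) (lift_pt c) (lift_pt c') -> same_orbit (Proj n.*2.+1) c c'.
Proof.
move=> /toric_orbitP[t0 [t1 [t2 [n0 n1 n2 e [ep em]]]]].
have w1 : lift_pt c (inord n.*2.+2) = 1 by rewrite /lift_pt inordK // lift_wp.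
have w2 : lift_pt c (inord n.*2.+3) = 1 by rewrite /lift_pt inordK // lift_wm.
have w1' : lift_pt c' (inord n.*2.+2) = 1 by rewrite /lift_pt inordK // lift_wp.
have w2' : lift_pt c' (inord n.*2.+3) = 1 by rewrite /lift_pt inordK // lift_wm.
move: ep em e; rewrite w1 w2 w1' w2' !mulr1 => <- <-; rewrite divr1 => e.
have cc' j : (c' j)%:A = t0 * (c j)%:A.
  rewrite -!blowdown_lift_pt /meval !(mmap_blowdown xi idfun) /blow_val /by_parity.
  have jn : (j./2 <= n)%N by apply: half_le; rewrite -ltnS.
  have [-> ->] := e _ jn; rewrite w1 w2 w1' w2'.
  by case: ifP => _; ring.
apply/proj_orbitP; have [[j cj]|c0] := pselect (exists j, c j != 0); last first.
  exists 1; rewrite ?oner_neq0 // => j; apply: (fmorph_inj (in_alg L)).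
  have cj : c j = 0 by apply/eqP/negP => /negP cj; apply: c0; exists j.
  by rewrite /= cc' cj scale0r mulr0 mulr0 scale0r.
have t0E : t0 = (c' j / c j)%:A.
  apply: (mulIf (x := (c j)%:A)); first by rewrite (fmorph_eq0 (in_alg L)).
  by rewrite -cc' -(rmorphM (in_alg L)) divfK.
exists (c' j / c j).
  by apply: contraNneq n0 => e0; rewrite t0E e0 scale0r.
by move=> l; apply: (fmorph_inj (in_alg L)); rewrite rmorphM /= cc' t0E.
Qed.

Lemma Xtilde_lift_pt c : semistable (toric n) (lift_pt c) -> meval c (hypX k n d) = 0 ->
  Xtilde_points xi n d (Defs.orbit (toric n) (lift_pt c)).
Proof.
move=> ss c0; split.
  by exists (lift_pt c) => //; split=> //; rewrite lift_pt_Fhat c0 scale0r mulr0.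
by apply: gal_orbit => s; apply: gal_lift_pt.
Qed.

End TwistedPoints.

(** * Points of bounded height *)

Section PrimitiveElement.
Variable K : fieldExtType rat.

Definition eval_at (theta : K) (P : {poly rat}) : K := (map_poly (in_alg K) P).[theta].

Lemma primitive_element : exists (theta : K) (q : {poly int}) (D : nat),
  [/\ (0 < D)%N, size q = D.+1, \sum_(i < D.+1) (q`_i)%:~R * theta ^+ i = 0,
      forall z, exists P, z = eval_at theta P &
      forall P : {poly rat}, (size P <= D)%N -> eval_at theta P = 0 -> P = 0].
Proof.
have char0 : has_char0 K by move=> p; rewrite pchar_lalg; apply: pchar_num.
have sep : separable 1%AS {:K}%AS by apply/separableP => y _; apply: pcharf0_separable.
set theta := separable_generator 1%AS {:K}%AS.
have gen : {:K}%VS = <<1; theta>>%VS.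
  exact: (eq_adjoin_separable_generator sep (sub1v _)).
pose D := adjoin_degree 1%AS theta.
have [p Ep] : exists p, minPoly 1 theta = map_poly (in_alg K) p by apply/polyOver1P/minPolyOver.
have [q [a a0 Eq]] := rat_poly_scale p.
have aQ : (a%:~R : rat) != 0 by rewrite intr_eq0.
have q0 : q != 0.
  apply: contraTneq (monic_minPoly 1%AS theta) => q0.
  by rewrite Ep Eq q0 rmorph0 scaler0 rmorph0 monicE lead_coef0 eq_sym oner_eq0.
have sq : size q = D.+1.
  rewrite -(size_minPoly 1%AS theta) Ep size_map_poly Eq size_scale ?invr_eq0 //.
  by rewrite size_map_poly_id0 // intr_eq0 lead_coef_eq0.
exists theta, q, D; split=> //.
- have : (map_poly (in_alg K) (map_poly (intr : int -> rat) q)).[theta] = 0.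
    have -> : map_poly (intr : int -> rat) q = a%:~R *: p by rewrite Eq scalerA mulfV // scale1r.
    by rewrite map_polyZ hornerZ -Ep minPolyxx mulr0.
  have sz : size (map_poly (in_alg K) (map_poly (intr : int -> rat) q)) = D.+1.
    by rewrite size_map_poly size_map_poly_id0 // intr_eq0 lead_coef_eq0.
  rewrite horner_coef sz => e; rewrite -[RHS]e.
  apply: eq_bigr => i _; rewrite !coef_map; congr (_ * _).
  exact/esym/(rmorph_int (in_alg K)).
- by move=> z; apply/Fadjoin1_polyP; rewrite -gen memvf.
- move=> P sP P0; have : minPoly 1 theta %| map_poly (in_alg K) P.
    apply: minPoly_dvdp; last exact/rootP.
    by apply/polyOver1P; exists P.
  case: (eqVneq P 0) => // nzP /dvdp_leq; rewrite size_minPoly map_poly_eq0 size_map_poly.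
  by move=> /(_ nzP); rewrite ltnNge sP.
Qed.

End PrimitiveElement.

Section Places.
Variables (R : realType) (K : fieldExtType rat).

Section FinitePlace.
Variable v : K -> R.
Hypothesis hv : finite_places v.

Lemma place0 : v 0 = 0. Proof. by case: hv => -[]. Qed.
Lemma place_gt0 a : a != 0 -> 0 < v a. Proof. by case: hv => -[_ h] _ _ _; apply: h. Qed.
Lemma placeM a b : v (a * b) = v a * v b. Proof. by case: hv => _ ->. Qed.
Lemma placeD a b : v (a + b) <= Num.max (v a) (v b). Proof. by case: hv => _ _ h _; apply: h. Qed.

Lemma place_ge0 a : 0 <= v a.
Proof. by have [->|/place_gt0/ltW//] := eqVneq a 0; rewrite place0. Qed.

Lemma place1 : v 1 = 1.
Proof.
have n1 : v 1 != 0 by rewrite gt_eqF // place_gt0 ?oner_neq0.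
by apply: (mulfI n1); rewrite -placeM !mulr1.
Qed.

Lemma placeN a : v (- a) = v a.
Proof.
suff e : v (-1) = 1 by rewrite -mulN1r placeM e mul1r.
have /eqP : v (-1) ^+ 2 = 1 by rewrite expr2 -placeM mulrNN mulr1 place1.
rewrite sqrf_eq1 => /orP[/eqP//|/eqP e].
by have := place_ge0 (-1); rewrite e ler0N1.
Qed.

Lemma placeX a m : v (a ^+ m) = v a ^+ m.
Proof. by elim: m => [|m IH]; rewrite ?place1 // !exprS placeM IH. Qed.

Lemma place_sum (I : Type) (r : seq I) (F : I -> K) b : 0 <= b ->
  (forall i, v (F i) <= b) -> v (\sum_(i <- r) F i) <= b.
Proof.
move=> b0 h; elim: r => [|i r IH]; first by rewrite big_nil place0.
by rewrite big_cons (le_trans (placeD _ _)) // ge_max h IH.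
Qed.

Lemma place_nat m : v m%:R <= 1.
Proof.
elim: m => [|m IH]; first by rewrite place0.
by rewrite -natr1 (le_trans (placeD _ _)) // ge_max IH place1 lexx.
Qed.

Lemma place_int z : v z%:~R <= 1.
Proof.
by case: (intP z) => [|m|m]; rewrite ?place0 // ?rmorphN /= ?placeN; apply: place_nat.
Qed.

End FinitePlace.

Variables (theta : K) (q : {poly int}) (D : nat).
Hypotheses (D0 : (0 < D)%N) (sq : size q = D.+1).
Hypothesis root_q : \sum_(i < D.+1) (q`_i)%:~R * theta ^+ i = 0.

(** An integral multiple of theta. *)
Definition int_theta : K := (lead_coef q)%:~R * theta.

Lemma lead_relation : (lead_coef q)%:~R * theta ^+ D = - \sum_(i < D) (q`_i)%:~R * theta ^+ i.
Proof.
by apply/eqP; rewrite -addr_eq0 addrC -[X in _ == X]root_q big_ord_recr /= lead_coefE sq.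
Qed.

Lemma place_int_theta (v : K -> R) : finite_places v -> v int_theta <= 1.
Proof.
move=> hv; rewrite /int_theta (placeM hv).
have [t1|t1] := leP (v theta) 1; first by rewrite mulr_ile1 ?place_ge0 ?place_int.
have t0 : 0 < v theta by apply: lt_trans t1.
rewrite -(ler_pM2r (exprn_gt0 D.-1 t0)) mul1r -mulrA -exprS prednK //.
rewrite -(placeX hv) -(placeM hv) lead_relation (placeN hv).
apply: (place_sum hv) => [|i]; first by rewrite exprn_ge0 // ltW.
rewrite (placeM hv) (placeX hv) -[X in _ <= X]mul1r ler_pM ?(place_int hv) ?exprn_ge0 ?(place_ge0 hv) //.
by rewrite ler_weXn2l ?(ltW t1) // -ltnS prednK.
Qed.

Local Notation normc := ComplexField.Normc.normc.

Lemma normc_ge0 (x : R[i]) : 0 <= normc x.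
Proof. by case: x => a b; rewrite /= sqrtr_ge0. Qed.

Lemma normc_sum (I : Type) (r : seq I) (F : I -> R[i]) :
  normc (\sum_(i <- r) F i) <= \sum_(i <- r) normc (F i).
Proof.
elim: r => [|i r IH]; first by rewrite !big_nil ComplexField.Normc.normc0.
by rewrite !big_cons (le_trans (le_normcD _ _)) // lerD2l.
Qed.

Lemma normcX (x : R[i]) m : normc (x ^+ m) = normc x ^+ m.
Proof.
elim: m => [|m IH]; first by rewrite !expr0 ComplexField.Normc.normc1.
by rewrite !exprS ComplexField.Normc.normcM IH.
Qed.

Lemma normc_int (z : int) : normc (z%:~R : R[i]) = `|z|%:~R.
Proof.
have h m : normc (m%:R : R[i]) = m%:R.
  by rewrite (normcMn (1 : R[i])) ComplexField.Normc.normc1.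
by case: (intP z) => [|m|m]; rewrite ?(h 0%N) // ?rmorphN /= ?normrN ?normcN; apply: h.
Qed.

Lemma int_norm_ge1 (z : int) : z != 0 -> 1 <= (`|z|%:~R : R).
Proof. by move=> z0; rewrite -[1]/(1%:~R) ler_int -gtz0_ge1 normr_gt0. Qed.

Definition cauchy_bound : R := `|lead_coef q|%:~R + \sum_(i < D) `|q`_i|%:~R.

Lemma cauchy_bound_ge1 : 1 <= cauchy_bound.
Proof.
rewrite -[1]addr0 lerD //; last by apply: sumr_ge0 => i _; rewrite ler0z.
by apply: int_norm_ge1; rewrite lead_coef_eq0 -size_poly_gt0 sq.
Qed.

(** Cauchy's bound for the roots of q, multiplied by its leading coefficient. *)
Lemma normc_int_theta (f : {rmorphism K -> R[i]}) : normc (f int_theta) <= cauchy_bound.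
Proof.
rewrite rmorphM /= rmorph_int ComplexField.Normc.normcM normc_int.
set t := normc _; have t0 : 0 <= t by apply: normc_ge0.
have [t1|t1] := leP t 1.
  rewrite -[X in X <= _]addr0 lerD //; last by apply: sumr_ge0 => i _; rewrite ler0z.
  by rewrite -[X in _ <= X]mulr1 ler_wpM2l // ler0z.
have tp : 0 < t by apply: lt_trans t1.
rewrite -(ler_pM2r (exprn_gt0 D.-1 tp)) -mulrA -exprS prednK //.
have -> : `|lead_coef q|%:~R * t ^+ D = normc (f (- \sum_(i < D) (q`_i)%:~R * theta ^+ i)).
  by rewrite -lead_relation rmorphM rmorphXn rmorph_int ComplexField.Normc.normcM normc_int normcX.
rewrite rmorphN rmorph_sum normcN (le_trans (normc_sum _ _)) //.
rewrite /cauchy_bound mulrDl mulr_suml -[X in X <= _]add0r lerD //.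
  by rewrite mulr_ge0 ?ler0z ?exprn_ge0.
apply: ler_sum => i _; rewrite rmorphM rmorphXn rmorph_int ComplexField.Normc.normcM normc_int normcX.
by rewrite ler_wpM2l ?ler0z // ler_weXn2l ?(ltW t1) // -ltnS prednK.
Qed.

End Places.

Section Heights.
Variables (R : realType) (K : fieldExtType rat).
Variables (theta : K) (q : {poly int}) (D : nat).
Hypotheses (D0 : (0 < D)%N) (sq : size q = D.+1).
Hypothesis root_q : \sum_(i < D.+1) (q`_i)%:~R * theta ^+ i = 0.
Hypothesis gen : forall z, exists P, z = eval_at theta P.
Hypothesis free_theta : forall P : {poly rat}, (size P <= D)%N -> eval_at theta P = 0 -> P = 0.

Local Notation normc := ComplexField.Normc.normc.

Lemma embedding_inj (f g : {rmorphism K -> R[i]}) :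
  f theta = g theta -> (f : K -> R[i]) = g.
Proof.
move=> fg; apply: funext => z; have [P ->] := gen z.
have e (h : {rmorphism K -> R[i]}) :
    h (eval_at theta P) = (map_poly (ratr : rat -> R[i]) P).[h theta].
  rewrite /eval_at -horner_map -map_poly_comp; congr _.[_].
  by apply: eq_map_poly => x; rewrite -(fmorph_eq_rat (h \o in_alg K)).
by rewrite !e fg.
Qed.

Lemma size_embeddings (s : seq (K -> R[i])) :
  uniq s -> (forall f, f \in s -> @embeddings R K f) -> (size s <= D)%N.
Proof.
move=> us hs; rewrite -(size_map (fun f : K -> R[i] => f theta)).
pose Q : {poly R[i]} := map_poly intr q.
have q0 : q != 0 by rewrite -size_poly_gt0 sq.
have sQ : size Q = D.+1 by rewrite size_map_poly_id0 // intr_eq0 lead_coef_eq0.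
rewrite -ltnS -sQ; apply: max_poly_roots.
- by rewrite -size_poly_gt0 sQ.
- apply/allP => _ /mapP[f /hs[g _ <-] ->]; apply/rootP.
  rewrite horner_coef sQ -[RHS](rmorph0 g) -root_q rmorph_sum.
  by apply: eq_bigr => i _; rewrite coef_map rmorphM rmorphXn rmorph_int.
- rewrite map_inj_in_uniq // => _ _ /hs[f _ <-] /hs[g _ <-].
  exact: embedding_inj.
Qed.

Lemma prod_le_exp (I : eqType) (s : seq I) (F : I -> R) X :
  (forall i, i \in s -> 0 <= F i <= X) -> \prod_(i <- s) F i <= X ^+ size s.
Proof.
elim: s => [|i s IH] h; first by rewrite big_nil expr0.
have /andP[F0 FX] := h i (mem_head _ _).
have hs j : j \in s -> 0 <= F j <= X by move=> js; apply: h; rewrite inE js orbT.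
rewrite big_cons exprS ler_pM ?IH //.
by rewrite big_seq; apply: prodr_ge0 => j /hs/andP[].
Qed.

Lemma height_le N (c : 'I_N -> K) (X : R) : 1 <= X ->
  (forall v : K -> R, finite_places v -> forall j, v (c j) <= 1) ->
  (exists j, c j = 1) ->
  (forall (f : {rmorphism K -> R[i]}) j, normc (f (c j)) <= X) ->
  height R c <= X ^+ D.
Proof.
move=> X1 cv [j0 cj0] cf; have X0 : 0 <= X by apply: le_trans X1.
rewrite /height fsbig1 ?mul1r => [|v hv]; last first.
  apply: le_anti; rewrite (bigmax_le _ ler01) => [|j _]; last exact: cv.
  by rewrite -(place1 hv) -cj0 le_bigmax.
set s := finite_support _ _ _.
have sE f : f \in s -> embeddings f.
  by rewrite /s; case: finite_supportP => // Y YP _ _; apply: YP.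
have us : uniq s by apply: finite_support_uniq.
apply: (le_trans (prod_le_exp (X := X) _)) => [f /sE[g _ <-]|].
  apply/andP; split; last by apply: bigmax_le.
  by elim/big_ind: _ => // [x y x0 y0|j _]; [rewrite le_max x0 | apply: normc_ge0].
by rewrite ler_weXn2l // size_embeddings.
Qed.

(** ** The integral points of the linear space x_{2i} + x_{2i+1} = 0 *)

Section LinearSpace.
Variables (n M : nat).
Hypothesis M0 : (0 < M)%N.
Local Notation tau := (int_theta theta q).

Definition lattice_pt (m : {ffun 'I_D -> 'I_M}) : K := \sum_(i < D) (m i)%:R * tau ^+ i.

Definition point_value (m : {ffun 'I_n -> {ffun 'I_D -> 'I_M}}) (i : nat) : K :=
  if i is i'.+1 then (if insub i' is Some j then lattice_pt (m j) else 0) else 1.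

Definition point m (j : 'I_n.*2.+2) : K :=
  if odd j then - point_value m j./2 else point_value m j./2.

Lemma lattice_pt_inj : injective lattice_pt.
Proof.
move=> m m' e; pose c : int := lead_coef q.
have c0 : (c%:~R : rat) != 0 by rewrite intr_eq0 lead_coef_eq0 -size_poly_gt0 sq.
pose P : {poly rat} := \poly_(i < D) ((if insub i is Some j then (m j)%:R - (m' j)%:R else 0) * c%:~R ^+ i).
have P0 : P = 0.
  apply: free_theta; first exact: size_poly.
  have e0 : lattice_pt m - lattice_pt m' = 0 by rewrite e subrr.
  rewrite -[RHS]e0 /lattice_pt -sumrB /eval_at /P poly_def rmorph_sum horner_sum.
  apply: eq_bigr => i _ /=; rewrite map_polyZ map_polyXn hornerZ hornerXn.
  rewrite (valK i).
  rewrite rmorphM rmorphXn rmorphB !rmorph_nat rmorph_int.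
  by rewrite /int_theta exprMn -mulrBl mulrA.
apply/ffunP => i; apply: val_inj => /=.
have := congr1 (fun p : {poly rat} => p`_i) P0; rewrite coef0 coef_poly ltn_ord.
rewrite (valK i).
by move/eqP; rewrite mulf_eq0 expf_eq0 (negPf c0) andbF orbF subr_eq0 eqr_nat => /eqP.
Qed.

Definition point_bound : R := D%:R * cauchy_bound R q D ^+ D.

Lemma point_bound_ge1 : 1 <= point_bound.
Proof.
rewrite -[1]mulr1 ler_pM ?ler01 //; first by rewrite ler1n.
by rewrite exprn_ege1 // cauchy_bound_ge1.
Qed.

Lemma point_value_place m (v : K -> R) : finite_places v -> forall i, v (point_value m i) <= 1.
Proof.
move=> hv [|i] /=; first by rewrite (place1 hv).
case: insub => [j|]; last by rewrite (place0 hv).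
apply: (place_sum hv) => // l; rewrite (placeM hv) (placeX hv).
rewrite mulr_ile1 ?exprn_ge0 ?(place_ge0 hv) ?(place_nat hv) // exprn_ile1 ?(place_ge0 hv) //.
exact: (place_int_theta D0 sq root_q).
Qed.

Lemma point_value_normc m (f : {rmorphism K -> R[i]}) i :
  normc (f (point_value m i)) <= point_bound * M%:R.
Proof.
have b1 : 1 <= point_bound * M%:R.
  by rewrite -[X in X <= _]mulr1 ler_pM ?ler01 ?point_bound_ge1 // ler1n.
case: i => [|i] /=; first by rewrite rmorph1 ComplexField.Normc.normc1.
case: insub => [j|]; last first.
  by rewrite rmorph0 ComplexField.Normc.normc0 (le_trans _ b1).
have Y1 := cauchy_bound_ge1 R sq; have Y0 : 0 <= cauchy_bound R q D by apply: le_trans Y1.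
rewrite rmorph_sum (le_trans (normc_sum _ _)) // /point_bound mulrAC.
have term (l : 'I_D) : normc (f ((m j l)%:R * tau ^+ l)) <= M%:R * cauchy_bound R q D ^+ D.
  rewrite rmorphM rmorphXn rmorph_nat ComplexField.Normc.normcM normcX.
  rewrite (normc_int R (m j l)) ler_pM ?ler0z ?exprn_ge0 ?normc_ge0 //.
    by rewrite -[_%:~R]/((m j l)%:R) ler_nat ltnW.
  rewrite (le_trans (lerXn2r _ _ _ (normc_int_theta D0 sq root_q f))) ?nnegrE ?normc_ge0 //.
  by rewrite ler_weXn2l // ltnW.
apply: (@le_trans _ _ (\sum_(l < D) M%:R * cauchy_bound R q D ^+ D)).
  by apply: ler_sum => l _; apply: term.
by rewrite sumr_const card_ord -[X in X <= _]mulr_natl mulrA.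
Qed.

Lemma height_point m : height R (point m) <= (point_bound * M%:R) ^+ D.
Proof.
apply: height_le.
- by rewrite -[X in X <= _]mulr1 ler_pM ?ler01 ?point_bound_ge1 // ler1n.
- move=> v hv j; rewrite /point; case: ifP => _; rewrite ?(placeN hv);
  exact: point_value_place.
- by exists ord0.
- move=> f j; rewrite /point; case: ifP => _; rewrite ?rmorphN ?normcN;
  exact: point_value_normc.
Qed.

Lemma card_points : #|{: {ffun 'I_n -> {ffun 'I_D -> 'I_M}}}| = ((M ^ D) ^ n)%N.
Proof. by rewrite !card_ffun !card_ord. Qed.

End LinearSpace.
End Heights.

Lemma counting_ge (R : realType) (T : choiceType) (A : set T) (I : finType) (g : I -> T) :
  injective g -> (forall i, A (g i)) -> ((#|I|%:R : R)%:E <= counting A)%E.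
Proof.
move=> gi gA; rewrite /counting; case: asboolP => [finA|_]; last exact: leey.
rewrite lee_fin ler_nat cardE -(size_map g).
apply: uniq_leq_size; first by rewrite map_inj_uniq ?enum_uniq.
by move=> _ /mapP[i _ ->]; rewrite in_fset_set //; apply: mem_set.
Qed.

Section ManyPoints.
Variables (R : realType) (K : fieldExtType rat) (L : fieldExtType K) (xi : L) (n d : nat).
Hypotheses (n0 : (0 < n)%N) (xi2 : xi ^+ 2 = - 3%:R).

Lemma char0_neq0 m : m.+1%:R != 0 :> L.
Proof.
rewrite -(rmorph_nat (in_alg L)) fmorph_eq0 -(rmorph_nat (in_alg K)) fmorph_eq0.
by rewrite pnatr_eq0.
Qed.

Let L2 : 2%:R != 0 :> L := char0_neq0 1.
Let L3 : 3%:R != 0 :> L := char0_neq0 2.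

Section Point.
Variable (a : nat -> K).
Hypothesis a0 : a 0%N = 1.
Let c (j : 'I_n.*2.+2) : K := if odd j then - a j./2 else a j./2.

Lemma linear_even i : (i <= n)%N -> c (inord i.*2) = a i.
Proof.
move=> h; have /andP[l0 l1] := val_index_le h.
by rewrite /c inordK ?ltnS // odd_double doubleK.
Qed.

Lemma linear_odd i : (i <= n)%N -> c (inord i.*2.+1) = - a i.
Proof.
move=> h; have /andP[l0 l1] := val_index_le h.
by rewrite /c inordK ?ltnS //= odd_double uphalf_double.
Qed.

Lemma linear_on : meval c (hypX K n d) = 0.
Proof.
rewrite meval_hypX /Xval big1 // => -[i /= lt] _.
by rewrite linear_even // linear_odd // subrr mul0r.
Qed.

Lemma linear_semistable : semistable (toric n) (lift_pt xi c).
Proof.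
have [nzm nzp] := three_xi_neq0 L2 L3 xi2.
have c0 := linear_even (leq0n n); have c1 := linear_odd (leq0n n).
apply/toric_semistableP; split.
- exists 0%N => //; rewrite /lift_pt inordK ?inord_even_lt // lift_even // c0 c1 a0.
  have -> : 1%:A - (1 + xi) / 2%:R * (-1)%:A = 2%:R^-1 * (3%:R + xi) :> L.
    by rewrite scaleN1r scale1r; field.
  by rewrite mulf_neq0 ?invr_eq0.
- exists 0%N => //; rewrite /lift_pt inordK ?inord_odd_lt // lift_odd // c0 c1 a0.
  have -> : 1%:A - (1 - xi) / 2%:R * (-1)%:A = 2%:R^-1 * (3%:R - xi) :> L.
    by rewrite scaleN1r scale1r; field.
  by rewrite mulf_neq0 ?invr_eq0.
- by left; rewrite /lift_pt inordK // lift_wp oner_neq0.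
Qed.

Lemma linear_Xtilde_le B : height R c <= B ->
  Xtilde_points_le xi n d B (Defs.orbit (toric n) (lift_pt xi c)).
Proof.
move=> hB; split; first exact: (Xtilde_lift_pt xi2 L2 L3 linear_semistable linear_on).
exists c => //; exists (lift_pt xi c); first exact: (@same_orbit_refl (toric n)).
rewrite (_ : (fun j => meval _ _) = fun j => (c j)%:A); first exact: same_orbit_refl.
by apply: funext => j; rewrite (blowdown_lift_pt xi2 L2 L3).
Qed.

End Point.

Lemma many_points : exists (C : R) (D : nat), [/\ 1 <= C, (0 < D)%N &
  forall (B : R) (M : nat), (0 < M)%N -> (C * M%:R) ^+ D <= B ->
  ((((M ^ D) ^ n)%N%:R : R)%:E <= counting (Xtilde_points_le xi n d B))%E].
Proof.
have [theta [q [D [D0 sq root_q gen free]]]] := primitive_element K.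
exists (point_bound R q D), D; split=> //; first exact: point_bound_ge1.
move=> B M M0 hB.
rewrite -(card_points D n M).
apply: (@counting_ge R _ _ _ (fun m => Defs.orbit (toric n) (lift_pt xi (point theta q m)))) => [m m'|m].
  move=> /orbitP/(lift_pt_orbit xi2 L2 L3)/proj_orbitP[t t0 e].
  have t1 : t = 1 by have := e ord0; rewrite /point /= mulr1.
  apply/ffunP => i; apply: (lattice_pt_inj sq free).
  have ile : (i.+1 <= n)%N by [].
  have := e (inord i.+1.*2); rewrite t1 mul1r.
  have E m1 : point theta q m1 (inord i.+1.*2) = lattice_pt theta q (m1 i).
    by apply: etrans (linear_even (point_value theta q m1) ile) _; rewrite /= (valK i).
  by rewrite !E.
apply: linear_Xtilde_le => //; apply: le_trans hB.
exact: height_point.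
Qed.

End ManyPoints.

Lemma part_iii (R : realType) (n d : nat) (K : fieldExtType rat) (L : fieldExtType K) (xi : L) :
  (0 < n)%N -> (0 < d)%N -> xi ^+ 2 = - 3%:R ->
  exists c B0 : R, 0 < c /\ forall (e B : R), e <= n%:R -> B0 <= B ->
    ((c * B `^ e)%:E <= counting (Xtilde_points_le xi n d B))%E.
Proof.
move=> n0 d0 xi2; have [C [D [C1 D0 count]]] := many_points R n d xi2.
have C0 : 0 < C by apply: lt_le_trans C1.
have Cge : 0 <= C by apply: ltW.
exists ((2%:R * C) ^+ (D * n))^-1, (C ^+ D); split.
  by rewrite invr_gt0 exprn_gt0 // mulr_gt0.
move=> e B en hB.
have B1 : 1 <= B by apply: le_trans hB; rewrite exprn_ege1.
pose P m := (C * m.+1%:R) ^+ D <= B.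
have exP : exists m, P m by exists 0%N; rewrite /P mulr1.
have ubP m : P m -> (m <= Num.bound B)%N.
  rewrite /P => hm; rewrite -(ler_nat R) ltW //.
  have hb : B < (Num.bound B)%:R by apply: archi_boundP; apply: le_trans B1.
  apply: le_lt_trans hb; apply: le_trans hm.
  have m1 : 1 <= C * m.+1%:R by rewrite -[X in X <= _]mulr1 ler_pM ?ler01 // ler1n.
  apply: (@le_trans _ _ (C * m.+1%:R)); last by rewrite ler_eXnr.
  by rewrite -[X in X <= _]mul1r ler_pM ?ler01 // ler_nat.
have [m Pm maxm] := ex_maxnP exP ubP.
have ltB : B <= ((2%:R * C) * m.+1%:R) ^+ D.
  have : ~~ P m.+1 by apply: contraTN (leqnn m.+1) => /maxm; rewrite ltnNge.
  rewrite -ltNge => /ltW/le_trans; apply; rewrite lerXn2r ?nnegrE ?mulr_ge0 //.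
  by rewrite [2%:R * C]mulrC -mulrA ler_pM2l // -natrM ler_nat; lia.
apply: le_trans (count B m.+1 isT Pm); rewrite lee_fin.
rewrite mulrC ler_pdivrMr ?exprn_gt0 ?mulr_gt0 //.
apply: (@le_trans _ _ (B `^ n%:R)); first exact: ler_powR.
rewrite powR_mulrn; last exact: le_trans B1.
rewrite natrX natrX -!exprM -exprMn.
by rewrite mulrC exprM lerXn2r ?nnegrE ?exprn_ge0 ?mulr_ge0 ?(ltW C0) ?(le_trans ler01 B1).
Qed.

(** * Counting points over finite fields *)

Section Fibres.
Local Close Scope classical_set_scope.

(** A map whose nonempty fibres in A all have r elements has #|A| / r values. *)
Lemma card_image_fibres (T : finType) (Y : Type) (g : T -> Y) (A : {set T}) r N :
  (0 < r)%N -> (forall x, x \in A -> #|[set y in A | `[< g x = g y >]]| = r) ->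
  #|A| = (r * N)%N -> (g @` [set` A] #= `I_N)%classic%card.
Proof.
move=> r0 fib cardA.
pose R x y := `[< g x = g y >].
have eqR : {in A & &, equivalence_rel R}.
  move=> x y z _ _ _; split; first exact/asboolP.
  by move=> /asboolP e; rewrite /R e.
pose P := finset.equivalence_partition R A.
have partP : finset.partition P A by apply: finset.equivalence_partitionP.
have blk x y : x \in A -> y \in A -> (y \in finset.pblock P x) = R x y.
  by move=> xA yA; rewrite finset.pblock_equivalence_partition.
have cP : #|P| = N.
  have /finset.card_uniform_partition : {in P, forall B : {set T}, #|B| = r}.
    move=> B /imsetP[x xA ->]; rewrite -(fib x xA); apply: eq_card => y.
    by rewrite !inE.
  move=> /(_ _ partP); rewrite cardA mulnC => /eqP; rewrite eqn_pmul2r // => /eqP ->.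
  by [].
pose X := finset.transversal P A.
have tX : finset.is_transversal X P A by apply: finset.transversalP.
have cX : #|X| = N by rewrite (finset.card_transversal tX).
have subX : {subset X <= A} by apply/fintype.subsetP; exact: finset.transversal_sub tX.
have [e0|[x0 x0A]] := set_0Vmem A.
  have N0 : N = 0%N by apply/eqP; move/eqP: cardA; rewrite e0 cards0 eq_sym muln_eq0 eqn0Ngt r0.
  rewrite N0 II0 e0; have -> : (g @` [set` (finset.set0 : {set T})] = set0)%classic.
    by apply/seteqP; split=> // y [x]; rewrite /= inE.
  exact: card_eq00.
pose h i := g (nth x0 (enum X) i).
have mem i : (i < N)%N -> nth x0 (enum X) i \in X.
  by move=> lt; rewrite -mem_enum mem_nth // -cardE cX.
have -> : (g @` [set` A] = h @` `I_N)%classic.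
  apply/seteqP; split=> y /=.
    move=> [x /= xA <-]; pose B := finset.pblock P x.
    have covx : x \in finset.cover P by rewrite (finset.cover_partition partP).
    have BP : B \in P by apply: finset.pblock_mem.
    pose t := finset.transversal_repr x X B.
    have tB : t \in B by exact: (finset.repr_mem_pblock tX x BP).
    have tXm : t \in X by exact: (finset.repr_mem_transversal tX x BP).
    exists (index t (enum X)); first by rewrite /= -cX cardE index_mem mem_enum.
    rewrite /h nth_index ?mem_enum //.
    by move: tB; rewrite blk //; [move=> /asboolP | apply: subX].
  by move=> [i /= lt <-]; exists (nth x0 (enum X) i) => //=; apply: subX; apply: mem.
apply: inj_card_eq => i j /set_mem /= li /set_mem /= lj hij.
have e : nth x0 (enum X) i = nth x0 (enum X) j.
  apply: (finset.pblock_inj tX); rewrite ?mem //.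
  apply/esym/finset.same_pblock; first by case/and3P: partP.
  by rewrite blk; [apply/asboolP | apply: subX; apply: mem | apply: subX; apply: mem].
by apply/eqP; rewrite -(nth_uniq x0 _ _ (enum_uniq X)) ?e // -cardE cX.
Qed.

End Fibres.

Section RootsOfUnity.
Local Close Scope classical_set_scope.
Variable k : finFieldType.

Lemma finField_primitive_root : exists z : k, (#|k| - 1).-primitive_root z.
Proof.
have q1 : (0 < #|k| - 1)%N by rewrite subn_gt0 finNzRing_gt1.
have sz : size (enum [set x : k | x != 0]) = (#|k| - 1)%N.
  by rewrite -cardE (eq_card (B := predC1 0)) ?cardC1 ?subn1 // => x; rewrite !inE.
have /hasP[z _ pz] : has (#|k| - 1).-primitive_root (enum [set x : k | x != 0]).
  apply: cyclic.has_prim_root; rewrite ?enum_uniq ?sz //.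
  apply/allP => x; rewrite mem_enum inE => x0; rewrite unity_rootE.
  by apply/eqP/(mulfI x0); rewrite -exprS mulr1 subn1 prednK ?expf_card // ltnW // finNzRing_gt1.
by exists z.
Qed.

Lemma expf_card1 (x : k) : x != 0 -> x ^+ (#|k| - 1) = 1.
Proof.
move=> x0; apply: (mulfI x0); rewrite -exprS mulr1 subn1 prednK ?expf_card //.
by rewrite ltnW // finNzRing_gt1.
Qed.

Lemma card_unity_roots m : (0 < m)%N ->
  #|[set t : k | t ^+ m == 1]| = gcdn (#|k| - 1) m.
Proof.
move=> m0; set q := (#|k| - 1)%N; set g := gcdn q m.
have [z pz] := finField_primitive_root.
have g0 : (0 < g)%N by rewrite gcdn_gt0 m0 orbT.
have pw : g.-primitive_root (z ^+ (q %/ g)) by apply: (dvdn_prim_root pz); apply: dvdn_gcdl.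
set w := z ^+ _ in pw.
have -> : [set t : k | t ^+ m == 1] = [set w ^+ (i : 'I_g) | i : 'I_g].
  apply/setP => t; rewrite inE; apply/eqP/imsetP => [tm|[i _ ->]]; last first.
    by rewrite exprAC -(divnK (dvdn_gcdr q m)) mulnC exprM (prim_expr_order pw) !expr1n.
  have t0 : t != 0.
    by apply: contra_eqN tm => /eqP ->; rewrite expr0n gtn_eqF // eq_sym oner_eq0.
  have tg : t ^+ g = 1.
    have [a _ /dvdnP[b eb]] := Bezoutl m (leq_ltn_trans (leq0n _) (prim_order_gt0 pz)).
    have : t ^+ (g + a * m) = 1 by rewrite eb mulnC exprM expf_card1 // expr1n.
    by rewrite exprD mulnC exprM tm expr1n mulr1.
  by have [i ->] := prim_rootP pw tg; exists i.
rewrite card_imset ?card_ord // => i j /eqP.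
by rewrite (eq_prim_root_expr pw) !modn_small // => /eqP/val_inj.
Qed.

End RootsOfUnity.

Section BoolSums.
Local Close Scope classical_set_scope.
Local Open Scope nat_scope.

Lemma card_sum_bool (T : finType) (P : pred T) : #|[set x | P x]| = \sum_x (P x : nat).
Proof. by rewrite -sum1dep_card big_mkcond; apply: eq_bigr => x _; case: (P x). Qed.

Lemma sum_bool_eq (T : finType) (c : T) : \sum_x (x == c : nat) = 1.
Proof. by rewrite (bigD1 c) //= eqxx big1 ?addn0 // => x /negPf ->. Qed.

Lemma sum_bool_ex1 (T : finType) (P : pred T) c :
  (forall x, P x = (x == c)) -> \sum_x (P x : nat) = 1.
Proof. by move=> e; under eq_bigr do rewrite e; apply: sum_bool_eq. Qed.

Lemma sum_pair (S T : finType) (F : S -> T -> nat) :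
  \sum_(x : S * T) F x.1 x.2 = \sum_x \sum_y F x y.
Proof. by rewrite pair_bigA. Qed.

End BoolSums.

Section ConicFibres.
Local Close Scope classical_set_scope.
Variables (k : finFieldType) (d : nat).
Hypothesis d0 : (0 < d)%N.
Local Notation q := #|k|.

Definition form (x : k * k) : k := (x.1 + x.2) * normval x.1 x.2 ^+ d.

Definition form_pairs : nat := (\sum_(x : k * k) \sum_(y : k * k) (form x == form y))%N.

Definition unity_count : nat := #|[set t : k | t ^+ (2 * d + 1) == 1]|.

Lemma q_gt1 : (1 < q)%N. Proof. exact: finNzRing_gt1. Qed.

Lemma card_linear (a b : k) : (\sum_(x : k * k) ((a * x.1 + b * x.2)%R == 0%R) =
  if (a == 0%R) && (b == 0%R) then q ^ 2 else q)%N.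
Proof.
rewrite (sum_pair (fun x y : k => nat_of_bool (a * x + b * y == 0))).
have [b0|b0] := eqVneq b 0; last first.
  rewrite andbF (eq_bigr (fun=> 1%N)) ?sum1_card // => x _.
  apply: (sum_bool_ex1 (c := - (a * x) / b)) => y.
  by rewrite addrC addr_eq0 -[RHS](inj_eq (mulfI b0)) [b * (_ / b)]mulrCA mulfV // mulr1.
have -> : (\sum_(x : k) \sum_(y : k) nat_of_bool ((a * x + b * y)%R == 0%R) =
    q * \sum_(x : k) nat_of_bool ((a * x)%R == 0%R))%N.
  rewrite big_distrr /=; apply: eq_bigr => x _.
  by rewrite b0 -sum_nat_const; apply: eq_bigr => y _; rewrite mul0r addr0.
rewrite andbT; have [->|a0] := eqVneq a 0.
  rewrite (eq_bigr (fun=> 1%N)) ?sum1_card ?mulnn // => x _.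
  by rewrite mul0r eqxx.
rewrite (sum_bool_ex1 (c := 0)) ?muln1 // => x.
by rewrite mulf_eq0 (negPf a0).
Qed.

Lemma card_linear_nz (a b : k) : (1 + \sum_(x : k * k | x != (0%R, 0%R)) ((a * x.1 + b * x.2)%R == 0%R) =
  if (a == 0%R) && (b == 0%R) then q ^ 2 else q)%N.
Proof. by rewrite -card_linear [RHS](bigD1 (0, 0)) //= !mulr0 addr0 eqxx. Qed.

Lemma formN x : form (- x.1, - x.2) = - form x.
Proof.
have e : normval (- x.1) (- x.2) = normval x.1 x.2 by rewrite /normval; ring.
by rewrite /form /= e -opprD mulNr.
Qed.

(** ** Anisotropic norm form *)

Definition qmul (z x : k * k) : k * k :=
  (z.1 * x.1 - z.2 * x.2, z.1 * x.2 + z.2 * x.1 - z.2 * x.2).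

Lemma form_qmul z x : form (qmul z x) =
  ((z.1 + z.2) * x.1 + (z.1 - 2%:R * z.2) * x.2) * (normval z.1 z.2 ^+ d * normval x.1 x.2 ^+ d).
Proof.
rewrite /form /= -exprMn; congr (_ * _ ^+ d); first by ring.
by rewrite /normval; ring.
Qed.

Section Anisotropic.
Hypothesis k3 : 3%:R != 0 :> k.
Hypothesis aniso : forall a b : k, normval a b = 0 -> (a, b) = (0, 0).

Lemma norm_neq0 (x : k * k) : x != (0, 0) -> normval x.1 x.2 != 0.
Proof. by case: x => a b; apply: contra => /eqP/aniso ->. Qed.

Lemma form_eq0 x : (form x == 0) = (1 * x.1 + 1 * x.2 == 0).
Proof.
rewrite /form mulf_eq0 !mul1r expf_eq0 d0 /=; have [//|nz] := eqVneq (_ + _) 0.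
apply/negbTE/norm_neq0; apply: contra_neq nz => ->; exact: addr0.
Qed.

Lemma card_form_zeros : (\sum_(x : k * k) (form x == 0%R) = q)%N.
Proof.
have := card_linear 1 1; rewrite oner_eq0 /= => <-.
by apply: eq_bigr => x _; rewrite form_eq0.
Qed.

Lemma reindex_qmul (x : k * k) (F : k * k -> nat) : x != (0, 0) ->
  (\sum_(y | y != (0%R, 0%R)) F y = \sum_(z | z != (0%R, 0%R)) F (qmul z x))%N.
Proof.
move=> x0; have nx := norm_neq0 x0.
pose inv (y : k * k) : k * k :=
  ((y.1 * (x.1 - x.2) + y.2 * x.2) / normval x.1 x.2, (y.2 * x.1 - y.1 * x.2) / normval x.1 x.2).
have invK : cancel inv (qmul^~ x).
  by move=> [a b]; rewrite /qmul /inv /=; congr (_, _); rewrite /normval in nx *; field.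
have Kinv : cancel (qmul^~ x) inv.
  by move=> [a b]; rewrite /qmul /inv /=; congr (_, _); rewrite /normval in nx *; field.
rewrite (reindex (qmul^~ x)) /=; last by exists inv => y _.
apply: eq_bigl => z; congr (~~ _); apply/eqP/eqP => [e|->]; last first.
  by rewrite /qmul /=; congr (_, _); ring.
by rewrite -(Kinv z) e /inv /=; congr (_, _); ring.
Qed.

Lemma pairs_anisotropic :
  form_pairs = ((q - 1) * (q ^ 2 + unity_count * q + 1) + 1)%N.
Proof.
have form0 : form (0, 0) = 0 by rewrite /form /= addr0 mul0r.
pose W := (\sum_(z : k * k | z != (0%R, 0%R)) \sum_(x : k * k | x != (0%R, 0%R)) (form x == form (qmul z x)))%N.
have E : form_pairs = (q + (q - 1) + W)%N.
  rewrite /form_pairs (bigD1 (0, 0)) //= form0.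
  have -> : (\sum_(y : k * k) (0%R == form y) = q)%N.
    by rewrite -[RHS]card_form_zeros; apply: eq_bigr => y _; rewrite eq_sym.
  rewrite -addnA; congr (_ + _)%N.
  have -> : (q - 1 = \sum_(x : k * k | x != (0%R, 0%R)) (form x == 0%R))%N.
    by rewrite -[in LHS]card_form_zeros (bigD1 (0, 0)) //= form0 eqxx addKn.
  have -> : W = (\sum_(x : k * k | x != (0%R, 0%R)) \sum_(z : k * k | z != (0%R, 0%R)) (form x == form (qmul z x)))%N by rewrite /W exchange_big.
  rewrite -big_split /=; apply: eq_bigr => x x0.
  by rewrite (bigD1 (0, 0)) //= form0; congr (_ + _)%N; apply: reindex_qmul.
have inner z : z != (0, 0) -> (\sum_(x : k * k | x != (0%R, 0%R)) (form x == form (qmul z x)) =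
    (q - 1) + ((z.2 == 0%R) && ((z.1 ^+ (2 * d + 1))%R == 1%R)) * (q ^ 2 - q))%N.
  move=> z0; set e := normval z.1 z.2 ^+ d.
  have -> : (\sum_(x : k * k | x != (0%R, 0%R)) (form x == form (qmul z x)) =
    \sum_(x : k * k | x != (0%R, 0%R))
      (((1 - e * (z.1 + z.2)) * x.1 + (1 - e * (z.1 - 2%:R * z.2)) * x.2)%R == 0%R))%N.
    apply: eq_bigr => x x0; congr (nat_of_bool _).
    have nd : normval x.1 x.2 ^+ d != 0 by rewrite expf_neq0 // norm_neq0.
    rewrite -subr_eq0 form_qmul /form -/e.
    rewrite -[RHS](inj_eq (mulIf nd)) mul0r; congr (_ == _); ring.
  have := card_linear_nz (1 - e * (z.1 + z.2)) (1 - e * (z.1 - 2%:R * z.2)).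
  have -> : (1 - e * (z.1 + z.2) == 0) && (1 - e * (z.1 - 2%:R * z.2) == 0) =
      (z.2 == 0) && (z.1 ^+ (2 * d + 1) == 1).
    rewrite !subr_eq0; apply/andP/andP => -[/eqP h1 /eqP h2].
      have z2 : z.2 = 0.
        have : (e * 3%:R) * z.2 = 0 by transitivity (e * (z.1 + z.2) - e * (z.1 - 2%:R * z.2)); [ring | rewrite -h1 -h2 subrr].
        by move/eqP; rewrite !mulf_eq0 (negPf k3) expf_eq0 d0 (negPf (norm_neq0 z0)) /= => /eqP.
      split; first exact/eqP.
      by rewrite h1 /e z2 /normval; apply/eqP; rewrite mulr0 subr0 expr0n !addr0 -exprM addn1 exprSr.
    have ee : e * z.1 = 1.
      by rewrite -h2 /e h1 /normval mulr0 subr0 expr0n addr0 -exprM addn1 exprSr.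
    by rewrite h1 mulr0 subr0 addr0 ee.
  have q1 : (1 < q)%N by exact: q_gt1.
  move=> h; apply/eqP; rewrite -(eqn_add2l 1) h; apply/eqP.
  have : (q <= q ^ 2)%N by rewrite -mulnn leq_pmull // ltnW.
  have [r er] : exists r, q = r by exists q.
  by clear h; move: q1; rewrite !er => q1; case: (_ && _) => /=; lia.
have degen : (\sum_(z : k * k | z != (0%R, 0%R)) ((z.2 == 0%R) && ((z.1 ^+ (2 * d + 1))%R == 1%R)) = unity_count)%N.
  have m0 : (2 * d + 1)%N != 0%N by rewrite addn1.
  transitivity (\sum_(z : k * k) ((z.2 == 0%R) && ((z.1 ^+ (2 * d + 1))%R == 1%R)))%N.
    rewrite [RHS](bigD1 (0, 0)) //= expr0n (negPf m0) [0 == 1]eq_sym oner_eq0 andbF add0n //.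
  rewrite (sum_pair (fun a b : k => nat_of_bool ((b == 0) && (a ^+ (2 * d + 1) == 1)))).
  rewrite /unity_count card_sum_bool; apply: eq_bigr => a _.
  case: (a ^+ (2 * d + 1) == 1); last by rewrite big1 // => b _; rewrite andbF.
  by rewrite (sum_bool_ex1 (c := 0)) // => b; rewrite andbT.
have nz : (\sum_(z : k * k | z != (0%R, 0%R)) 1 = q ^ 2 - 1)%N.
  by rewrite sum1_card (eq_card (B := predC1 (0, 0))) // cardC1 card_prod mulnn subn1.
have EW : W = ((q ^ 2 - 1) * (q - 1) + unity_count * (q ^ 2 - q))%N.
  rewrite /W (eq_bigr _ inner) big_split /= -big_distrl /= degen; congr (_ + _)%N.
  by rewrite -nz big_distrl /=; apply: eq_bigr => z _; rewrite mul1n.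
rewrite E EW; have q1 : (1 < q)%N by exact: q_gt1.
move: (unity_count) => s.
have [r er] : exists r, q = r.+1 by exists q.-1; rewrite prednK // ltnW.
rewrite !er.
have -> : (r.+1 ^ 2 - 1 = r * (r + 2))%N by nia.
have -> : (r.+1 ^ 2 - r.+1 = r.+1 * r)%N by nia.
by rewrite subn1 /= -mulnn; nia.
Qed.

End Anisotropic.
End ConicFibres.

Section UnitSums.
Local Close Scope classical_set_scope.
Variables (k : finFieldType).
Local Notation q := #|k|.

Lemma sum_nz (F : k -> nat) : (\sum_x F x = F 0%R + \sum_(x | x != 0%R) F x)%N.
Proof. by rewrite (bigD1 0). Qed.

Lemma sum_nz_const c : (\sum_(x : k | x != 0%R) c = c * (q - 1))%N.
Proof.
by rewrite sum_nat_const mulnC (eq_card (B := predC1 0)) // cardC1 subn1.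
Qed.

Lemma reindex_mulr (c : k) (F : k -> nat) : c != 0 ->
  (\sum_(x | x != 0%R) F x = \sum_(x | x != 0%R) F (x * c)%R)%N.
Proof.
move=> c0; rewrite (reindex (fun x => x * c)) /=.
  by apply: eq_bigl => x; rewrite mulf_eq0 (negPf c0) orbF.
by exists (fun x => x / c) => x _; rewrite ?mulfK ?divfK.
Qed.

Lemma sum_nz_ex1 (P : pred k) c : c != 0 ->
  (forall x, x != 0 -> P x = (x == c)) -> (\sum_(x | x != 0%R) (P x : nat) = 1)%N.
Proof.
move=> c0 e; rewrite (bigD1 c) //= e // eqxx big1 // => x /andP[x0 xc].
by rewrite e // (negPf xc).
Qed.

Lemma card_linear_units (a b : k) : let r := (q - 1)%N in
  (\sum_(x : k | x != 0%R) \sum_(y : k | y != 0%R) ((a * x + b * y)%R == 0%R)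
     + r * (a == 0%R) + r * (b == 0%R) = r + (r ^ 2 + r) * ((a == 0%R) && (b == 0%R)))%N.
Proof.
move=> r; have [->|a0] := eqVneq a 0; have [->|b0] := eqVneq b 0 => /=.
- rewrite (eq_bigr (fun=> r)) => [|x _]; last first.
    rewrite -[RHS]mul1n -(sum_nz_const 1).
    by apply: eq_bigr => y _; rewrite !mul0r addr0 eqxx.
  by rewrite sum_nz_const -/r; nia.
- rewrite big1 => [|x _]; first by lia.
  by rewrite big1 // => y y0; rewrite mul0r add0r mulf_eq0 (negPf b0) (negPf y0).
- rewrite big1 => [|x x0]; first by lia.
  by rewrite big1 // => y y0; rewrite mul0r addr0 mulf_eq0 (negPf a0) (negPf x0).
rewrite (eq_bigr (fun=> 1%N)) => [|x x0]; first by rewrite sum_nz_const -/r; lia.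
apply: (sum_nz_ex1 (c := - (a * x) / b)).
  by rewrite mulf_neq0 ?invr_eq0 // oppr_eq0 mulf_neq0.
by move=> y _; rewrite addrC addr_eq0 -[RHS](inj_eq (mulfI b0)) [b * (_ / b)]mulrCA mulfV // mulr1.
Qed.

End UnitSums.

Section SplitFibres.
Local Close Scope classical_set_scope.
Variables (k : finFieldType) (d : nat).
Hypothesis d0 : (0 < d)%N.
Local Notation q := #|k|.
Local Notation s := (unity_count k d).

Definition split_form (y : k * k) : k := (y.1 + y.2) * (y.1 * y.2) ^+ d.

Lemma unit_pairs_split :
  (\sum_(a : k | a != 0%R) \sum_(b : k | b != 0%R)
     \sum_(a' : k | a' != 0%R) \sum_(b' : k | b' != 0%R) (split_form (a, b) == split_form (a', b'))
   + 2 * (q - 1) ^ 2 = (q - 1) ^ 3 + ((q - 1) ^ 2 + (q - 1)) * s)%N.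
Proof.
set r := (q - 1)%N.
pose A (x w : k) := 1 - x * w ^+ d.
pose B (x w : k) := 1 - (w / x) * w ^+ d.
pose S (x w : k) := (\sum_(a : k | a != 0%R) \sum_(b : k | b != 0%R) ((A x w * a + B x w * b)%R == 0%R))%N.
have -> : (\sum_(a : k | a != 0%R) \sum_(b : k | b != 0%R)
     \sum_(a' : k | a' != 0%R) \sum_(b' : k | b' != 0%R) (split_form (a, b) == split_form (a', b')) =
   \sum_(w : k | w != 0%R) \sum_(x : k | x != 0%R) S x w)%N.
  transitivity (\sum_(a : k | a != 0%R) \sum_(b : k | b != 0%R) \sum_(w : k | w != 0%R) \sum_(x : k | x != 0%R)
      ((A x w * a + B x w * b)%R == 0%R))%N.
    apply: eq_bigr => a a0; apply: eq_bigr => b b0.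
    rewrite [RHS]exchange_big /= (reindex_mulr _ a0); apply: eq_bigr => x x0.
    have xb : b / x != 0 by rewrite mulf_neq0 ?invr_eq0.
    rewrite (reindex_mulr _ xb); apply: eq_bigr => w w0.
    congr (nat_of_bool _); rewrite /split_form /=.
    have -> : x * a * (w * (b / x)) = w * (a * b) by field.
    have e : (a * b) ^+ d != 0 by rewrite expf_neq0 ?mulf_neq0.
    rewrite -subr_eq0 -[RHS](inj_eq (mulIf e)) mul0r; congr (_ == _).
    by rewrite [(w * (a * b)) ^+ d]exprMn /A /B; field.
  under eq_bigr => a _ do rewrite exchange_big /=.
  rewrite exchange_big /=; apply: eq_bigr => w _.
  under eq_bigr => a _ do rewrite exchange_big /=.
  by rewrite exchange_big.
have inner w : w != 0 -> (\sum_(x : k | x != 0%R) S x w + 2 * r =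
    r ^ 2 + (r ^ 2 + r) * ((w ^+ (2 * d + 1))%R == 1%R))%N.
  move=> w0; have wd : w ^+ d != 0 by rewrite expf_neq0.
  have wd1 : w ^+ d.+1 != 0 by rewrite expf_neq0.
  have A0 x : (A x w == 0) = (x == (w ^+ d)^-1).
    by rewrite /A subr_eq0 -[RHS](inj_eq (mulIf wd)) mulVf // eq_sym.
  have B0 x : x != 0 -> (B x w == 0) = (x == w ^+ d.+1).
    move=> x0; rewrite /B subr_eq0 -[RHS](inj_eq (mulIf (invr_neq0 x0))) mulfV //.
    by rewrite mulrAC -exprS.
  have : (\sum_(x : k | x != 0%R) (S x w + r * (A x w == 0%R) + r * (B x w == 0%R)) =
     \sum_(x : k | x != 0%R) (r + (r ^ 2 + r) * ((A x w == 0%R) && (B x w == 0%R))))%N.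
    by apply: eq_bigr => x x0; apply: card_linear_units.
  rewrite !big_split /= -!big_distrr /=.
  rewrite (sum_nz_ex1 (c := (w ^+ d)^-1)) ?invr_eq0 //.
  rewrite (sum_nz_ex1 (c := w ^+ d.+1)) //.
  have -> : (\sum_(x : k | x != 0%R) ((A x w == 0%R) && (B x w == 0%R)) =
      ((w ^+ (2 * d + 1))%R == 1%R))%N.
    rewrite (bigD1 (w ^+ d)^-1) ?invr_eq0 //= A0 eqxx B0 ?invr_eq0 //=.
    rewrite big1 => [|x /andP[x0 xn]]; last by rewrite A0 (negPf xn).
    rewrite addn0 -(inj_eq (mulIf wd)) mulVf // eq_sym -exprD.
    by congr (nat_of_bool (_ ^+ _ == _)); lia.
  rewrite sum_nz_const -/r.
  by rewrite -mulnn; lia.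
have : (\sum_(w : k | w != 0%R) (\sum_(x : k | x != 0%R) S x w + 2 * r) =
   \sum_(w : k | w != 0%R) (r ^ 2 + (r ^ 2 + r) * ((w ^+ (2 * d + 1))%R == 1%R)))%N.
  exact: eq_bigr.
rewrite !big_split /= -!big_distrr /=.
have sumc c : (\sum_(x : k | x != 0%R) c = c * r)%N by exact: sum_nz_const.
rewrite !sumc.
have -> : (\sum_(w : k | w != 0%R) ((w ^+ (2 * d + 1))%R == 1%R) = s)%N.
  rewrite /unity_count card_sum_bool [RHS]sum_nz expr0n addn1 /= eq_sym oner_eq0 add0n.
  by [].
by move: (\sum_(w | _) _)%N => S0; rewrite !expnS expn0; nia.
Qed.

Lemma pairs_split_form :
  (\sum_(x : k * k) \sum_(y : k * k) (split_form x == split_form y) =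
   (q - 1) * (q ^ 2 + (s + 4) * q + 1) + 1)%N.
Proof.
have q1 : (1 < q)%N by exact: q_gt1.
pose r := (q - 1)%N.
have f0l b : split_form (0, b) = 0 by rewrite /split_form /= mul0r expr0n gtn_eqF // mulr0.
have f0r a : split_form (a, 0) = 0 by rewrite /split_form /= mulr0 expr0n gtn_eqF // mulr0.
have axes (F : k * k -> nat) : (\sum_(x : k * k) F x = F (0, 0)%R + \sum_(b | b != 0%R) F (0%R, b) +
   \sum_(a | a != 0%R) F (a, 0%R) + \sum_(a | a != 0%R) \sum_(b | b != 0%R) F (a, b))%N.
  have -> : (\sum_(x : k * k) F x = \sum_(a : k) \sum_(b : k) F (a, b))%N.
    by rewrite pair_bigA; apply: eq_bigr => -[].
  rewrite sum_nz sum_nz -[RHS]addnA -big_split /=; congr (_ + _)%N.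
  by apply: eq_bigr => a _; rewrite [LHS]sum_nz.
have sumc c : (\sum_(x : k | x != 0%R) c = c * r)%N by exact: sum_nz_const.
have unit0 : (\sum_(a : k | a != 0%R) \sum_(b : k | b != 0%R) (split_form (a, b) == 0%R) = r)%N.
  rewrite -[RHS]mul1n -sumc; apply: eq_bigr => a a0.
  apply: (sum_nz_ex1 (c := - a)); rewrite ?oppr_eq0 // => b b0.
  rewrite /split_form mulf_eq0 expf_eq0 mulf_eq0 (negPf a0) (negPf b0) andbF orbF.
  by rewrite addrC addr_eq0.
have zeros : (\sum_(y : k * k) (0%R == split_form y) = 3 * r + 1)%N.
  rewrite axes f0l eqxx (eq_bigr (fun=> 1%N)) => [|b _]; last by rewrite f0l eqxx.
  rewrite [X in (_ + X + _)%N](eq_bigr (fun=> 1%N)) => [|b _]; last by rewrite f0r eqxx.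
  rewrite !sumc.
  rewrite (_ : (\sum_(a | a != 0%R) \sum_(b | b != 0%R) (0%R == split_form (a, b)) = r)%N); first by lia.
  by rewrite -[RHS]unit0; apply: eq_bigr => a _; apply: eq_bigr => b _; rewrite eq_sym.
have U := unit_pairs_split.
rewrite axes f0l zeros.
rewrite (eq_bigr (fun=> 3 * r + 1)%N) => [|b _]; last by under eq_bigr do rewrite f0l; rewrite zeros.
rewrite [X in (_ + X + _)%N](eq_bigr (fun=> 3 * r + 1)%N) => [|a _]; last by under eq_bigr do rewrite f0r; rewrite zeros.
rewrite !sumc.
have -> : (\sum_(a : k | a != 0%R) \sum_(b : k | b != 0%R) \sum_(y : k * k) (split_form (a, b) == split_form y) =
   (2 * r + 1) * r + \sum_(a : k | a != 0%R) \sum_(b : k | b != 0%R)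
     \sum_(a' : k | a' != 0%R) \sum_(b' : k | b' != 0%R) (split_form (a, b) == split_form (a', b')))%N.
  rewrite -[X in ((2 * r + 1) * X)%N]unit0 big_distrr -big_split /=; apply: eq_bigr => a _.
  rewrite big_distrr -big_split /=; apply: eq_bigr => b _.
  rewrite axes f0l (eq_bigr (fun=> (split_form (a, b) == 0%R) : nat)) => [|? _]; last by rewrite f0l.
  rewrite [X in (_ + X + _)%N](eq_bigr (fun=> (split_form (a, b) == 0%R) : nat)) => [|? _]; last by rewrite f0r.
  rewrite !sumc; move: (split_form (a, b) == 0) (\sum_(i | _) _)%N => e S.
  by case: e => /=; lia.
move: U; rewrite -/r; move: (\sum_(a | _) _)%N (unity_count _ _) => U t eU.
have er : q = r.+1 by rewrite /r subn1 prednK // ltnW.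
rewrite !er; nia.
Qed.

Section Split.
Variable w : k.
Hypotheses (k3 : 3%:R != 0 :> k) (w0 : w ^+ 2 + w + 1 = 0).

Lemma pairs_split : form_pairs k d = ((q - 1) * (q ^ 2 + (s + 4) * q + 1) + 1)%N.
Proof.
pose y (x : k * k) : k * k := (- w * x.1 - w ^+ 2 * x.2, - w ^+ 2 * x.1 - w * x.2).
have w2 : w ^+ 2 = - (w + 1) by apply/eqP; rewrite -addr_eq0 addrA w0.
pose z (y : k * k) : k * k :=
  (((1 - w ^+ 2) * y.1 + (1 - w) * y.2) / 3%:R, ((1 - w) * y.1 + (1 - w ^+ 2) * y.2) / 3%:R).
have yz : cancel y z.
  by move=> [a b]; rewrite /z /y /=; congr (_, _); apply: (mulIf k3); rewrite divfK //; ring: w2.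
have zy : cancel z y.
  move=> [a b]; rewrite /z /y /=; congr (_, _); apply: (mulIf k3);
    rewrite mulrDl !mulNr -!mulrA [_^-1 * _]mulVf //; ring: w2.
rewrite -pairs_split_form /form_pairs.
have fy x : form d x = split_form (y x).
  rewrite /form /split_form /y /normval /=; congr (_ * _ ^+ _); ring: w2.
rewrite [RHS](reindex y) /=; last by exists z => ? _.
apply: eq_bigr => x _; rewrite [RHS](reindex y) /=; last by exists z => ? _.
by apply: eq_bigr => x' _; rewrite !fy.
Qed.

End Split.
End SplitFibres.

Section NormFormCases.
Local Close Scope classical_set_scope.
Variables (k : finFieldType) (d : nat).
Local Notation q := #|k|.

Lemma pairs_char3 : 3%:R = 0 :> k ->
  form_pairs k d = ((q - 1) * (unity_count k d * q ^ 2 + q + 1) + 1)%N.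
Proof.
move=> k3; set m := (2 * d + 1)%N.
have m0 : (0 < m)%N by rewrite /m addn1.
have fE (a b : k) : form d (a, b) = (a + b) ^+ m.
  rewrite /form /= /m addn1 exprS exprM; congr (_ * _ ^+ _).
  by rewrite -[RHS]subr0 -(mul0r (a * b)) -k3 /normval; ring.
have add (F : k -> nat) : (\sum_(x : k * k) F (x.1 + x.2)%R = q * \sum_x F x)%N.
  rewrite (sum_pair (fun a b => F (a + b))) -sum_nat_const.
  apply: eq_bigr => a _; rewrite [RHS](reindex (+%R a)) //.
  by exists (+%R (- a)) => b _; [exact: addKr | exact: addNKr].
have -> : form_pairs k d = (q * \sum_(x : k) (q * \sum_(y : k) ((x ^+ m)%R == (y ^+ m)%R)))%N.
  rewrite /form_pairs -add; apply: eq_bigr => -[a b] _ /=.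
  by rewrite -add; apply: eq_bigr => -[a' b'] _; rewrite !fE.
rewrite -big_distrr /= sum_nz.
have -> : (\sum_(y : k) ((0 ^+ m)%R == (y ^+ m)%R) = 1)%N.
  by apply: (sum_bool_ex1 (c := 0)) => y; rewrite expr0n gtn_eqF //= eq_sym expf_eq0 m0.
rewrite (eq_bigr (fun=> unity_count k d)) => [|x x0]; last first.
  rewrite /unity_count card_sum_bool (reindex (fun t => t * x)) /=; last first.
    by exists (fun y => y / x) => y _; rewrite ?mulfK ?divfK.
  apply: eq_bigr => t _; rewrite exprMn eq_sym -[in RHS](inj_eq (mulIf (expf_neq0 m x0))).
  by rewrite mul1r.
rewrite sum_nz_const; have := q_gt1 k; move: (unity_count _ _) => s q1.
have [r er] : exists r, q = r.+1 by exists q.-1; rewrite prednK // ltnW.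
by rewrite !er; nia.
Qed.

Hypothesis k3 : 3%:R != 0 :> k.

Lemma anisotropic_norm : ~~ (3 %| q - 1)%N ->
  forall a b : k, normval a b = 0 -> (a, b) = (0, 0).
Proof.
move=> nd a b ab; have [b0|b0] := eqVneq b 0.
  by move: ab; rewrite b0 /normval mulr0 subr0 expr0n addr0 => /eqP; rewrite expf_eq0 => /eqP ->.
exfalso; pose s := - (a / b).
have s0 : s ^+ 2 + s + 1 = 0.
  by apply: (mulIf (expf_neq0 2 b0)); rewrite mul0r -ab /s /normval; field.
have s3 : s ^+ 3 = 1.
  by apply/eqP; rewrite -subr_eq0; apply/eqP; transitivity ((s - 1) * (s ^+ 2 + s + 1)); [ring | rewrite s0 mulr0].
have : #|[set t : k | t ^+ 3 == 1]| = 1%N.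
  by rewrite card_unity_roots //; apply/eqP; rewrite -/(coprime _ 3) coprime_sym prime_coprime.
move=> /eqP/cards1P[u eu].
have : s \in [set u] by rewrite -eu inE s3.
have : 1 \in [set u] by rewrite -eu inE expr1n.
rewrite !inE => /eqP <- /eqP s1; move: k3; rewrite -s0 s1 => /eqP; apply; ring.
Qed.

Lemma primitive_cube_root : (3 %| q - 1)%N -> exists w : k, w ^+ 2 + w + 1 = 0.
Proof.
move=> /gcdn_idPr q3.
have : (1 < #|[set t : k | (t ^+ 3 == 1)%R]|)%N by rewrite card_unity_roots // q3.
rewrite (cardD1 1) inE expr1n eqxx ltnS => /card_gt0P[w].
rewrite !inE => /andP[w1 /eqP w3]; exists w.
have : (w - 1) * (w ^+ 2 + w + 1) = 0 by transitivity (w ^+ 3 - 1); [ring | rewrite w3 subrr].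
by move/eqP; rewrite mulf_eq0 subr_eq0 (negPf w1) => /eqP.
Qed.

Hypothesis d0 : (0 < d)%N.

Lemma pairs_anisotropic_q : ~~ (3 %| q - 1)%N ->
  form_pairs k d = ((q - 1) * (q ^ 2 + unity_count k d * q + 1) + 1)%N.
Proof. by move=> q3; apply: pairs_anisotropic => //; apply: anisotropic_norm. Qed.

Lemma pairs_split_q : (3 %| q - 1)%N ->
  form_pairs k d = ((q - 1) * (q ^ 2 + (unity_count k d + 4) * q + 1) + 1)%N.
Proof. by move=> /primitive_cube_root[w w0]; apply: pairs_split w0. Qed.

(** When the power map of exponent 2d+1 is bijective, scaling makes all the
    nonzero values of the form equally frequent. *)
Lemma form_fibres v : ~~ (3 %| q - 1)%N -> gcdn (2 * d + 1) (q - 1) = 1%N ->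
  (\sum_(x : k * k) (form d x == v) = q)%N.
Proof.
move=> q3 cop; set m := (2 * d + 1)%N in cop.
have m0 : (0 < m)%N by rewrite /m addn1.
have zeros := card_form_zeros d0 (anisotropic_norm q3).
have scale t x : form d (t * x.1, t * x.2) = t ^+ m * form d x.
  have e : normval (t * x.1) (t * x.2) = t ^+ 2 * normval x.1 x.2 by rewrite /normval; ring.
  by rewrite /form /= e exprMn -exprM /m addn1 exprS; ring.
have inj : injective (fun t : k => t ^+ m).
  move=> a b /= ab; have [b0|b0] := eqVneq b 0.
    by move/eqP: ab; rewrite b0 expr0n gtn_eqF // expf_eq0 m0 => /eqP.
  have /eqP/cards1P[u eu] : #|[set t : k | t ^+ m == 1]| = 1%N.
    by rewrite card_unity_roots // gcdnC.
  have : a / b \in [set u] by rewrite -eu inE expr_div_n ab divff ?expf_neq0.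
  have : 1 \in [set u] by rewrite -eu inE expr1n.
  by rewrite !inE => /eqP <- /eqP e; rewrite -[RHS]mul1r -e divfK.
have [root rootK Kroot] := injF_bij inj.
have nz c : c != 0 -> (\sum_(x : k * k) (form d x == c) = \sum_(x : k * k) (form d x == 1%R))%N.
  move=> c0; have t0 : root c != 0.
    by apply: contra_neq c0 => t0; rewrite -(Kroot c) t0 expr0n gtn_eqF.
  rewrite (reindex (fun x : k * k => (root c * x.1, root c * x.2))) /=; last first.
    exists (fun x => (x.1 / root c, x.2 / root c)) => -[a b] _ /=.
      by congr (_, _); rewrite mulrAC divff // mul1r.
    by congr (_, _); rewrite mulrCA divff // mulr1.
  apply: eq_bigr => x _; rewrite scale (Kroot c); congr (nat_of_bool _).
  by apply/eqP/eqP => [e|->]; [apply: (mulfI c0); rewrite e mulr1 | rewrite mulr1].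
have [->//|v0] := eqVneq v 0; rewrite nz //.
have tot : (q ^ 2 = \sum_(c : k) \sum_(x : k * k) (form d x == c))%N.
  rewrite exchange_big /= -mulnn -card_prod -sum1_card; apply: eq_bigr => x _.
  by rewrite (sum_bool_ex1 (c := form d x)) // => c; rewrite eq_sym.
rewrite sum_nz zeros (eq_bigr (fun=> \sum_(x : k * k) (form d x == 1%R))%N) // sum_nz_const in tot.
have := q_gt1 k; move: tot; move: (\sum_x _)%N => N.
have [r ->] : exists r, q = r.+1 by exists q.-1; rewrite prednK // ltnW // q_gt1.
by rewrite subn1 /= -mulnn; nia.
Qed.

End NormFormCases.

Section ProjectiveCounts.
Local Close Scope classical_set_scope.
Variables (k : finFieldType) (m : nat).
Local Notation q := #|k|.
Implicit Types c : {ffun 'I_m.+1 -> k}.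

Definition dilate (t : k) c : {ffun 'I_m.+1 -> k} := [ffun j => t * c j].

(** A cone with (q-1) N + 1 points has N points in projective space; the map g
    may be any model of the projection to the set of lines. *)
Lemma card_cone (Y : Type) (g : {ffun 'I_m.+1 -> k} -> Y) (P : pred {ffun 'I_m.+1 -> k}) N :
  (forall c c', g c = g c' <-> same_orbit (Proj m) c c') ->
  P [ffun=> 0] -> (forall t c, t != 0 -> P c -> P (dilate t c)) ->
  #|[set c | P c]| = ((q - 1) * N + 1)%N ->
  (g @` [set` [set c | P c && (c != [ffun=> 0%R])]%SET] #= `I_N)%classic%card.
Proof.
move=> gE P0 Pt cP; apply: (@card_image_fibres _ _ _ _ (q - 1)).
- by rewrite subn_gt0 q_gt1.
- move=> c; rewrite inE => /andP[Pc c0].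
  have [j cj] : exists j, c j != 0.
    apply/existsP; apply: contraR c0 => /existsPn h; apply/eqP/ffunP => j; rewrite ffunE.
    by apply/eqP; rewrite -[_ == _]negbK.
  have -> : (q - 1)%N = #|[set t : k | t != 0]|.
    by rewrite -sum1_card -[LHS]mul1n -sum_nz_const; apply: eq_bigl => t; rewrite inE.
  rewrite -(card_imset (f := dilate^~ c)) => [|s t /ffunP/(_ j)]; last first.
    by rewrite !ffunE => /(mulIf cj).
  apply: eq_card => c'; rewrite !inE; apply/andP/imsetP => [[_ /asboolP/gE/proj_orbitP[t t0 e]]|[t]].
    by exists t; rewrite ?inE //; apply/ffunP => i; rewrite ffunE e.
  rewrite inE => t0 ->; split; last first.
    by apply/asboolP/gE/proj_orbitP; exists t => // i; rewrite ffunE.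
  rewrite Pt //=; apply: contraNneq cj => /ffunP/(_ j); rewrite !ffunE => /eqP.
  by rewrite mulf_eq0 (negPf t0) => /eqP ->.
have : [set c | P c] = [ffun=> 0] |: [set c | P c && (c != [ffun=> 0%R])].
  by apply/setP => c; rewrite !inE; case: eqVneq => [->|]; rewrite ?P0 ?andbT.
move=> e; move: cP; rewrite e cardsU1 inE eqxx andbF /= => h; lia.
Qed.

Lemma cox_points_cone (f : mpoly m.+1 k) N :
  meval (fun=> 0) f = 0 ->
  (forall t (p : 'I_m.+1 -> k), t != 0 -> meval p f = 0 -> meval (fun j => t * p j) f = 0) ->
  #|[set c : {ffun 'I_m.+1 -> k} | meval c f == 0]| = ((q - 1) * N + 1)%N ->
  (cox_points (Proj m) f #= `I_N)%classic%card.
Proof.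
move=> f0 ft cf; pose P (c : {ffun 'I_m.+1 -> k}) := meval c f == 0.
have e : cox_points (Proj m) f =
    ((fun c : {ffun 'I_m.+1 -> k} => Defs.orbit (Proj m) c)
       @` [set` [set c | P c && (c != [ffun=> 0%R])]%SET])%classic.
  apply/seteqP; split=> O /=.
    move=> [p [/proj_semistableP[j pj] p0] <-]; pose c : {ffun 'I_m.+1 -> k} := [ffun i => p i].
    have cp : (c : 'I_m.+1 -> k) = p by apply: funext => i; rewrite ffunE.
    exists c; last by rewrite cp.
    rewrite /= inE /P cp p0 eqxx /=; apply: contraNneq pj => /ffunP/(_ j).
    by rewrite !ffunE => ->.
  move=> [c]; rewrite /= inE => /andP[/eqP Pc c0] <-; exists c => //; split=> //.
  apply/proj_semistableP; apply/not_existsP => h; move/eqP: c0; apply.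
  apply/ffunP => j; rewrite ffunE; apply/eqP; rewrite -[_ == _]negbK; apply/negP/h.
rewrite e; apply: card_cone => //.
- by move=> c c'; apply: orbitP.
- rewrite /P; apply/eqP; rewrite -[RHS]f0; congr (meval _ f).
  by apply: funext => j; rewrite ffunE.
move=> t c t0 /eqP Pc; apply/eqP; rewrite -[RHS](ft t c t0 Pc); congr (meval _ f).
by apply: funext => j; rewrite ffunE.
Qed.




End ProjectiveCounts.

Section HypersurfaceCounts.
Local Close Scope classical_set_scope.
Variables (k : finFieldType) (n d : nat).
Local Notation q := #|k|.

Lemma meval_hypX_form (p : 'I_n.*2.+2 -> k) :
  meval p (hypX k n d) = \sum_(i < n.+1) form d (p (inord i.*2), p (inord i.*2.+1)).
Proof. by rewrite meval_hypX. Qed.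

Lemma form_dilate t (x : k * k) : form d (t * x.1, t * x.2) = t ^+ (2 * d + 1) * form d x.
Proof.
have e : normval (t * x.1) (t * x.2) = t ^+ 2 * normval x.1 x.2 by rewrite /normval; ring.
by rewrite /form /= e exprMn -exprM addn1 exprS; ring.
Qed.

Lemma hypX_dilate t (p : 'I_n.*2.+2 -> k) :
  meval (fun j => t * p j) (hypX k n d) = t ^+ (2 * d + 1) * meval p (hypX k n d).
Proof.
rewrite !meval_hypX_form big_distrr; apply: eq_bigr => i _.
exact: (form_dilate t (p (inord i.*2), p (inord i.*2.+1))).
Qed.

Lemma hypX_0 : meval (fun=> 0) (hypX k n d) = 0.
Proof.
by rewrite meval_hypX_form big1 // => i _; rewrite /form /= addr0 mul0r.
Qed.

Definition update (x : k * k) (c : {ffun 'I_n.*2.+2 -> k}) : {ffun 'I_n.*2.+2 -> k} :=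
  [ffun j => if j == inord 0 then x.1 else if j == inord 1 then x.2 else c j].

Lemma hypX_update x c : meval (update x c) (hypX k n d) =
  form d x + \sum_(1 <= i < n.+1) form d (c (inord i.*2), c (inord i.*2.+1)).
Proof.
rewrite meval_hypX_form -(big_mkord xpredT (fun i => form d (update x c (inord i.*2), update x c (inord i.*2.+1)))).
rewrite big_ltn //; congr (_ + _).
  have d01 : (inord 1 == inord 0 :> 'I_n.*2.+2) = false by rewrite -val_eqE /= !inordK.
  by rewrite !ffunE eqxx d01 eqxx; case: x.
apply: eq_big_nat => i /andP[i0 iN].
have off t : (1 < t < n.*2.+2)%N -> update x c (inord t) = c (inord t).
  by move=> /andP[t1 tn]; rewrite ffunE -!val_eqE /= !inordK // !gtn_eqF // ltnW.
by rewrite !off //; lia.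
Qed.

(** Replacing the first two coordinates by arbitrary ones turns the fibres of the
    form into fibres of the equation of the hypersurface. *)
Lemma card_hypX_cone : (forall v, \sum_(x : k * k) (form d x == v) = q)%N ->
  #|[set c : {ffun 'I_n.*2.+2 -> k} | meval c (hypX k n d) == 0]| = (q ^ (2 * n + 1))%N.
Proof.
move=> fib; pose Z (c : {ffun 'I_n.*2.+2 -> k}) := meval c (hypX k n d) == 0.
pose sw (y : (k * k) * {ffun 'I_n.*2.+2 -> k}) := ((y.2 (inord 0), y.2 (inord 1)), update y.1 y.2).
have d01 : (inord 1 == inord 0 :> 'I_n.*2.+2) = false by rewrite -val_eqE /= !inordK.
have swK : involutive sw.
  move=> [[a b] c]; rewrite /sw /update /= !ffunE !eqxx d01 /=; congr (_, _).
  by apply/ffunP => j; rewrite !ffunE; case: eqP => [->//|_]; case: eqP => [->|].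
have : (\sum_(y : (k * k) * {ffun 'I_n.*2.+2 -> k}) Z y.2 = \sum_(y : (k * k) * {ffun 'I_n.*2.+2 -> k}) Z (update y.1 y.2))%N.
  by rewrite (reindex_inj (inv_inj swK)).
rewrite (sum_pair (fun x c => nat_of_bool (Z c))) (sum_pair (fun x c => nat_of_bool (Z (update x c)))).
rewrite sum_nat_const card_prod.
have -> : (\sum_(x : k * k) \sum_(c : {ffun 'I_n.*2.+2 -> k}) Z (update x c) =
    \sum_(c : {ffun 'I_n.*2.+2 -> k}) q)%N.
  rewrite exchange_big; apply: eq_bigr => c _.
  rewrite -(fib (- \sum_(1 <= i < n.+1) form d (c (inord i.*2), c (inord i.*2.+1)))).
  by apply: eq_bigr => x _; rewrite /Z hypX_update addr_eq0.
rewrite sum_nat_const card_ffun card_ord -card_sum_bool => e.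
have q0 : (0 < q * q)%N by rewrite muln_gt0 !(ltnW (q_gt1 k)).
apply/eqP; rewrite -(eqn_pmul2l q0) e -expnSr mulnn -expnD; apply/eqP; congr (_ ^ _)%N.
lia.
Qed.

End HypersurfaceCounts.

Section Surfaces.
Local Close Scope classical_set_scope.
Variables (k : finFieldType) (d : nat).
Hypothesis d0 : (0 < d)%N.
Local Notation q := #|k|.

Lemma card_surface_cone :
  #|[set c : {ffun 'I_4 -> k} | meval c (hypX k 1 d) == 0]| = form_pairs k d.
Proof.
rewrite card_sum_bool /form_pairs -(sum_pair (fun x y : k * k => nat_of_bool (form d x == form d y))).
pose f (y : (k * k) * (k * k)) : {ffun 'I_4 -> k} :=
  [ffun j : 'I_4 => nth 0 [:: y.1.1; y.1.2; - y.2.1; - y.2.2] j].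
pose g (c : {ffun 'I_4 -> k}) := ((c (inord 0), c (inord 1)), (- c (inord 2), - c (inord 3))).
have fg : cancel f g.
  by move=> [[a b] [a' b']]; rewrite /f /g !ffunE !inordK //= !opprK.
have gf : cancel g f.
  move=> c; apply/ffunP => j; rewrite ffunE /g /= !opprK.
  rewrite -[in RHS](inord_val j); case: j => -[|[|[|[|//]]]] lt //=.
rewrite (reindex f) /=; last by exists g => ? _.
apply: eq_bigr => -[[a b] [a' b']] _; congr (nat_of_bool _).
have e : meval (f ((a, b), (a', b'))) (hypX k 1 d) = _ := @meval_hypX_form k 1 d _.
rewrite e big_ord_recl big_ord1 /= /f !ffunE !inordK //=.
by rewrite (_ : form d (- a', - b') = - form d (a', b')) ?subr_eq0 //; apply: (formN d (a', b')).
Qed.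

Lemma cox_points_surface N : form_pairs k d = ((q - 1) * N + 1)%N ->
  (cox_points (Proj 3) (hypX k 1 d) #= `I_N)%classic%card.
Proof.
move=> e; apply: cox_points_cone; first exact: (hypX_0 k 1 d).
  by move=> t p _ p0; have h := @hypX_dilate k 1 d t p; rewrite p0 mulr0 in h.
by rewrite card_surface_cone.
Qed.

Lemma unity_countE : unity_count k d = gcdn (q - 1) (2 * d + 1).
Proof. by apply: card_unity_roots; rewrite addn1. Qed.

Lemma surface_points p m : prime p -> (0 < m)%N -> q = (p ^ m)%N ->
  let s := gcdn (q - 1) (2 * d + 1) in
  let X2 := cox_points (Proj 3) (hypX k 1 d) in
  [/\ p <> 2%N -> p <> 3%N ->
        ((q %% 6 = 5)%N -> (X2 #= `I_(q ^ 2 + s * q + 1))%classic%card) /\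
        ((q %% 6 = 1)%N -> (X2 #= `I_(q ^ 2 + (s + 4) * q + 1))%classic%card),
      p = 3%N -> forall i g : nat, (2 * d + 1 = 3 ^ i * g)%N -> ~~ (3 %| g)%N ->
        (X2 #= `I_(gcdn g (q - 1) * q ^ 2 + q + 1))%classic%card &
      p = 2%N ->
        (odd m -> (X2 #= `I_(q ^ 2 + s * q + 1))%classic%card) /\
        (~~ odd m -> (X2 #= `I_(q ^ 2 + (s + 4) * q + 1))%classic%card)].
Proof.
move=> pp m0 qp s X2; have pk : p \in [pchar k] by apply: card_finPcharP qp pp.
have q1 : (1 < q)%N by exact: q_gt1.
have k3 : p <> 3%N -> 3%:R != 0 :> k.
  by move=> /eqP p3; rewrite -(dvdn_pcharf pk) dvdn_prime2.
have an : p <> 3%N -> ~~ (3 %| q - 1)%N -> (X2 #= `I_(q ^ 2 + s * q + 1))%classic%card.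
  by move=> p3 q3; apply: cox_points_surface; rewrite pairs_anisotropic_q ?unity_countE // k3.
have sp : p <> 3%N -> (3 %| q - 1)%N -> (X2 #= `I_(q ^ 2 + (s + 4) * q + 1))%classic%card.
  by move=> p3 q3; apply: cox_points_surface; rewrite pairs_split_q ?unity_countE // k3.
split.
- move=> _ p3; split=> q6; [apply: an | apply: sp] => //.
    by move: q6 q1; move: #|k| => r; lia.
  by move: q6 q1; move: #|k| => r; lia.
- move=> p3 i g dg g3; apply: cox_points_surface.
  have three : 3%:R = 0 :> k by move: (pcharf0 pk); rewrite p3.
  have cop : coprime (q - 1) (3 ^ i).
    rewrite coprime_sym coprimeXl // prime_coprime // qp p3 -(prednK m0) expnS.
    by move: (expn_gt0 3 m.-1); move: (3 ^ _)%N => t /= t0; lia.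
  by rewrite pairs_char3 // unity_countE dg Gauss_gcdr // gcdnC.
move=> p2; have n3 : p <> 3%N by rewrite p2.
have q3 : (q %% 3 = if odd m then 2 else 1)%N.
  rewrite qp p2 -{1}[m]odd_double_half expnD -mul2n expnM.
  rewrite -modnMmr -modnXm exp1n; case: (odd m); first by [].
  by [].
split=> om; [apply: an | apply: sp] => //; move: q3; rewrite ?om ?(negPf om);
  by move: q1; move: #|k| => r; lia.
Qed.

Lemma expn_geometric e : (q ^ e)%N = ((q - 1) * ((q ^ e - 1) %/ (q - 1)) + 1)%N.
Proof.
have q0 : (0 < q ^ e)%N by rewrite expn_gt0 ltnW // q_gt1.
by rewrite [((q - 1) * _)%N]mulnC divnK ?subnK // !subn1 dvdn_pred_predX.
Qed.

Lemma cox_points_proj n : (cox_points (Proj n.*2) (0 : mpoly n.*2.+1 k)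
  #= `I_((q ^ (2 * n + 1) - 1) %/ (q - 1)))%classic%card.
Proof.
apply: cox_points_cone; rewrite ?meval0 //; first by move=> t p _ _; rewrite meval0.
rewrite -expn_geometric (eq_card (B := predT)) => [|c]; last by rewrite !inE meval0 eqxx.
by rewrite cardE -cardT card_ffun card_ord addn1 mul2n.
Qed.

End Surfaces.

Section QuadraticExtension.
Variables (k : fieldType) (L : fieldExtType k) (xi : L).
Hypothesis qs : quadratic_setting xi.

Let xi2 : xi ^+ 2 = - 3%:R. Proof. by case: qs. Qed.

Lemma quadratic_degree : adjoin_degree 1 xi = 2%N.
Proof.
case: qs => _ _ dL gen _; apply/eqP.
by have := dim_Fadjoin 1 xi; rewrite gen dL dimv1 muln1 => <-.
Qed.

Lemma quadratic_coords z : exists a b : k, z = a%:A + b%:A * xi.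
Proof.
have zin : z \in <<1; xi>>%VS by case: qs => _ _ _ -> _; rewrite memvf.
have [a ea] := vlineP _ _ (polyOverP (Fadjoin_polyOver 1 xi z) 0%N).
have [b eb] := vlineP _ _ (polyOverP (Fadjoin_polyOver 1 xi z) 1%N).
exists a, b; rewrite -(Fadjoin_poly_eq zin) (horner_coef_wide (n := 2)).
  by rewrite !big_ord_recr big_ord0 /= add0r expr0 mulr1 expr1 ea eb.
by rewrite -quadratic_degree size_Fadjoin_poly.
Qed.

Lemma xi_not_rational a : a%:A != xi.
Proof.
apply/eqP => e; have : adjoin_degree 1 xi == 1%N by rewrite adjoin_deg_eq1 -e memvZ ?mem1v.
by rewrite quadratic_degree.
Qed.

Lemma quadratic_minPoly : minPoly 1 xi = 'X^2 + 3%:R%:P.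
Proof.
have sz : size ('X^2 + 3%:R%:P : {poly L}) = 3%N by rewrite size_polyDl size_polyXn // size_polyC; case: eqP.
have mon : 'X^2 + 3%:R%:P \is @monic L.
  by rewrite monicE lead_coefDl ?lead_coefXn // size_polyXn size_polyC; case: eqP.
apply/eqP; rewrite -eqp_monic ?monic_minPoly // -dvdp_size_eqp.
  by rewrite size_minPoly quadratic_degree sz.
apply: minPoly_dvdp; first by rewrite rpredD ?rpredX ?polyOverX // polyOverC rpred_nat.
by rewrite /root hornerD hornerXn hornerC xi2 addNr.
Qed.

Lemma conjugation_exists : exists s : 'AEnd(L), s xi = - xi.
Proof.
have root : root (map_poly \1%VF (minPoly 1 xi)) (- xi).
  by rewrite lfun1_poly quadratic_minPoly /root hornerD hornerXn hornerC sqrrN xi2 addNr.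
have hom := kHomExtendP (sub1v 1%AS) (kHom1 1 1) root.
have ah : ahom_in {:L} (kHomExtend 1 \1 xi (- xi)).
  by rewrite -k1HomE; case: qs => _ _ _ <- _.
exists (AHom ah); exact: (kHomExtend_val (kHom1 1 1) root).
Qed.

End QuadraticExtension.

Lemma Fhat_same_orbit (F : fieldType) n d (xi : F) p q :
  same_orbit (toric n) p q -> meval p (Fhat n d xi) = 0 -> meval q (Fhat n d xi) = 0.
Proof.
move=> /toric_orbitP[t0 [t1 [t2 [n0 n1 n2 e [ep em]]]]].
rewrite !meval_Fhat /Fval ep em => p0.
pose a := t0 / t1; pose b := t0 / t2.
have eP : Pval n d (fun t => q (inord t)) =
    a ^+ d.+1 * b ^+ d * Pval n d (fun t => p (inord t)).
  rewrite /Pval big_distrr; apply: eq_bigr => -[i /= lt] _.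
  by have [-> ->] := e i lt; rewrite -/a -/b !exprMn; ring.
have eQ : Qval n d (fun t => q (inord t)) =
    a ^+ d * b ^+ d.+1 * Qval n d (fun t => p (inord t)).
  rewrite /Qval big_distrr; apply: eq_bigr => -[i /= lt] _.
  by have [-> ->] := e i lt; rewrite -/a -/b !exprMn; ring.
have e1 : t1 * a = t0 by rewrite /a mulrC divfK.
have e2 : t2 * b = t0 by rewrite /b mulrC divfK.
rewrite eP eQ -[RHS](mulr0 (t0 * (a ^+ d * b ^+ d))) -[in RHS]p0 !exprS.
clearbody a b; ring: e1 e2.
Qed.

Section RationalPoints.
Variables (k : fieldType) (L : fieldExtType k) (xi : L) (n d : nat).
Hypothesis qs : quadratic_setting xi.

Let xi2 : xi ^+ 2 = - 3%:R. Proof. by case: qs. Qed.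
Let L2 : 2%:R != 0 :> L.
Proof. by case: qs => c2 _ _ _ _; rewrite -(rmorph_nat (in_alg L)) fmorph_eq0; apply: contraNN c2 => h; rewrite inE. Qed.
Let L3 : 3%:R != 0 :> L.
Proof. by case: qs => _ c3 _ _ _; rewrite -(rmorph_nat (in_alg L)) fmorph_eq0; apply: contraNN c3 => h; rewrite inE. Qed.
Let x0 : xi != 0. Proof. exact: xi_neq0 L3 xi2. Qed.

Lemma lift_pt_even c i : (i <= n)%N ->
  lift_pt xi c (inord i.*2 : 'I_n.*2.+4) =
    (c (inord i.*2))%:A - (1 + xi) * 2%:R^-1 * (c (inord i.*2.+1))%:A.
Proof. by move=> h; rewrite /lift_pt inordK ?inord_even_lt // lift_even. Qed.

Lemma lift_pt_odd c i : (i <= n)%N ->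
  lift_pt xi c (inord i.*2.+1 : 'I_n.*2.+4) =
    (c (inord i.*2))%:A - (1 - xi) * 2%:R^-1 * (c (inord i.*2.+1))%:A.
Proof. by move=> h; rewrite /lift_pt inordK ?inord_odd_lt // lift_odd. Qed.

Lemma lift_pt_semistable (c : 'I_n.*2.+2 -> k) j : c j != 0 -> semistable (toric n) (lift_pt xi c).
Proof.
move=> cj.
have indep (e : L) (a b : k) : e ^+ 2 = - 3%:R -> (forall f, f%:A != e) ->
    a%:A - (1 + e) * 2%:R^-1 * b%:A = 0 -> a = 0 /\ b = 0.
  move=> e2 en h; have [b0|b0] := eqVneq b 0.
    split=> //; apply: (fmorph_inj (in_alg L)); move: h; rewrite b0 scale0r mulr0 subr0.
    by rewrite /= scale0r.
  have bA : b%:A != 0 :> L by rewrite (fmorph_eq0 (in_alg L)).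
  case/negP: (en (2%:R * a / b - 1)); apply/eqP; apply: (mulIf bA).
  move: h bA; rewrite !(in_algE L) rmorphB fmorph_div rmorphM rmorph1 rmorph_nat.
  rewrite /=; move: (a%:A : L) (b%:A : L) => u v h bA.
  transitivity (2%:R * u - v); first by field.
  by move/eqP: h; rewrite subr_eq0 => /eqP ->; field.
have nr a : a%:A != xi by exact: xi_not_rational.
have nrN a : a%:A != - xi by rewrite -eqr_oppLR -scaleNr.
have jn : (j./2 <= n)%N by apply: half_le; rewrite -ltnS.
have nz : ~ (c (inord j./2.*2) = 0 /\ c (inord j./2.*2.+1) = 0).
  case=> h0 h1; case/negP: cj; rewrite -[j]inord_val -[nat_of_ord j]odd_double_half.
  by case: (odd j); rewrite ?add0n ?add1n ?h0 ?h1.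
apply/toric_semistableP; split; first exists j./2 => //.
- by rewrite lift_pt_even //; apply/eqP => h; apply: nz; apply: indep h.
- exists j./2 => //; rewrite lift_pt_odd //; apply/eqP => h; apply: nz.
  by apply: indep h; rewrite ?sqrrN.
by left; rewrite /lift_pt inordK // lift_wp oner_neq0.
Qed.

Lemma lift_pt_dilate (c c' : 'I_n.*2.+2 -> k) :
  same_orbit (Proj n.*2.+1) c c' -> same_orbit (toric n) (lift_pt xi c) (lift_pt xi c').
Proof.
move=> /proj_orbitP[t t0 e]; apply/toric_orbitP; exists t%:A, 1, 1.
rewrite (fmorph_eq0 (in_alg L)) t0 oner_neq0; split=> // [i h|].
  rewrite !lift_pt_even // !lift_pt_odd // !e !(in_algE L) !rmorphM /= divr1.
  by split; ring.
by rewrite /lift_pt !inordK // !lift_wp !lift_wm !mul1r.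
Qed.

(** Hilbert 90: a Galois-stable orbit contains the lift of a rational point. *)
Lemma Xtilde_descent O : Xtilde_points xi n d O ->
  exists c : 'I_n.*2.+2 -> k, [/\ exists j, c j != 0, meval c (hypX k n d) = 0 &
    O = Defs.orbit (toric n) (lift_pt xi c)].
Proof.
case=> -[p [ss p0] <-] stable.
have [s sxi] := conjugation_exists qs.
have sM x y : s (x * y) = s x * s y by exact: rmorphM.
have sD x y : s (x + y) = s x + s y by exact: rmorphD.
have sN x : s (- x) = - s x by exact: rmorphN.
have sV x : s x^-1 = (s x)^-1 by exact: fmorphV.
have sA a : s a%:A = a%:A by rewrite linearZ /= rmorph1.
have ss2 x : s (s x) = x.
  by have [a [b ->]] := quadratic_coords qs x; rewrite !sD !sM !sA sxi sN sxi opprK.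
have fixed x : s x = x -> exists a : k, x = a%:A.
  have [a [b ->]] := quadratic_coords qs x; rewrite sD sM !sA sxi => /addrI e.
  exists a; have : (b%:A * xi) *+ 2 = 0 by rewrite mulr2n -{1}e mulrN addNr.
  by rewrite -mulr_natl => /eqP; rewrite mulf_eq0 (negPf L2) /= => /eqP ->; rewrite addr0.
have : Defs.orbit (toric n) p (gal_point xi s p).
  by rewrite -(stable s); exists p => //; apply: same_orbit_refl.
move=> /toric_orbitP[t0 [t1 [t2 [n0 n1 n2 e [ep em]]]]].
have sw i j : (i <= n.*2.+3)%N -> flip i = j -> gal_point xi s p (inord i) = s (p (inord j)).
  move=> h f; rewrite /gal_point; congr (s (p _)); apply: val_inj.
  rewrite /= swap_index_flip // !inordK //; rewrite -?f ?ltnS //.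
  exact: flip_le.
have e0 i : (i <= n)%N -> s (p (inord i.*2.+1)) = t0 / t1 * p (inord i.*2).
  move=> h; rewrite -(sw i.*2) ?flip_even //; last by rewrite -ltnS inord_even_lt.
  by have [] := e i h.
have e1 i : (i <= n)%N -> s (p (inord i.*2)) = t0 / t2 * p (inord i.*2.+1).
  move=> h; rewrite -(sw i.*2.+1) ?flip_odd //; last by rewrite -ltnS inord_odd_lt.
  by have [] := e i h.
have e2 : s (p (inord n.*2.+3)) = t1 * p (inord n.*2.+2).
  by rewrite -ep; apply/esym/sw => //; rewrite -doubleS flip_even.
have e3 : s (p (inord n.*2.+2)) = t2 * p (inord n.*2.+3).
  by rewrite -em; apply/esym/sw => //; rewrite -(doubleS n) flip_odd.
set wp := p (inord n.*2.+2) in e2 e3; set wm := p (inord n.*2.+3) in e2 e3.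
have /toric_semistableP[[i0 i0n z0] [i1 i1n z1] w0] := ss.
have [wp0 wm0] : wp != 0 /\ wm != 0.
  have : (wp != 0) = (wm != 0).
    have := congr1 (fun x => x == 0) e2; rewrite fmorph_eq0 mulf_eq0 (negPf n1) /= => h.
    by rewrite -h.
  by case: w0; rewrite -/wp -/wm => h; rewrite h => h'; split; rewrite // ?h' // -h'.
pose Z i := wp * p (inord i.*2); pose Z' i := wm * p (inord i.*2.+1).
have sZ' i : (i <= n)%N -> s (Z' i) = t0 * Z i.
  by move=> h; rewrite sM e2 e0 // /Z; field.
have sZ i : (i <= n)%N -> s (Z i) = t0 * Z' i.
  by move=> h; rewrite sM e3 e1 // /Z'; field.
have norm1 : s t0 * t0 = 1.
  have zz : Z i0 != 0 by rewrite mulf_neq0.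
  have h := ss2 (Z i0); rewrite (sZ _ i0n) (sM t0) (sZ' _ i0n) in h.
  by apply: (mulIf zz); rewrite mul1r -mulrA.
have [u u0 su] : exists2 u, u != 0 & s u * t0 = u.
  have [tm|tm] := eqVneq (1 + t0) 0.
    exists xi; rewrite // sxi mulNr; have -> : t0 = -1 by apply/eqP; rewrite -addr_eq0 addrC tm.
    by rewrite mulrN1 opprK.
  by exists (1 + t0); rewrite // sD rmorph1 mulrDl norm1 mul1r addrC.
have [Y EY] : exists Y, forall i, Y i = u * Z i by exists (fun i => u * Z i).
have [Y' EY'] : exists Y', forall i, Y' i = u * Z' i by exists (fun i => u * Z' i).
have sY' i : (i <= n)%N -> s (Y' i) = Y i.
  by move=> h; rewrite EY EY' sM sZ' // mulrA su.
have sY i : (i <= n)%N -> s (Y i) = Y' i.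
  by move=> h; rewrite EY EY' sM sZ // mulrA su.
have shf : s 2%:R^-1 = 2%:R^-1 by rewrite sV rmorph_nat.
have ex0 i : (i <= n)%N -> exists a : k, (Y i + Y' i) / 2%:R + (Y' i - Y i) / xi / 2%:R = a%:A.
  move=> h; apply: fixed; rewrite sD (sM (Y i + Y' i)) (sM (_ / xi)) shf.
  rewrite (sM (Y' i - Y i)) !sD !sN sV sY // sY' // sxi.
  by field; rewrite oppr_eq0 x0 L2.
have ex1 i : (i <= n)%N -> exists a : k, (Y' i - Y i) / xi = a%:A.
  by move=> h; apply: fixed; rewrite !(sD, sM, sN, sV) sY // sY' // sxi; field; rewrite oppr_eq0 x0.
have exc (j : 'I_n.*2.+2) : exists a : k, a%:A = let i := j./2 in
    if odd j then (Y' i - Y i) / xi else (Y i + Y' i) / 2%:R + (Y' i - Y i) / xi / 2%:R.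
  have jn : (j./2 <= n)%N by apply: half_le; rewrite -ltnS.
  by case: (odd j); [have [a ea] := ex1 _ jn | have [a ea] := ex0 _ jn]; exists a; rewrite /= ea.
have [c cE] := choice exc.
have c0E i : (i <= n)%N -> (c (inord i.*2))%:A = (Y i + Y' i) / 2%:R + (Y' i - Y i) / xi / 2%:R.
  move=> h; have /andP[lt _] := val_index_le h.
  by rewrite cE inordK //= odd_double doubleK.
have c1E i : (i <= n)%N -> (c (inord i.*2.+1))%:A = (Y' i - Y i) / xi.
  move=> h; have /andP[_ lt] := val_index_le h.
  by rewrite cE inordK //= odd_double uphalf_double.
have orb : same_orbit (toric n) p (lift_pt xi c).
  apply/toric_orbitP; exists u, wp^-1, wm^-1; rewrite !invr_eq0; split=> // [i h|].
    rewrite lift_pt_even // lift_pt_odd // c0E // c1E // EY EY' /Z /Z'.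
    by split; field; rewrite ?wp0 ?wm0 oner_neq0 x0 L2.
  by rewrite /lift_pt !inordK // lift_wp lift_wm !mulVf.
exists c; split; last exact/orbitP.
  apply/not_existsP => c0; case/negP: z0.
  have cz j : c j = 0 by apply/eqP; rewrite -[_ == _]negbK; apply/negP/c0.
  have : Y i0 = (c (inord i0.*2))%:A - (1 + xi) * 2%:R^-1 * (c (inord i0.*2.+1))%:A.
    by rewrite c0E // c1E //; field; rewrite x0 L2.
  rewrite !cz scale0r mulr0 subr0 => /eqP.
  by rewrite EY /Z !mulf_eq0 (negPf u0) (negPf wp0).
have := Fhat_same_orbit orb p0; rewrite lift_pt_Fhat // => /eqP.
rewrite mulf_eq0 oppr_eq0 mulf_eq0 (negPf L2) (negPf x0) /= (fmorph_eq0 (in_alg L)).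
by move=> /eqP.
Qed.

End RationalPoints.

Section TwistedCount.
Variables (k : finFieldType) (L : fieldExtType k) (xi : L) (n d : nat).
Hypotheses (qs : quadratic_setting xi) (d0 : (0 < d)%N).
Local Notation q := #|k|.

Lemma Xtilde_points_cone : Xtilde_points xi n d =
  (fun c : {ffun 'I_n.*2.+2 -> k} => Defs.orbit (toric n) (lift_pt xi c)) @`
    [set` [set c : {ffun 'I_n.*2.+2 -> k} | (meval c (hypX k n d) == 0%R) && (c != [ffun=> 0%R])]%SET].
Proof.
case: (qs) => c2 c3 _ _ xi2.
apply/seteqP; split=> O /=.
  move=> /(Xtilde_descent qs)[c [[j cj] c0 ->]]; pose c' : {ffun 'I_n.*2.+2 -> k} := [ffun i => c i].
  have cc' : (c' : 'I_n.*2.+2 -> k) = c by apply: funext => i; rewrite ffunE.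
  exists c'; last by rewrite cc'.
  rewrite /= inE cc' c0 eqxx /=; apply: contraNneq cj => /ffunP/(_ j).
  by rewrite !ffunE => ->.
move=> [c]; rewrite /= inE => /andP[/eqP c0 cn] <-.
have toL m : m%:R != 0 :> k -> m%:R != 0 :> L.
  by move=> h; rewrite -(rmorph_nat (in_alg L)) fmorph_eq0.
have L2 : 2%:R != 0 :> L by apply: toL; apply: contraNN c2 => h; rewrite inE.
have L3 : 3%:R != 0 :> L by apply: toL; apply: contraNN c3 => h; rewrite inE.
apply: (Xtilde_lift_pt xi2 L2 L3) => //.
have [j cj] : exists j, c j != 0.
  apply/not_existsP => h; move/eqP: cn; apply; apply/ffunP => j; rewrite ffunE.
  by apply/eqP; rewrite -[_ == _]negbK; apply/negP/h.
exact: (lift_pt_semistable qs cj).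
Qed.

Lemma card_Xtilde_points : (q %% 6 = 5)%N -> gcdn (2 * d + 1) (q - 1) = 1%N ->
  (Xtilde_points xi n d #= `I_((q ^ (2 * n + 1) - 1) %/ (q - 1)))%card.
Proof.
move=> q6 cop; case: (qs) => c2 c3 _ _ xi2.
have k3 : 3%:R != 0 :> k by apply: contraNN c3 => h; rewrite inE.
have toL m : m%:R != 0 :> k -> m%:R != 0 :> L.
  by move=> h; rewrite -(rmorph_nat (in_alg L)) fmorph_eq0.
have L2 : 2%:R != 0 :> L by apply: toL; apply: contraNN c2 => h; rewrite inE.
have L3 := toL _ k3.
have q3 : ~~ (3 %| q - 1)%N by move: q6; move: #|k| => r; lia.
rewrite Xtilde_points_cone.
apply: (card_cone (P := fun c => meval c (hypX k n d) == 0)).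
- move=> c c'; rewrite orbitP; split; first exact: (lift_pt_orbit xi2 L2 L3).
  exact: lift_pt_dilate.
- rewrite (_ : ([ffun=> 0] : {ffun _ -> k}) = (fun=> 0) :> ('I_n.*2.+2 -> k)); first by rewrite hypX_0.
  by apply: funext => j; rewrite ffunE.
- move=> t c t0 /eqP c0; rewrite (_ : (dilate t c : 'I_n.*2.+2 -> k) = (fun j => t * c j)).
    by rewrite hypX_dilate c0 mulr0.
  by apply: funext => j; rewrite ffunE.
rewrite (@card_hypX_cone k n d) => [|v]; first exact: expn_geometric.
exact: form_fibres.
Qed.

End TwistedCount.

Theorem theorem1p1 (R : realType) (n d : nat) (hn : (1 <= n)%N) (hd : (1 <= d)%N) :
  (* (i) *)
  (forall (k : fieldType) (L : fieldExtType k) (xi : L), quadratic_setting xi ->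
    [/\ multihomog (toric n) (Fhat_class d) (Fhat n d xi) /\
          strict_transform n xi (hypX L n d) (Fhat n d xi),
        birational (Proj n.*2) 0 (Proj n.*2.+1) (hypX k n d) (phi k n d),
        exists psi : 'I_(nvar (toric n)) -> mpoly n.*2.+1 L,
          [/\ ratmap (Proj n.*2) 0 (Proj n.*2.+1) (hypX L n d)
                (mapcomp (blowdown n xi) psi),
              ratmap_eq (Proj n.*2) 0 (Proj n.*2.+1)
                (mapcomp (blowdown n xi) psi) (phi L n d),
              birational (Proj n.*2) 0 (toric n) (Fhat n d xi) psi &
              descends_to xi psi],
        birational (toric n) (Fhat n d xi) (Proj n.*2.+1) (hypX L n d)
          (blowdown n xi) /\ descends_from xi n d (blowdown n xi) &
        d = 1%N -> hypX k n d = fermat_cubic k n])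
  /\
  (* (ii), first part *)
  (forall (k : finFieldType) (L : fieldExtType k) (xi : L), quadratic_setting xi ->
    (#|k| %% 6 = 5)%N -> gcdn (2 * d + 1) (#|k| - 1) = 1%N ->
    (Xtilde_points xi n d #= cox_points (Proj n.*2) (0 : mpoly n.*2.+1 k))%card /\
    (Xtilde_points xi n d #= `I_((#|k| ^ (2 * n + 1) - 1) %/ (#|k| - 1)))%card)
  /\
  (* (ii), the surfaces (n = 1) over every finite field *)
  (forall (k : finFieldType) (p m : nat), prime p -> (0 < m)%N -> #|k| = (p ^ m)%N ->
    let q := #|k| in
    let s := gcdn (q - 1) (2 * d + 1) in
    let X2 := cox_points (Proj 3) (hypX k 1 d) in
    [/\ p <> 2%N -> p <> 3%N ->
          ((q %% 6 = 5)%N -> (X2 #= `I_(q ^ 2 + s * q + 1))%card) /\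
          ((q %% 6 = 1)%N -> (X2 #= `I_(q ^ 2 + (s + 4) * q + 1))%card),
        p = 3%N -> forall i g : nat, (2 * d + 1 = 3 ^ i * g)%N -> ~~ (3 %| g)%N ->
          (X2 #= `I_(gcdn g (q - 1) * q ^ 2 + q + 1))%card &
        p = 2%N ->
          (odd m -> (X2 #= `I_(q ^ 2 + s * q + 1))%card) /\
          (~~ odd m -> (X2 #= `I_(q ^ 2 + (s + 4) * q + 1))%card)])
  /\
  (* (iii) *)
  (forall (K : fieldExtType rat) (L : fieldExtType K) (xi : L),
    <<1; xi>>%VS = {:L}%VS -> xi ^+ 2 = - 3%:R ->
    (exists c B0 : R, 0 < c /\ forall B : R, B0 <= B ->
      ((c * B `^ ((2 * n + 1)%:R / (2 * d + 2)%:R))%:E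
        <= counting (Xtilde_points_le xi n d B))%E) /\
    (n = 1%N -> exists c B0 : R, 0 < c /\ forall B : R, B0 <= B ->
      ((c * B `^ (3%:R / (2 * d + 1)%:R))%:E
        <= counting (Xtilde_points_le xi n d B))%E)).
Proof.
split; first by move=> k L xi; apply: part_i.
split.
  move=> k L xi qs q6 cop; have cX := @card_Xtilde_points k L xi n d qs hd q6 cop; split=> //.
  by apply: card_eq_trans cX _; rewrite card_eq_sym; apply: cox_points_proj.
split; first by move=> k p m pp m0 kp; apply: surface_points.
move=> K L xi _ xi2; have [c [B0 [c0 bound]]] := @part_iii R n d K L xi hn hd xi2.
split; last move=> n1; exists c, B0; split=> // B hB; apply: bound => //.
  rewrite ler_pdivrMr ?ltr0n ?addn2 // -natrM ler_nat; nia.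
rewrite n1 ler_pdivrMr ?ltr0n ?addn1 // -natrM ler_nat; lia.
Qed.
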